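(* Let $\Delta$ be a four-dimensional thin lattice simplex that is not a free join. Then, up to isomorphism, either the code $C_\Delta$ over $\mathbb{Z}_{N_\Delta}$ is generated by the rows of one of the following six matrices $g_\Delta$ (sporadic cases; each is the code of a thin simplex, with the listed $N_\Delta$, $h^*$-polynomial, lattice width and spanning property): 1. $N_\Delta=2$, $g_\Delta=\begin{pmatrix}1&1&0&0&0\\0&1&1&0&0\\0&0&1&1&0\\0&0&0&1&1\end{pmatrix}$, $h^*(\Delta,t)=5t^2+10t+1$, width $2$, spanning; 2. $N_\Delta=3$, $g_\Delta=\begin{pmatrix}0&0&1&1&1\\1&2&0&1&2\end{pmatrix}$, $h^*(\Delta,t)=7t^2+t+1$, width $1$, not spanning; 3. $N_\Delta=4$, $g_\Delta=\begin{pmatrix}0&0&1&1&2\\2&2&1&3&0\end{pmatrix}$, $h^*(\Delta,t)=5t^2+2t+1$, width $1$, not spanning; 4. $N_\Delta=4$, $g_\Delta=\begin{pmatrix}0&1&1&1&1\\2&0&1&2&3\end{pmatrix}$, $h^*(\Delta,t)=t^3+11t^2+3t+1$, width $2$, not spanning; 5. $N_\Delta=4$, $g_\Delta=\begin{pmatrix}0&0&1&1&2\\2&2&0&2&2\\0&2&3&3&0\end{pmatrix}$, $h^*(\Delta,t)=9t^2+6t+1$, width $2$, spanning; 6. $N_\Delta=8$, $g_\Delta=\begin{pmatrix}4&0&1&2&1\\4&4&0&4&4\end{pmatrix}$, $h^*(\Delta,t)=t^3+11t^2+3t+1$, width $2$, not spanning; or $\Delta$ belongs to the following one-parameter family of non-spanning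 simplices of width $1$: for each even $N_\Delta\ge 2$ there is a thin simplex whose code over $\mathbb{Z}_{N_\Delta}$ is generated by the rows of $$g_\Delta=\begin{pmatrix}N_\Delta/2&0&N_\Delta/2&0&0\\0&N_\Delta/2&N_\Delta/2&1&N_\Delta-1\end{pmatrix},$$ with $h^*(\Delta,t)=\left(\tfrac{3N_\Delta}{2}-1\right)t^2+\tfrac{N_\Delta}{2}t+1$.
   Context: Let $M\cong\mathbb{Z}^d$ be a lattice and $\Delta$ a $d$-dimensional lattice simplex in $M\otimes\mathbb{R}$ with vertices $v_0,\dots,v_d\in M$. Two lattice simplices are isomorphic if an affine unimodular transformation of the lattice maps one to the other. The polynomial $h^*(\Delta,t)$ is defined by $1+\sum_{k\ge1}|k\Delta\cap M|t^k=h^*(\Delta,t)/(1-t)^{d+1}$. Let $\Pi_\Delta^\circ=\{\sum_{i=0}^d a_i(v_i,1):0<a_i<1\}$. The local $h^*$-polynomial is $l^*(\Delta,t)=\sum_{\lambda\in\Pi^\circ_\Delta\cap(M\oplus\mathbb{Z})}t^{\lambda_{d+1}}$, where $\lambda_{d+1}$ denotes the last coordinate. $\Delta$ is thin if $l^*(\Delta,t)=0$. The free join of lattice polytopes $\Delta_1,\Delta_2$ of dimensions $d_1,d_2\ge0$ is $\Delta_1\circ_{\mathbb{Z}}\Delta_2=\operatorname{conv}(\Delta_1\times\{0^{d_2}\}\times\{0\},\ \{0^{d_1}\}\times\Delta_2\times\{1\})\subset\mathbb{R}^{d_1+d_2+1}$; a simplex is called a free join if it is isomorphic to such a polytope (lattice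 pyramids are free joins with a point). Code of a simplex: $\mathbb{Z}_N=\mathbb{Z}/N\mathbb{Z}$. Let $\Lambda_\Delta=\{x\in(\mathbb{R}/\mathbb{Z})^{d+1}:\sum_i\{x_i\}(v_i,1)\in M\oplus\mathbb{Z}\}$, where $\{\cdot\}$ is the fractional part; this is a finite group. $N_\Delta$ is the least common multiple of the denominators of all coordinates of elements of $\Lambda_\Delta$, and $C_\Delta\subseteq\mathbb{Z}_{N_\Delta}^{d+1}$ is the $\mathbb{Z}_{N_\Delta}$-submodule $\{(N_\Delta\{x_0\},\dots,N_\Delta\{x_d\}):x\in\Lambda_\Delta\}$. Two codes over the same $\mathbb{Z}_N$ and of the same length are isomorphic if they coincide after a permutation of coordinates. Simplices are isomorphic if and only if their codes are. A lattice polytope $\Delta$ is spanning if every point of $M\oplus\mathbb{Z}$ is an integer linear combination of lattice points of $\Delta\times\{1\}$. The lattice width of $\Delta$ is the minimum of $\max_{x\in\Delta}u(x)-\min_{x\in\Delta}u(x)$ over all nonzero integer linear forms $u$. *)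

(* Defs.v *)
From mathcomp Require Import all_boot all_order all_fingroup all_algebra.
From mathcomp Require Import finmap.
From mathcomp Require Import all_classical all_reals.

Set Implicit Arguments.
Unset Strict Implicit.
Unset Printing Implicit Defensive.

Import Order.TTheory GRing.Theory Num.Theory.

Local Open Scope classical_set_scope.
Local Open Scope ring_scope.

(* The lattice M is Z^d, with points written as integer row vectors; M (x) R is
   'rV[R]_d, for R the field of real numbers.  A list of n points is an
   n x d matrix, one point per row. *)

Definition to_real (R : realType) (m n : nat) (A : 'M[int]_(m, n)) : 'M[R]_(m, n) :=
  map_mx intr A.

(* (v, 1) for every row v of A. *)
Definition homog (T : pzRingType) (n d : nat) (A : 'M[T]_(n, d)) : 'M[T]_(n, d + 1) :=
  row_mx A (const_mx 1).

(** Polytopes *)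

Definition conv_hull (R : realType) (d : nat) (A : set 'rV[R]_d) : set 'rV[R]_d :=
  [set x | exists n (p : 'M[R]_(n, d)) (a : 'rV[R]_n),
    [/\ forall i, A (row i p), forall i, 0 <= a 0 i,
        \sum_i a 0 i = 1 & x = a *m p]].

Definition polytope (R : realType) (n d : nat) (V : 'M[int]_(n, d)) : set 'rV[R]_d :=
  conv_hull (range (fun i => row i (to_real R V))).
Arguments polytope R {n d} V.

(* Full-dimensional lattice polytopes; the rank condition says that the points
   affinely span R^d. *)
Definition lattice_polytope (R : realType) (d : nat) (P : set 'rV[R]_d) : Prop :=
  exists n (V : 'M[int]_(n, d)),
    row_full (homog (to_real R V)) /\ P = polytope R V.

(* The rows of V are affinely independent, hence the vertices of a
   d-dimensional simplex. *)
Definition lattice_simplex (R : realType) (d : nat) (V : 'M[int]_(d.+1, d)) : Prop :=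
  row_free (homog (to_real R V)).

(* The two ambient dimensions are distinct variables, but the existence of a
   two-sided inverse of U forces them to be equal. *)
Definition unimodular_iso (R : realType) (m n : nat)
    (P : set 'rV[R]_m) (Q : set 'rV[R]_n) : Prop :=
  exists (U : 'M[int]_(m, n)) (U' : 'M[int]_(n, m)) (b : 'rV[int]_n),
    [/\ U *m U' = 1%:M, U' *m U = 1%:M &
        Q = [set x *m to_real R U + to_real R b | x in P]].

Definition free_join (R : realType) (d1 d2 : nat)
    (P1 : set 'rV[R]_d1) (P2 : set 'rV[R]_d2) : set 'rV[R]_(d1 + d2 + 1) :=
  conv_hull ([set row_mx (row_mx x (0 : 'rV_d2)) (0 : 'rV_1) | x in P1] `|`
             [set row_mx (row_mx (0 : 'rV_d1) y) (const_mx 1 : 'rV_1) | y in P2]).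

Definition is_free_join (R : realType) (d : nat) (P : set 'rV[R]_d) : Prop :=
  exists d1 d2 (P1 : set 'rV[R]_d1) (P2 : set 'rV[R]_d2),
    [/\ lattice_polytope P1, lattice_polytope P2 &
        unimodular_iso P (free_join P1 P2)].

Definition lattice_points (R : realType) (d : nat) (P : set 'rV[R]_d) : set 'rV[int]_d :=
  [set x | P (to_real R x)].

Definition spanning (R : realType) (d : nat) (P : set 'rV[R]_d) : Prop :=
  forall y : 'rV[int]_(d + 1), exists n (A : 'M[int]_(n, d)) (c : 'rV[int]_n),
    (forall i, lattice_points P (row i A)) /\ y = c *m homog A.

Definition width_along (R : realType) (d : nat) (P : set 'rV[R]_d) (u : 'cV[int]_d) : R :=
  sup [set (x *m to_real R u) 0 0 | x in P] - inf [set (x *m to_real R u) 0 0 | x in P].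

(* For a nonempty lattice polytope the widths along integer forms are natural
   numbers, so that this infimum is a minimum. *)
Definition lattice_width (R : realType) (d : nat) (P : set 'rV[R]_d) : R :=
  inf [set width_along P u | u in [set u : 'cV[int]_d | u != 0]].

(** The h*-polynomial and the local h*-polynomial *)

Definition ehrhart_coef (R : realType) (d : nat) (P : set 'rV[R]_d) (k : nat) : nat :=
  if k == 0%N then 1%N
  else #|` fset_set (lattice_points [set k%:R *: x | x in P]) |%N.

(* h is (1 - t)^(d + 1) times the Ehrhart series; the coefficient of t^n in this
   product of power series only depends on the first n + 1 terms of the series. *)
Definition is_hstar (R : realType) (d : nat) (P : set 'rV[R]_d) (h : {poly int}) : Prop :=
  forall n, h`_n =
    ((1 - 'X) ^+ d.+1 * \poly_(k < n.+1) ((ehrhart_coef P k)%:Z))`_n.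

Definition open_box_points (R : realType) (d : nat) (V : 'M[int]_(d.+1, d)) :
    set 'rV[int]_(d + 1) :=
  [set l | exists a : 'rV[R]_d.+1,
    (forall i, 0 < a 0 i < 1) /\ to_real R l = a *m homog (to_real R V)].

(* The last coordinates of the points of the open box are positive, so that
   taking absolute values only converts from int to nat. *)
Definition local_hstar (R : realType) (d : nat) (V : 'M[int]_(d.+1, d)) : {poly int} :=
  \sum_(l \in open_box_points R V) ('X^(absz (l 0 (rshift d 0))) : {poly int}).

Definition thin (R : realType) (d : nat) (V : 'M[int]_(d.+1, d)) : Prop :=
  local_hstar R V = 0.

(** Codes *)

Definition frac_part (R : realType) (x : R) : R := x - (Num.floor x)%:~R.

(* Elements of (R/Z)^(d+1) are given by all their representatives in R^(d+1). *)
Definition Lambda (R : realType) (d : nat) (V : 'M[int]_(d.+1, d)) : set 'rV[R]_d.+1 :=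
  [set x | exists l : 'rV[int]_(d + 1),
    map_mx (@frac_part R) x *m homog (to_real R V) = to_real R l].
Arguments Lambda R {d} V.

Definition denominators (R : realType) (d : nat) (V : 'M[int]_(d.+1, d)) : set nat :=
  [set n | exists2 x, Lambda R V x &
    exists i (q : rat), x 0 i = ratr q /\ n = absz (denq q)].

Definition code_modulus (R : realType) (d : nat) (V : 'M[int]_(d.+1, d)) : nat :=
  \big[lcmn/1%N]_(n \in denominators R V) n.

(* N {x_i} is an integer, and Num.floor only converts it from R to int.
   Beware that 'Z_1 is Z/2Z, so that the type of codes is the intended one only
   if the code modulus is at least 2. *)
Definition simplex_code (R : realType) (d : nat) (V : 'M[int]_(d.+1, d)) :
    set 'rV['Z_(code_modulus R V)]_d.+1 :=
  [set map_mx (fun t : R => (Num.floor ((code_modulus R V)%:R * frac_part t))%:~R) x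
    | x in Lambda R V].
Arguments simplex_code R {d} V.

Definition code_iso (N n : nat) (C D : set 'rV['Z_N]_n) : Prop :=
  exists s : 'S_n, D = [set col_perm s c | c in C].

(* The 'Z_N-submodule spanned by the rows of the matrix with row list g. *)
Definition generated_code (N n : nat) (g : seq (seq nat)) : set 'rV['Z_N]_n :=
  range (fun a : 'rV['Z_N]_(size g) =>
    a *m \matrix_(i, j) (nth 0%N (nth [::] g i) j)%:R).

(** The classification *)

Record simplex_data := SimplexData {
  data_modulus : nat;
  data_gens : seq (seq nat);
  data_hstar : {poly int};
  data_width : nat;
  data_spanning : bool }.

Definition has_data (R : realType) (d : nat) (V : 'M[int]_(d.+1, d))
    (e : simplex_data) : Prop :=
  [/\ code_modulus R V = data_modulus e,
      code_iso (simplex_code R V) (generated_code (data_gens e)),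
      is_hstar (polytope R V) (data_hstar e),
      lattice_width (polytope R V) = (data_width e)%:R &
      spanning (polytope R V) <-> data_spanning e].

Definition sporadic : 6.-tuple simplex_data :=
  [tuple
    SimplexData 2 [:: [:: 1; 1; 0; 0; 0];
                      [:: 0; 1; 1; 0; 0];
                      [:: 0; 0; 1; 1; 0];
                      [:: 0; 0; 0; 1; 1]]%N
      (5 *: 'X^2 + 10 *: 'X + 1) 2 true;
    SimplexData 3 [:: [:: 0; 0; 1; 1; 1];
                      [:: 1; 2; 0; 1; 2]]%N
      (7 *: 'X^2 + 'X + 1) 1 false;
    SimplexData 4 [:: [:: 0; 0; 1; 1; 2];
                      [:: 2; 2; 1; 3; 0]]%N
      (5 *: 'X^2 + 2 *: 'X + 1) 1 false;
    SimplexData 4 [:: [:: 0; 1; 1; 1; 1];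
                      [:: 2; 0; 1; 2; 3]]%N
      ('X^3 + 11 *: 'X^2 + 3 *: 'X + 1) 2 false;
    SimplexData 4 [:: [:: 0; 0; 1; 1; 2];
                      [:: 2; 2; 0; 2; 2];
                      [:: 0; 2; 3; 3; 0]]%N
      (9 *: 'X^2 + 6 *: 'X + 1) 2 true;
    SimplexData 8 [:: [:: 4; 0; 1; 2; 1];
                      [:: 4; 4; 0; 4; 4]]%N
      ('X^3 + 11 *: 'X^2 + 3 *: 'X + 1) 2 false].

Definition thin_family (N : nat) : simplex_data :=
  SimplexData N [:: [:: N %/ 2; 0; N %/ 2; 0; 0];
                    [:: 0; N %/ 2; N %/ 2; 1; N - 1]]%N
    (((3 * N) %/ 2 - 1)%N%:R *: 'X^2 + (N %/ 2)%N%:R *: 'X + 1) 1 false.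

(* Main.v *)
Require Import Defs.
From mathcomp Require Import all_boot all_order all_algebra all_fingroup finmap.
From mathcomp Require Import all_classical all_reals.
From mathcomp Require Import ring lra zify.

(** Let G be the group of all real row vectors x of length 5 such that
    sum_i x_i (v_i, 1) is integral; it contains Z^5 and its image modulo Z^5 is
    the group Lambda.  The simplex is thin exactly when every x in G has an
    integral coordinate, so that the subgroups {x_i integral} cover G.  Take a
    minimal set I of coordinates whose subgroups still cover G, and number the
    coordinates so that I = {i < n}.  By minimality there are, for each i in I,
    elements of G whose only integral coordinate within I is the i-th.
    - n = 0 and n = 2 are impossible, and n = 1 means that the simplex is a
      lattice pyramid.
    - For n = 3 the coordinates in I are half-integral and add up to an integer.
      Let 1/m generate the values of the coordinate 3 modulo Z.  If (0, 0, 0, 1/m,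
      -1/m) is in G, then G is the group of a free join of a triangle and a
      segment; otherwise m is even and G is the group of the family with N = m.
    - For n = 4, 5 a pigeonhole argument over the translates x + k y shows that
      24 annihilates G modulo Z^5, and the same count restricts the words with
      entries modulo 24 enough for an exhaustive search: adjoin one element for
      each i in I, discarding groups with an element having no integral
      coordinate in I.  What remains are the sporadic codes.
    All listed invariants can be read off G: the h*-polynomial counts the elements
    of the half-open box by height, integral affine forms on the lattice are the
    vectors dual to G, and the simplex is spanning when the elements of height 1
    generate G. *)

Set Implicit Arguments.
Unset Strict Implicit.
Unset Printing Implicit Defensive.

Import Order.TTheory GRing.Theory Num.Theory.

Local Open Scope classical_set_scope.
Local Open Scope ring_scope.

(** What separates the finite cases from the family is the number of coordinates outside the
    covering set I. The coordinates of an element of G add up to an integer, because the vertices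
    enter as (v_i, 1). If at most one coordinate lies outside I, integrality on I thus gives
    integrality everywhere, and bounding orders within I bounds the exponent of G. For n = 3 two
    coordinates lie outside; they can carry a cyclic group of any order, which produces the
    one-parameter family. The number 24 arises from iterating the pigeonhole: each round multiplies
    y by some j not exceeding the size of its support and makes the support smaller. This gives 4 or
    6 for n = 4, and 16, 18 or 24 for n = 5, where divisibility of digits lowers 16 and 18 to 8 and
    6. The search need not end exactly at a listed code. Reaching a group that contains one is
    enough, since any further candidate word adjoined to a listed code creates an element without
    integral covering coordinate. Working in R^5 instead of its quotient by Z^5 makes membership in
    G a linear condition; fractional parts appear only where the box and the code require them. *)

Definition simplex_lattice (R : realType) (d : nat) (V : 'M[int]_(d.+1, d)) :
    set 'rV[R]_d.+1 :=
  [set x | exists l, x *m homog (to_real R V) = to_real R l].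
Arguments simplex_lattice R {d} V.

Definition barycentric (R : realType) (n : nat) : set 'rV[R]_n :=
  [set a | (forall i, 0 <= a 0 i) /\ \sum_i a 0 i = 1].
Arguments barycentric R n : clear implicits.

(** * The lattice of a simplex in barycentric coordinates *)

Section Lattice.
Variable R : realType.

Lemma to_realM m n p (A : 'M[int]_(m, n)) (B : 'M[int]_(n, p)) :
  to_real R (A *m B) = to_real R A *m to_real R B.
Proof. exact: map_mxM. Qed.

Lemma to_real_inj m n : injective (@to_real R m n).
Proof.
move=> A B /matrixP h; apply/matrixP => i j.
by have := h i j; rewrite !mxE => /intr_inj.
Qed.

Lemma homog_to_real n d (A : 'M[int]_(n, d)) :
  homog (to_real R A) = to_real R (homog A).
Proof. by rewrite /homog /to_real map_row_mx map_const_mx. Qed.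

Lemma mul_homog n d (x : 'rV[R]_n) (A : 'M[R]_(n, d)) :
  x *m homog A = row_mx (x *m A) (const_mx (\sum_i x 0 i)).
Proof.
rewrite /homog mul_mx_row; congr row_mx.
apply/rowP => j; rewrite !mxE; apply: eq_bigr => i _.
by rewrite !mxE mulr1.
Qed.

Lemma int_row n (x : 'rV[R]_n) :
  (forall i, x 0 i \is a Num.int) -> exists l, x = to_real R l.
Proof.
move=> h; exists (map_mx Num.floor x); apply/rowP => i.
by rewrite !mxE floorK.
Qed.

Lemma to_real_int m n (A : 'M[int]_(m, n)) i j : to_real R A i j \is a Num.int.
Proof. by rewrite mxE intr_int. Qed.

Lemma to_realD m n (A B : 'M[int]_(m, n)) :
  to_real R (A + B) = to_real R A + to_real R B.
Proof. exact: map_mxD. Qed.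

Lemma to_realN m n (A : 'M[int]_(m, n)) : to_real R (- A) = - to_real R A.
Proof. exact: map_mxN. Qed.

Section Basic.
Variables (d : nat) (V : 'M[int]_(d.+1, d)).
Local Notation G := (simplex_lattice R V).
Local Notation M := (homog (to_real R V)).

Lemma lattice0 : G 0.
Proof. by exists 0; rewrite mul0mx /to_real map_mx0. Qed.

Lemma latticeD x y : G x -> G y -> G (x + y).
Proof.
move=> [l hl] [m hm]; exists (l + m).
by rewrite mulmxDl hl hm to_realD.
Qed.

Lemma latticeN x : G x -> G (- x).
Proof. by move=> [l hl]; exists (- l); rewrite mulNmx hl to_realN. Qed.

Lemma latticeB x y : G x -> G y -> G (x - y).
Proof. by move=> hx hy; apply: latticeD => //; exact: latticeN. Qed.

Lemma latticeMn x k : G x -> G (x *+ k).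
Proof.
move=> hx; elim: k => [|k IH]; first by rewrite mulr0n; exact: lattice0.
by rewrite mulrS; exact: latticeD.
Qed.

Lemma latticeMz x k : G x -> G (x *~ k).
Proof.
move=> hx; case: k => k; first exact: latticeMn.
by rewrite NegzE mulrNz; apply: latticeN; exact: latticeMn.
Qed.

Lemma lattice_sum (I : Type) (r : seq I) (P : pred I) (F : I -> 'rV[R]_d.+1) :
  (forall i, P i -> G (F i)) -> G (\sum_(i <- r | P i) F i).
Proof. by move=> h; elim/big_ind: _ => //; [exact: lattice0|exact: latticeD]. Qed.

Lemma lattice_int (x : 'rV[R]_d.+1) : (forall i, x 0 i \is a Num.int) -> G x.
Proof.
move=> /int_row[l ->]; exists (l *m homog V).
by rewrite to_realM homog_to_real.
Qed.

Lemma lattice_coord_sum x : G x -> \sum_i x 0 i \is a Num.int.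
Proof.
move=> [l]; rewrite mul_homog => /rowP /(_ (rshift d 0)).
by rewrite row_mxEr !mxE => ->.
Qed.

Lemma lattice_congr (x y : 'rV[R]_d.+1) : (forall i, x 0 i - y 0 i \is a Num.int) -> G x -> G y.
Proof.
move=> h hx; have -> : y = x - (x - y) by rewrite opprB addrC subrK.
by apply: latticeB => //; apply: lattice_int => i; rewrite !mxE.
Qed.

Lemma frac_part_int (x : R) : x - frac_part x \is a Num.int.
Proof. by rewrite /frac_part opprB addrC subrK intr_int. Qed.

Lemma frac_part_ge0 (x : R) : 0 <= frac_part x.
Proof. by rewrite subr_ge0 floor_le. Qed.

Lemma frac_part_lt1 (x : R) : frac_part x < 1.
Proof. by rewrite ltrBlDl -[1]/(1%:~R) -intrD floorD1_gt. Qed.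

Lemma Lambda_lattice : Lambda R V = G.
Proof.
apply/seteqP; split => x /=.
- move=> hx; apply: (@lattice_congr (map_mx (@frac_part R) x)) => // i.
  by rewrite mxE -opprB rpredN frac_part_int.
- apply: lattice_congr => i.
  by rewrite mxE frac_part_int.
Qed.

End Basic.
End Lattice.

Lemma finite_int_box (n B : nat) :
  finite_set [set l : 'rV[int]_n | forall j, `|l 0 j| <= B%:Z].
Proof.
pose f (g : {ffun 'I_n -> 'I_(B + B).+1}) : 'rV[int]_n :=
  \row_j ((g j : nat)%:Z - B%:Z).
apply: (@sub_finite_set _ _ (f @` setT)); last first.
  by apply: finite_image; exact: finite_finset.
move=> l /= hl; exists [ffun j => inord (absz (l 0 j + B%:Z))] => //.
apply/rowP => j; rewrite !mxE ffunE inordK; have := hl j; lia.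
Qed.

(** * Thinness as a covering of the lattice *)

Section Thin.
Variables (R : realType) (d : nat) (V : 'M[int]_(d.+1, d)).
Local Notation G := (simplex_lattice R V).

(** A sum over a set with infinite support is 0 by convention, so finiteness is what makes the
    vanishing of [local_hstar] say something about points. The coordinates are bounded because the
    coefficients lie between 0 and 1. *)
Lemma open_box_finite : finite_set (open_box_points R V).
Proof.
pose B := (\sum_i \sum_j absz (homog V i j))%N.
apply: (sub_finite_set _ (@finite_int_box (d + 1) B)) => l /= [a [ha hl]] j.
have : (`|l 0 j|)%:~R <= (B%:Z)%:~R :> R.
  rewrite intr_norm; have -> : (l 0 j)%:~R = to_real R l 0 j by rewrite mxE.
  rewrite hl homog_to_real mxE.
  apply: le_trans (ler_norm_sum _ _ _) _.
  rewrite /B -pmulrn natr_sum; apply: ler_sum => i _.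
  rewrite natr_sum (bigD1 j) //= -[leLHS]addr0 lerD //; last first.
    by apply: sumr_ge0 => k _; exact: ler0n.
  rewrite normrM [to_real _ _ i j]mxE natr_absz intr_norm.
  rewrite -[leRHS]mul1r ler_wpM2r //.
  by have /andP[h1 h2] := ha i; rewrite ger0_norm ltW.
by rewrite ler_int.
Qed.

Lemma thin_lattice :
  thin R V <-> forall x, G x -> exists i, x 0 i \is a Num.int.
Proof.
split=> [ht x hx|h]; last first.
  rewrite /thin /local_hstar.
  suff -> : open_box_points R V = set0 by rewrite fsbig_set0.
  apply/seteqP; split => // l [a [ha hl]].
  have [|i] := h a; first by exists l.
  move=> /intrP[m hm]; have := ha i; rewrite hm.
  rewrite -[0]/(0%:~R) -[1]/(1%:~R) !ltr_int; lia.
apply: contrapT => hn.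
pose y : 'rV[R]_d.+1 := map_mx (@frac_part R) x.
have : Lambda R V x by rewrite Lambda_lattice.
move=> [l hl].
have hmem : open_box_points R V l.
  exists y; split=> // i; rewrite mxE frac_part_lt1 andbT lt_def frac_part_ge0 andbT.
  apply/negP => /eqP h0; apply: hn; exists i.
  by have := frac_part_int (x 0 i); rewrite h0 subr0.
move: ht; rewrite /thin /local_hstar fsbig_finite; last exact: open_box_finite.
(* All coefficients are nonnegative, so nothing cancels: the value at 1 counts the box points, and l
   is one of them. *)
move=> /(congr1 (fun p : {poly int} => p.[1])).
rewrite horner_sum horner0.
under eq_bigr => i _ do rewrite hornerXn expr1n.
rewrite (big_fsetD1 l) /=; last by rewrite in_fset_set ?inE //; exact: open_box_finite.
move=> h; have : (0 : int) < 0 by rewrite -[ltRHS]h ltr_pwDl // sumr_ge0.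
by rewrite ltxx.
Qed.

End Thin.

(** * Convex hulls and barycentric coordinates *)

Section Hull.
Variable R : realType.

Lemma barycentric_mul m n (a : 'rV[R]_m) (B : 'M[R]_(m, n)) :
  barycentric R m a -> (forall i, barycentric R n (row i B)) ->
  barycentric R n (a *m B).
Proof.
move=> [a0 a1] hB; split=> [i|].
  rewrite mxE; apply: sumr_ge0 => j _; apply: mulr_ge0 => //.
  by have [/(_ i)] := hB j; rewrite mxE.
under eq_bigr => i _ do rewrite mxE.
rewrite exchange_big /= -a1; apply: eq_bigr => j _.
rewrite -mulr_sumr; have [_ h] := hB j.
by rewrite -[RHS]mulr1 -h; congr (_ * _); apply: eq_bigr => i _; rewrite mxE.
Qed.

(** Convex combinations of convex combinations give nothing new. The set A may be anything between
    the rows and their hull, because a free join is the hull of two whole polytopes and not of a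
    list of vertices. *)
Lemma conv_hull_rows n d (p : 'M[R]_(n, d)) (A : set 'rV[R]_d) :
  (forall i, A (row i p)) ->
  (forall x, A x -> exists2 a, barycentric R n a & x = a *m p) ->
  conv_hull A = [set a *m p | a in barycentric R n].
Proof.
move=> h1 h2; apply/seteqP; split=> x.
  move=> [m [q [a [hq a0 a1 ->]]]].
  have /choice[f hf] : forall i, exists b, barycentric R n b /\ row i q = b *m p.
    by move=> i; have [b hb e] := h2 _ (hq i); exists b.
  exists (a *m (\matrix_i f i)).
    by apply: barycentric_mul => // i; rewrite rowK; have [] := hf i.
  rewrite -mulmxA; congr (_ *m _); apply/row_matrixP => i.
  by rewrite row_mul rowK; have [] := hf i.
move=> [a [a0 a1] <-]; by exists n, p, a.
Qed.

Lemma barycentric_delta n (i : 'I_n) : barycentric R n (delta_mx 0 i).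
Proof.
split=> [j|]; first by rewrite mxE ler0n.
rewrite (bigD1 i) //= big1 => [|j /negPf hj]; first by rewrite addr0 mxE !eqxx.
by rewrite mxE hj andbF.
Qed.

Lemma polytopeE n d (V : 'M[int]_(n, d)) :
  polytope R V = [set a *m to_real R V | a in barycentric R n].
Proof.
apply: conv_hull_rows => [i|x]; first by exists i.
move=> [i _ <-]; exists (delta_mx 0 i); first exact: barycentric_delta.
by rewrite -rowE.
Qed.

End Hull.

(** * The lattice of a simplex determines it up to isomorphism *)

Section Inverse.
Variables (R : realType) (d : nat) (V : 'M[int]_(d.+1, d)).
Hypothesis hV : lattice_simplex R V.
Local Notation M := (homog (to_real R V)).

(** The dimensions [d.+1] and [d + 1] are equal but not convertible, hence a pseudo-inverse in place
    of an inverse. Its rows form a basis of the lattice. *)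
Definition vertex_inv : 'M[R]_(d + 1, d.+1) := pinvmx M.

Lemma mul_vertex_inv : M *m vertex_inv = 1%:M.
Proof. exact: mulmxVp. Qed.

Lemma vertex_invM : vertex_inv *m M = 1%:M.
Proof.
by apply: mulVpmx; rewrite /row_full (eqP hV) addn1.
Qed.

Lemma vertex_inv_lattice i : simplex_lattice R V (row i vertex_inv).
Proof.
exists (row i 1%:M); rewrite -row_mul vertex_invM.
by apply/rowP => j; rewrite !mxE; case: (_ == _).
Qed.

Lemma lattice_dual (y : 'cV[R]_d.+1) :
  (forall x, simplex_lattice R V x -> (x *m y) 0 0 \is a Num.int) ->
  exists w : 'cV[int]_(d + 1), y = M *m to_real R w.
Proof.
move=> h; exists (map_mx Num.floor (vertex_inv *m y)).
have -> : to_real R (map_mx Num.floor (vertex_inv *m y)) = vertex_inv *m y.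
  apply/matrixP => i j; rewrite ord1 2!mxE floorK //.
  by have := h _ (vertex_inv_lattice i); rewrite -row_mul mxE.
by rewrite mulmxA mul_vertex_inv mul1mx.
Qed.

End Inverse.

Section Isomorphism.
Variables (R : realType) (d : nat).
Implicit Types V W : 'M[int]_(d.+1, d).

(** The linear map taking each (v_i, 1) to (w_i, 1) is integral, since the rows of the inverse of
    (V, 1) lie in the lattice of W as well. It preserves the last coordinate, so it is an affine map
    with linear part U and translation b. *)
Lemma transition_matrix V W : lattice_simplex R V -> lattice_simplex R W ->
  simplex_lattice R V `<=` simplex_lattice R W ->
  exists U b, to_real R (block_mx U 0 b 1%:M) = vertex_inv R V *m homog (to_real R W).
Proof.
move=> hV hW sub; set Q := vertex_inv R V.
have /choice[f hf] : forall i, exists l, row i Q *m homog (to_real R W) = to_real R l.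
  by move=> i; apply: sub; exact: vertex_inv_lattice.
have hT : to_real R (\matrix_i f i) = Q *m homog (to_real R W).
  apply/row_matrixP => i; rewrite row_mul hf /to_real.
  by apply/rowP => j; rewrite !mxE.
exists (usubmx (lsubmx (\matrix_i f i))), (dsubmx (lsubmx (\matrix_i f i))).
rewrite -hT; congr (to_real R _); rewrite block_mxEh vsubmxK -[RHS]hsubmxK; congr row_mx.
apply/esym; apply: (@to_real_inj R); rewrite /to_real map_rsubmx -/(to_real R _) hT.
have -> : rsubmx (Q *m homog (to_real R W)) = rsubmx (Q *m homog (to_real R V)).
  by rewrite /homog !mul_mx_row !row_mxKr.
rewrite vertex_invM // scalar_mx_block block_mxEh row_mxKr.
by rewrite map_col_mx map_mx0 map_mx1.
Qed.

Lemma barycentric_mul1 n (a : 'rV[R]_n) :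
  barycentric R n a -> a *m const_mx 1 = 1%:M.
Proof.
move=> [_ h]; apply/matrixP => i j; rewrite !ord1 mxE [RHS]mxE eqxx -[RHS]h.
by apply: eq_bigr => k _; rewrite mxE mulr1.
Qed.

Lemma polytope_affine V W (U : 'M[int]_d) (b : 'rV[int]_d) :
  to_real R W = to_real R V *m to_real R U + const_mx 1 *m to_real R b ->
  polytope R W = [set x *m to_real R U + to_real R b | x in polytope R V].
Proof.
move=> hW; rewrite !polytopeE.
have e a : barycentric R _ a ->
    a *m to_real R W = (a *m to_real R V) *m to_real R U + to_real R b.
  by move=> ha; rewrite hW mulmxDr !mulmxA barycentric_mul1 // mul1mx.
apply/seteqP; split=> x.
  by move=> [a ha <-]; exists (a *m to_real R V); [exists a|rewrite e].
by move=> [_ [a ha <-] <-]; exists a => //; rewrite e.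
Qed.

Lemma lattice_iso V W : lattice_simplex R V -> lattice_simplex R W ->
  simplex_lattice R V = simplex_lattice R W ->
  unimodular_iso (polytope R V) (polytope R W).
Proof.
move=> hV hW e.
have [U [b hT]] : exists U b, to_real R (block_mx U 0 b 1%:M)
    = vertex_inv R V *m homog (to_real R W) by apply: transition_matrix => //; rewrite e.
have [U' [b' hT']] : exists U b, to_real R (block_mx U 0 b 1%:M)
    = vertex_inv R W *m homog (to_real R V) by apply: transition_matrix => //; rewrite e.
have hUU' : block_mx U 0 b 1%:M *m block_mx U' 0 b' 1%:M = 1%:M.
  apply: (@to_real_inj R); rewrite to_realM hT hT' -mulmxA (mulmxA (homog _)).
  by rewrite mul_vertex_inv // mul1mx vertex_invM // /to_real map_mx1.
have hU'U : block_mx U' 0 b' 1%:M *m block_mx U 0 b 1%:M = 1%:M.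
  apply: (@to_real_inj R); rewrite to_realM hT hT' -mulmxA (mulmxA (homog _)).
  by rewrite mul_vertex_inv // mul1mx vertex_invM // /to_real map_mx1.
exists U, U', b; split.
- by move: hUU'; rewrite mulmx_block scalar_mx_block => /eq_block_mx[]; rewrite mul0mx addr0.
- by move: hU'U; rewrite mulmx_block scalar_mx_block => /eq_block_mx[]; rewrite mul0mx addr0.
apply: polytope_affine.
have : homog (to_real R V) *m to_real R (block_mx U 0 b 1%:M) = homog (to_real R W).
  by rewrite hT mulmxA mul_vertex_inv // mul1mx.
rewrite /homog /to_real map_block_mx block_mxEh mul_mx_row !mul_row_col.
by move=> /eq_row_mx[<- _].
Qed.

End Isomorphism.

(** This is [simplex_code] with the modulus as a free parameter. The modulus occurs in the type of a
    code, so it can be rewritten only after this abstraction. *)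
Definition code_at (R : realType) (n N : nat) (L : set 'rV[R]_n) : set 'rV['Z_N]_n :=
  [set map_mx (fun t : R => (Num.floor (N%:R * frac_part t))%:~R) x | x in L].
Arguments code_at {R n} N L.

(** * Renumbering the vertices *)

Section Permutation.
Variables (R : realType) (d : nat) (s : 'S_d.+1) (V : 'M[int]_(d.+1, d)).

Lemma polytope_row_perm : polytope R (row_perm s V) = polytope R V.
Proof.
rewrite /polytope; congr conv_hull; apply/seteqP; split=> _ [i _ <-].
  by exists (s i) => //; apply/rowP => j; rewrite !mxE.
by exists ((s^-1)%g i) => //; apply/rowP => j; rewrite !mxE permKV.
Qed.

Lemma homog_row_perm :
  homog (to_real R (row_perm s V)) = row_perm s (homog (to_real R V)).
Proof.
rewrite /homog [RHS]row_permE mul_mx_row -!row_permE; congr row_mx.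
  by apply/matrixP => i j; rewrite !mxE.
by apply/matrixP => i j; rewrite !mxE.
Qed.

Lemma simplex_row_perm : lattice_simplex R V -> lattice_simplex R (row_perm s V).
Proof.
rewrite /lattice_simplex homog_row_perm row_permE /row_free.
by rewrite eqmxMfull // row_full_unit unitmx_perm.
Qed.

Lemma lattice_row_perm x :
  simplex_lattice R (row_perm s V) (col_perm s x) <-> simplex_lattice R V x.
Proof.
rewrite /simplex_lattice /= homog_row_perm.
by rewrite mul_col_perm -row_permM mulVg row_perm1.
Qed.

Lemma lattice_row_permE :
  simplex_lattice R (row_perm s V) = [set col_perm s x | x in simplex_lattice R V].
Proof.
apply/seteqP; split=> x; last by move=> [y hy <-]; apply/lattice_row_perm.
have e : col_perm s (col_perm s^-1 x) = x by rewrite -col_permM mulgV col_perm1.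
by rewrite -[in X in X -> _]e => /lattice_row_perm hy; exists (col_perm s^-1 x).
Qed.

Lemma denominators_row_perm : denominators R (row_perm s V) = denominators R V.
Proof.
rewrite /denominators !Lambda_lattice lattice_row_permE.
apply/seteqP; split=> n.
  move=> [_ [x hx <-] [i [q [hq ->]]]]; exists x => //; exists (s i), q.
  by split=> //; rewrite -hq mxE.
move=> [x hx [i [q [hq ->]]]]; exists (col_perm s x); first by exists x.
by exists ((s^-1)%g i), q; rewrite mxE permKV.
Qed.

Lemma code_at_col_perm N (L : set 'rV[R]_d.+1) :
  code_at N [set col_perm s x | x in L] = [set col_perm s c | c in code_at N L].
Proof.
apply/seteqP; split=> c.
  move=> [_ [x hx <-] <-]; exists (map_mx (fun t => (Num.floor (N%:R * frac_part t))%:~R) x).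
    by exists x.
  by apply/rowP => j; rewrite !mxE.
move=> [_ [x hx <-] <-]; exists (col_perm s x); first by exists x.
by apply/rowP => j; rewrite !mxE.
Qed.

Lemma has_data_row_perm e : has_data R (row_perm s V) e -> has_data R V e.
Proof.
rewrite /has_data polytope_row_perm => -[h1 h2 h3 h4 h5].
have eN : code_modulus R (row_perm s V) = code_modulus R V.
  by rewrite /code_modulus denominators_row_perm.
split=> //; first by rewrite -eN.
have {h2} : code_iso (@code_at R d.+1 (code_modulus R (row_perm s V))
      (Lambda R (row_perm s V))) (generated_code (data_gens e)) by [].
rewrite eN Lambda_lattice lattice_row_permE code_at_col_perm -Lambda_lattice.
move=> [t ->]; exists (t * s)%g.
by rewrite image_comp; apply: eq_imagel => c _ /=; rewrite col_permM.
Qed.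

End Permutation.

Local Close Scope classical_set_scope.

Local Notation o k := (@Ordinal 5 k isT).
Local Notation segment n := [set i : 'I_5 | (i < n)%N].

(** * Minimal coverings *)

Lemma perm_initial_segment m (I : {set 'I_m}) :
  exists s : 'S_m, forall i, (s i \in I) = (i < #|I|)%N.
Proof.
pose t := enum I ++ enum (~: I).
have st : size t = m by rewrite size_cat -!cardE cardsC card_ord.
have ut : uniq t.
  rewrite cat_uniq !enum_uniq andbT /=; apply/hasPn => i.
  by rewrite !mem_enum inE.
have tE : t = enum I ++ enum (~: I) by [].
case: m I t tE st ut => [|m] I t tE st ut; first by exists 1%g => -[].
have inj : injective (fun i : 'I_m.+1 => nth ord0 t i).
  by move=> i j /eqP; rewrite nth_uniq ?st // => /eqP /val_inj.
exists (perm inj) => i; rewrite permE tE nth_cat -cardE; case: ltnP => h.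
  by rewrite -mem_enum mem_nth // -cardE.
apply/negbTE; rewrite -finset.in_setC -mem_enum mem_nth // -cardE.
by rewrite -(ltn_add2r #|I|) subnK // addnC cardsC card_ord.
Qed.

(** The elements of K agree modulo q = m / gcd(a, m), so the quotient by q, which is below gcd(a,
    m), tells them apart. *)
Lemma card_residue_class m a (K : {set 'I_m}) : (0 < m)%N ->
  (forall k l : 'I_m, k \in K -> l \in K -> (k <= l)%N -> (m %| (l - k) * a)%N) ->
  (#|K| <= gcdn a m)%N.
Proof.
move=> m0 h; set g := gcdn a m; set q := (m %/ g)%N.
have g0 : (0 < g)%N by rewrite gcdn_gt0 m0 orbT.
have mE : m = (q * g)%N by rewrite divnK // dvdn_gcdr.
have q0 : (0 < q)%N by rewrite divn_gt0 // dvdn_leq // dvdn_gcdr.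
have hq (k l : 'I_m) : k \in K -> l \in K -> (k <= l)%N -> (q %| l - k)%N.
  move=> kK lK kl; have := h _ _ kK lK kl.
  have aE : a = (a %/ g * g)%N by rewrite divnK // dvdn_gcdl.
  rewrite {1}mE {1}aE mulnA dvdn_pmul2r // Gauss_dvdl //.
  by rewrite coprime_sym /coprime -(eqn_pmul2r g0) mul1n muln_gcdl -aE -mE.
have hd (k : 'I_m) : (k %/ q < g)%N by rewrite ltn_divLR // mulnC -mE.
pose f (k : 'I_m) : 'I_g := Ordinal (hd k).
rewrite -[leqRHS]card_ord -(card_in_imset (f := f)); first exact: max_card.
move=> k l kK lK /(congr1 val) /= e.
wlog kl : k l kK lK e / (k <= l)%N.
  by move=> W; case/orP: (leq_total k l) => kl; [|symmetry]; apply: W.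
have /dvdnP[c hc] := hq _ _ kK lK kl; apply: val_inj => /=.
have lE : (l = k + c * q :> nat)%N by rewrite -hc subnKC.
move: e; rewrite lE addnC divnMDl // => e; have -> : c = 0%N by lia.
by rewrite mul0n.
Qed.

Section Cover.
Variables (R : realType) (d : nat).
Implicit Types (V : 'M[int]_(d.+1, d)) (I : {set 'I_d.+1}).

Definition covers V I :=
  forall x, simplex_lattice R V x -> exists2 i, i \in I & x 0 i \is a Num.int.

(** Minimality is recorded through its witnesses: x is not covered once i is removed. That x is
    integral at i then follows from the covering. *)
Definition minimal_cover V I := covers V I /\
  forall i, i \in I -> exists2 x, simplex_lattice R V x &
    forall j, j \in I -> x 0 j \is a Num.int -> j = i.

Lemma minimal_cover_exists V I : covers V I -> exists J, minimal_cover V J.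
Proof.
have [n] := ubnP #|I|; elim: n I => // n IH I /ltnSE hI hc.
have [h|h] := pselect (minimal_cover V I); first by exists I.
have [i [iI hi]] : exists i, i \in I /\ forall x, simplex_lattice R V x ->
    exists2 j, j \in I :\ i & x 0 j \is a Num.int.
  apply: contrapT => hn; apply: h; split=> // i iI.
  apply: contrapT => hx; apply: hn; exists i; split=> // x xG.
  apply: contrapT => hj; apply: hx; exists x => // j jI xj.
  apply: contrapT => ji; apply: hj; exists j => //.
  by rewrite !inE jI andbT; apply/eqP.
apply: (IH (I :\ i)) => //; apply: leq_trans hI.
by rewrite [in leqRHS](cardsD1 i) iI.
Qed.

Lemma minimal_cover_row_perm V I (s : 'S_d.+1) :
  minimal_cover V I -> minimal_cover (row_perm s V) [set i : 'I_d.+1 | s i \in I].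
Proof.
move=> [hc hm]; split=> [x|i].
  rewrite lattice_row_permE => -[y /hc[i iI hi] <-].
  by exists ((s^-1)%g i); rewrite ?inE ?mxE permKV.
rewrite inE => /hm[x hx hj]; exists (col_perm s x).
  by rewrite lattice_row_permE; exists x.
by move=> j; rewrite inE mxE => jI xj; apply: (@perm_inj _ s); exact: hj.
Qed.

Lemma minimal_cover_segment V I : minimal_cover V I ->
  exists s : 'S_d.+1, minimal_cover (row_perm s V) [set i : 'I_d.+1 | (i < #|I|)%N].
Proof.
move=> h; have [s hs] := perm_initial_segment I; exists s.
have -> : [set i : 'I_d.+1 | (i < #|I|)%N] = [set i : 'I_d.+1 | s i \in I].
  by apply/setP => i; rewrite !inE hs.
exact: minimal_cover_row_perm.
Qed.

Section Support.
Variables (V : 'M[int]_(d.+1, d)) (I : {set 'I_d.+1}).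
Hypothesis hI : minimal_cover V I.
Local Notation G := (simplex_lattice R V).

Definition support (x : 'rV[R]_d.+1) : {set 'I_d.+1} :=
  [set i in I | x 0 i \isn't a Num.int].

(* Pigeonhole over k bounds the order of y and the size of its support. *)
Lemma support_cover y i0 : G y -> i0 \in support y -> exists2 x : 'rV[R]_d.+1, G x &
  forall k, exists2 i, i \in support y & (x + y *+ k) 0 i \is a Num.int.
Proof.
move=> hy; rewrite inE => /andP[iI yi]; have [hc /(_ _ iI)[x hx hxi]] := hI.
(* Let j cover x + k y. If y were integral at j, so would be x, which forces j = i0; but y is not
   integral at i0. *)
exists x => // k; have [j jI hj] := hc _ (latticeD hx (latticeMn k hy)).
exists j => //; rewrite inE jI /=; apply/negP => yj.
move: hj; rewrite mxE rpredDr ?mulmxnE ?rpredMn // => /(hxi _ jI) ji.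
by move: yj; rewrite ji (negbTE yi).
Qed.

(** The translates x + k y for k from 0 to #|support y| are one more than the coordinates available
    to cover them. Two of them share a coordinate, and their difference is a multiple of y that is
    integral there. *)
Lemma pigeonhole_support y : G y -> support y != finset.set0 ->
  exists2 j, (0 < j <= #|support y|)%N & (#|support (y *+ j)| < #|support y|)%N.
Proof.
move=> hy /set0Pn[i0 hi0]; have [x hx hk] := support_cover hy hi0.
set S := support y.
have /choice[f hf] : forall k : 'I_#|S|.+1, exists i, i \in S /\
    (x + y *+ k) 0 i \is a Num.int.
  by move=> k; have [i iS hi] := hk k; exists i.
have [k [l [kl fkl]]] : exists k l : 'I_#|S|.+1, (k < l)%N /\ f k = f l.
  apply: contrapT => hn.
  have inj : injective f.
    move=> k l e; apply: val_inj; apply/eqP; apply: contrapT => /negP.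
    by rewrite neq_ltn => /orP[] h; apply: hn; [exists k, l|exists l, k].
  have : (#|f @: [set: 'I_#|S|.+1]| <= #|S|)%N.
    by apply/subset_leq_card/fintype.subsetP => _ /imsetP[k _ ->]; have [] := hf k.
  by rewrite card_imset // cardsT card_ord ltnn.
exists (l - k)%N.
  by rewrite subn_gt0 kl /= leq_subLR (leq_trans (leq_ord l)) // leq_addl.
have [fS hfk] := hf k; have [_ hfl] := hf l.
apply: (@leq_trans #|S :\ f k|.+1); last by rewrite [in leqRHS](cardsD1 (f k)) fS.
apply/subset_leq_card/fintype.subsetP => i; rewrite !inE => /andP[iI hi].
rewrite iI /=; apply/andP; split; last first.
  by apply: contra hi => hi; rewrite mulmxnE rpredMn.
apply/eqP => e; move/negP: hi; apply; rewrite e.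
have -> : (y *+ (l - k)) 0 (f k) = (x + y *+ l) 0 (f k) - (x + y *+ k) 0 (f k).
  by rewrite mulrnBr ?(ltnW kl) // !mxE; ring.
by rewrite rpredB // fkl.
Qed.

Lemma ratio_int (a m : nat) : (0 < m)%N ->
  (a%:R / m%:R : R) \is a Num.int = (m %| a)%N.
Proof.
move=> m0; have m0' : m%:R != 0 :> R by rewrite pnatr_eq0 -lt0n.
apply/idP/dvdnP => [|[k ->]]; last by rewrite natrM mulfK // rpred_nat.
move=> /intrP[z hz].
have : (a%:Z)%:~R = (z * m%:Z)%:~R :> R.
  by rewrite intrM -hz -!pmulrn divfK.
move=> /intr_inj e; exists (absz z).
by have := congr1 absz e; rewrite abszM.
Qed.

(** A finer count than the pigeonhole: a coordinate i covers x + k y only for k in one class modulo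
    m / gcd(a_i, m), hence for at most gcd(a_i, m) of the m residues k. *)
Lemma support_gcd (m : nat) (a : 'I_d.+1 -> nat) y : (0 < m)%N -> G y ->
  (forall i, y 0 i - (a i)%:R / m%:R \is a Num.int) ->
  support y != finset.set0 -> (m <= \sum_(i in support y) gcdn (a i) m)%N.
Proof.
move=> m0 hy ha /set0Pn[i0 hi0]; have [x hx hk] := support_cover hy hi0.
pose K i : {set 'I_m} := [set k : 'I_m | (x + y *+ k) 0 i \is a Num.int].
have hc : (#|[set: 'I_m]| <= #|\bigcup_(i in support y) K i|)%N.
  apply/subset_leq_card/fintype.subsetP => k _.
  have [i iS hi] := hk k; apply/bigcupP; exists i => //.
  by rewrite inE.
rewrite cardsT card_ord in hc; apply: (leq_trans hc).
apply: leq_trans (_ : \sum_(i in support y) #|K i| <= _)%N; last first.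
  apply: leq_sum => i _; apply: card_residue_class => // k l; rewrite !inE => hki hli kl.
  rewrite -ratio_int // natrM -mulrA mulr_natl.
  suff : (y *+ (l - k)) 0 i \is a Num.int.
    rewrite mulmxnE => hs; have := rpredB hs (rpredMn (l - k) (ha i)).
    by rewrite -mulrnBl subKr.
  have -> : (y *+ (l - k)) 0 i = (x + y *+ l) 0 i - (x + y *+ k) 0 i.
    by rewrite mulrnBr // !mxE; ring.
  by rewrite rpredB.
elim/big_rec2: _ => [|i s t _ IH]; first by rewrite cards0.
by apply: leq_trans (leq_card_setU _ _) _; rewrite leq_add2l.
Qed.

Lemma support0_int y i : support y = finset.set0 -> i \in I -> y 0 i \is a Num.int.
Proof. by move=> /setP/(_ i); rewrite !inE => + iI; rewrite iI /= => /negbFE. Qed.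

(** For a support of one element the pigeonhole yields j = 1, and the support of y would be smaller
    than itself. *)
Lemma support_le1 y : G y -> (#|support y| <= 1)%N -> support y = finset.set0.
Proof.
move=> hy h; apply/eqP/contraT => hn.
have [j hj hlt] := pigeonhole_support hy hn; have e : j = 1%N by lia.
by move: hlt; rewrite e mulr1n ltnn.
Qed.

Lemma support_le2 y : G y -> (#|support y| <= 2)%N -> support (y *+ 2) = finset.set0.
Proof.
move=> hy h; have [h0|hn] := eqVneq (support y) finset.set0.
  by apply/setP => i; have /setP/(_ i) := h0; rewrite !inE mulmxnE => /negbT;
    case: (i \in I) => //= /negPn hi; rewrite rpredMn.
have [j hj hlt] := pigeonhole_support hy hn.
have {}hlt : support (y *+ j) = finset.set0.
  by apply: support_le1; [exact: latticeMn|lia].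
have /orP[/eqP e|/eqP e] : (j == 1%N) || (j == 2%N) by lia.
  by rewrite e mulr1n in hlt; rewrite hlt eqxx in hn.
by rewrite e in hlt.
Qed.

Lemma support_le3 y : G y -> (#|support y| <= 3)%N ->
  support (y *+ 4) = finset.set0 \/ support (y *+ 6) = finset.set0.
Proof.
move=> hy h; have [h0|hn] := eqVneq (support y) finset.set0.
  left; apply/setP => i; have /setP/(_ i) := h0; rewrite !inE mulmxnE => /negbT.
  by case: (i \in I) => //= /negPn hi; rewrite rpredMn.
have [j hj hlt] := pigeonhole_support hy hn.
have : support (y *+ j *+ 2) = finset.set0.
  by apply: support_le2; [exact: latticeMn|lia].
rewrite -mulrnA; have /or3P[/eqP e|/eqP e|/eqP e] : [|| j == 1, j == 2 | j == 3]%N by lia.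
- by move: hlt; rewrite e mulr1n ltnn.
- by rewrite e => ->; left.
- by rewrite e => ->; right.
Qed.

Lemma support_mul y m k : support (y *+ m) = finset.set0 -> (m %| k)%N ->
  support (y *+ k) = finset.set0.
Proof.
move=> h0 /dvdnP[c ->]; apply/setP => i; have /setP/(_ i) := h0.
rewrite mulnC mulrnA !inE [in X in _ -> X]mulmxnE => /negbT.
by case: (i \in I) => //= /negPn hi; rewrite rpredMn.
Qed.

(** The pigeonhole and the bound for smaller supports give an exponent 4 j or 6 j with j at most 4;
    each of these divides 16, 18 or 24. *)
Lemma support_le4 y : G y -> (#|support y| <= 4)%N ->
  exists2 m, m \in [:: 16; 18; 24]%N & support (y *+ m) = finset.set0.
Proof.
move=> hy h; have [h0|hn] := eqVneq (support y) finset.set0.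
  by exists 16%N; rewrite ?inE //; apply: (@support_mul _ 1).
have [j hj hlt] := pigeonhole_support hy hn.
have [||] := @support_le3 (y *+ j) (latticeMn j hy); first by lia.
all: rewrite -mulrnA; have /or4P[/eqP->|/eqP->|/eqP->|/eqP->] :
  [|| j == 1, j == 2, j == 3 | j == 4]%N by lia.
- by move=> hs; exists 16%N; [rewrite !inE|apply: (support_mul hs)].
- by move=> hs; exists 16%N; [rewrite !inE|apply: (support_mul hs)].
- by move=> hs; exists 24%N; [rewrite !inE|apply: (support_mul hs)].
- by move=> hs; exists 16%N; [rewrite !inE|apply: (support_mul hs)].
- by move=> hs; exists 24%N; [rewrite !inE|apply: (support_mul hs)].
- by move=> hs; exists 24%N; [rewrite !inE|apply: (support_mul hs)].
- by move=> hs; exists 18%N; [rewrite !inE|apply: (support_mul hs)].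
- by move=> hs; exists 24%N; [rewrite !inE|apply: (support_mul hs)].
Qed.

End Support.
End Cover.

(** * Coverings by four and five coordinates *)

Section Words.
Local Open Scope nat_scope.
Implicit Types (m n i k : nat) (u v h cur : seq nat) (G acc codes : seq (seq nat)).

Definition addv m u v := [seq (p.1 + p.2) %% m | p <- zip u v].
Definition scalev m k v := [seq (k * a) %% m | a <- v].
(* A word v stands for the vector v / m; its first n coordinates are the covering
   ones, and it is full when none of these vanishes. *)
Definition full n v := all (leq 1) (take n v).
Definition gcd_sum m n v := sumn [seq gcdn a m | a <- take n v & 0 < a].
(* For y in G with digits v and x integral at just one covering coordinate, at which
   y is not, every x + k y is integral at a covering coordinate where y is not, and
   each such coordinate accounts for at most gcd(v_i, m) residues k modulo m. *)
Definition heavy m n v := let s := gcd_sum m n v in (s == 0) || (m <= s).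
(** The multiples of a word of G are words of G and so are heavy too. A conditional replaces the
    conjunction because evaluation by value would run the costly second test on every word. *)
Definition admissible m n v :=
  if heavy m n v then all (fun k => heavy m n (scalev m k v)) (iota 2 (m - 2))
  else false.
(* The summand 3 * m keeps the truncated subtraction exact. *)
Definition zero_sum_quads m :=
  [seq [:: a; t.1; t.2; (3 * m - (a + t.1 + t.2)) %% m]
  | a <- iota 0 m, t <- [seq (b, c) | b <- iota 0 m, c <- iota 0 m]].
Definition candidates m n := [seq q <- zero_sum_quads m | admissible m n q].
Definition insert0 i v := take i v ++ 0 :: drop i v.

(* The cosets cur + G, cur + h + G, ... are added until one of them is G again, with
   result None if a full word appears; the fuel 24 is the exponent of the group. *)
Fixpoint extend n k G acc h cur : option (seq (seq nat)) :=
  if k is k'.+1 then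
    if cur \in G then Some acc else
    let C := [seq addv 24 cur x | x <- G] in
    if has (full n) C then None else extend n k' G (C ++ acc) h (addv 24 h cur)
  else Some acc.
Definition adjoin n h G := extend n 24 G G h h.

(* One word is adjoined from each list in L; branches with a full word are cut, since
   they cannot come from a covering. *)
Fixpoint search n (goal : seq (seq nat) -> bool) (L : seq (seq (seq nat))) G :=
  if goal G then true else
  if L is Ps :: L' then
    all (fun p => if adjoin n p G is Some H then search n goal L' H else true) Ps
  else false.

(** A generator whose adjunction fails is dropped, so the result stays inside the generated
    group. *)
Definition span n gens : seq (seq nat) :=
  foldr (fun h G => odflt G (adjoin n h G)) [:: nseq 5 0] gens.

(** The possible witnesses of minimality at coordinate i: zero there and nonzero at the other [n.-1]
    covering coordinates. *)
Definition points n i (c : seq (seq nat)) := [seq insert0 i q | q <- c & full n.-1 q].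

Definition contains_code (codes : seq (seq (seq nat))) perms G :=
  has (fun gens =>
    has (fun s => all (fun g => [seq nth 0 g i | i <- s] \in G) gens) perms) codes.

(** Each candidate outside the span creates a full word when it is adjoined. A covered lattice that
    contains the generators therefore cannot be larger than their code. *)
Definition maximal n (c gens : seq (seq nat)) :=
  let G := span n gens in
  all (fun i => all (fun q =>
    let z := insert0 i q in (z \in G) || ~~ isSome (adjoin n z G)) c) (iota 0 n).

Section Soundness.
Variable A : seq nat -> Prop.
Hypothesis A_add : forall u v, A u -> A v -> A (addv 24 u v).

(** The predicate A stays abstract since [span_sound] is applied both to the words of a lattice and
    to the words of a code. *)
Lemma extend_sound n k G acc h cur :
  (forall x, x \in G -> A x) -> (forall x, x \in acc -> A x) -> A h -> A cur ->
  if extend n k G acc h cur is Some H then forall x, x \in H -> A x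
  else exists2 x, A x & full n x.
Proof.
move=> hG; elim: k acc cur => [|k IH] acc cur hacc hh hc //=.
case: ifP => // _; case: hasP => [[x /mapP[y yG ->] hx]|_].
  by exists (addv 24 cur y) => //; apply: A_add => //; exact: hG.
apply: IH => // [x|]; last exact: A_add.
rewrite mem_cat => /orP[/mapP[y yG ->]|]; last exact: hacc.
by apply: A_add => //; exact: hG.
Qed.

Lemma adjoin_sound n h G : (forall x, x \in G -> A x) -> A h ->
  if adjoin n h G is Some H then forall x, x \in H -> A x
  else exists2 x, A x & full n x.
Proof. by move=> hG hh; apply: extend_sound. Qed.

Lemma span_sound n gens : A (nseq 5 0) -> (forall x, x \in gens -> A x) ->
  forall x, x \in span n gens -> A x.
Proof.
move=> A0; elim: gens => [|h gens IH] hg x /=; first by rewrite inE => /eqP->.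
have hG : forall y, y \in span n gens -> A y.
  by apply: IH => y yg; apply: hg; rewrite inE yg orbT.
have := @adjoin_sound n h _ hG (hg _ (mem_head _ _)); rewrite -/(span n gens).
by case: adjoin => [H hH|_]; [exact: hH|exact: hG].
Qed.

(** Every list contains a word of A. The branch that follows these words stays within A, so it meets
    no full word, is never cut, and ends at the goal. *)
Lemma search_sound n goal (L : seq (seq (seq nat))) G :
  (forall x, A x -> ~~ full n x) ->
  (forall Ps, Ps \in L -> exists2 p, p \in Ps & A p) ->
  (forall x, x \in G -> A x) -> search n goal L G ->
  exists2 H, (forall x, x \in H -> A x) & goal H.
Proof.
move=> nf; elim: L G => [|Ps L IH] G hL hG /=.
  by case: ifP => // hl _; exists G.
case: ifP => [hl _|_ /allP hs]; first by exists G.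
have [p pP Ap] := hL _ (mem_head _ _).
have := hs _ pP; have := @adjoin_sound n p _ hG Ap.
case: adjoin => [H hH|[x /nf/negP]//].
by apply: IH => // Q QL; apply: hL; rewrite inE QL orbT.
Qed.

End Soundness.

Lemma gcd_sum_big m n v : n <= size v ->
  gcd_sum m n v = \sum_(i < size v | (i < n) && (0 < nth 0 v i)) gcdn (nth 0 v i) m.
Proof.
move=> nv; rewrite /gcd_sum sumnE big_map big_filter (big_nth 0) size_takel //.
rewrite big_mkord (big_ord_widen_cond _ (fun i => 0 < nth 0 (take n v) i)
  (fun i => gcdn (nth 0 (take n v) i) m) nv).
apply: eq_big => [i|i /andP[_ hi]]; last by rewrite nth_take.
by rewrite andbC; case: (ltnP i n) => //= hi; rewrite nth_take.
Qed.

End Words.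

(** * Digits of lattice elements modulo m *)

Section Digits.
Variable R : realType.

Definition residue_vec (m : nat) (v : seq nat) : 'rV[R]_5 :=
  \row_i ((nth 0%N v i)%:R / m%:R).

Definition digits_of (m : nat) (y : 'rV[R]_5) (v : seq nat) :=
  [/\ size v = 5%N, all (fun a => a < m)%N v &
      forall i, y 0 i - residue_vec m v 0 i \is a Num.int].

Lemma digits_exist m (y : 'rV[R]_5) : (0 < m)%N ->
  (forall i, (y *+ m) 0 i \is a Num.int) -> exists v, digits_of m y v.
Proof.
move=> m0 hy; pose v := [tuple absz (modz (Num.floor ((y *+ m) 0 i)) m) | i < 5].
have hmod (z : int) : (absz (z %% m)%Z)%:Z = (z %% m)%Z.
  by rewrite gez0_abs // modz_ge0 // -lt0n.
exists v; split; first by rewrite size_tuple.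
  apply/(all_tnthP) => i; rewrite tnth_mktuple -ltz_nat hmod.
  exact: ltz_pmod.
move=> i; rewrite mxE -tnth_nth tnth_mktuple.
have m0' : m%:R != 0 :> R by rewrite pnatr_eq0 -lt0n.
have -> : y 0 i = (Num.floor ((y *+ m) 0 i))%:~R / m%:R.
  by rewrite floorK // mulmxnE -[y 0 i *+ m]mulr_natr mulfK.
set z := Num.floor _.
have -> : (absz (modz z m))%:R = (modz z m)%:~R :> R by rewrite pmulrn hmod.
rewrite -mulrBl -intrB.
rewrite {1}(divz_eq z m) addrK intrM -pmulrn mulfK //.
Qed.

Lemma residue_vec_int m v i : (0 < m)%N ->
  (residue_vec m v 0 i \is a Num.int) = (m %| nth 0 v i)%N.
Proof. by move=> m0; rewrite mxE ratio_int. Qed.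

Lemma nth_addv m u v i : size u = size v -> (i < size u)%N ->
  nth 0%N (addv m u v) i = ((nth 0 u i + nth 0 v i) %% m)%N.
Proof.
move=> s iu; rewrite (nth_map (0%N, 0%N)) ?size_zip -?s ?minnn // nth_zip //.
Qed.

Lemma residue_mod m a : (0 < m)%N ->
  (a%:R / m%:R - (a %% m)%N%:R / m%:R : R) \is a Num.int.
Proof.
move=> m0; have m0' : m%:R != 0 :> R by rewrite pnatr_eq0 -lt0n.
rewrite {1}(divn_eq a m) natrD natrM mulrDl mulfK // addrK.
exact: rpred_nat.
Qed.

Lemma digits_addv m x y u v : (0 < m)%N ->
  digits_of m x u -> digits_of m y v -> digits_of m (x + y) (addv m u v).
Proof.
move=> m0 [su _ hu] [sv _ hv]; have s : size u = size v by rewrite su.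
split; first by rewrite size_map size_zip su sv.
  by apply/allP => _ /mapP[p _ ->]; rewrite ltn_pmod.
move=> i; rewrite [residue_vec _ _ _ _]mxE nth_addv ?su //.
rewrite -(subrKA ((nth 0%N u i + nth 0%N v i)%N%:R / m%:R)) rpredD ?residue_mod //.
rewrite mxE natrD mulrDl opprD addrACA.
by have := rpredD (hu i) (hv i); rewrite !mxE.
Qed.

Lemma digits_scalev m y v k : (0 < m)%N -> digits_of m y v ->
  digits_of m (y *+ k) (scalev m k v).
Proof.
move=> m0 [sv _ hv]; split; first by rewrite size_map.
  by apply/allP => _ /mapP[p _ ->]; rewrite ltn_pmod.
move=> i; rewrite [residue_vec _ _ _ _]mxE (nth_map 0%N) ?sv //.
rewrite -(subrKA ((k * nth 0%N v i)%N%:R / m%:R)) rpredD ?residue_mod //.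
rewrite mulmxnE natrM -mulrA mulr_natl -mulrnBl rpredMn //.
by have := hv i; rewrite mxE.
Qed.

Lemma digits_int m y v i : (0 < m)%N -> digits_of m y v ->
  (y 0 i \is a Num.int) = (nth 0%N v i == 0%N).
Proof.
move=> m0 [sv /allP lv hv].
have -> : (y 0 i \is a Num.int) = (residue_vec m v 0 i \is a Num.int).
  by rewrite -[y 0 i](subrK (residue_vec m v 0 i)) rpredDl.
rewrite residue_vec_int //; have : (nth 0%N v i < m)%N by apply: lv; rewrite mem_nth ?sv.
by case: (nth 0%N v i) => [|a] h; rewrite ?dvdn0 // gtnNdvd.
Qed.

End Digits.

Lemma perm_of_iota m (s : seq nat) : perm_eq s (iota 0 m) ->
  exists t : 'S_m, forall i : 'I_m, nth 0%N s i = t i.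
Proof.
move=> h; have ss : size s = m by rewrite (perm_size h) size_iota.
have us : uniq s by rewrite (perm_uniq h) iota_uniq.
have hlt (i : 'I_m) : (nth 0%N s i < m)%N.
  have : nth 0%N s i \in s by rewrite mem_nth ?ss.
  by rewrite (perm_mem h) mem_iota.
have inj : injective (fun i => Ordinal (hlt i)).
  move=> i j /(congr1 val) /= /eqP; rewrite nth_uniq ?ss // => /eqP.
  exact: val_inj.
by exists (perm inj) => i; rewrite permE.
Qed.

Lemma gcd_sum_insert0 m n i v : size v = 4%N -> (i < n)%N -> (n == 4%N) || (n == 5%N) ->
  gcd_sum m n (insert0 i v) = gcd_sum m n.-1 v.
Proof.
case: v => [|a [|b [|c [|e []]]]] // _ iln /orP[]/eqP nE.
all: by move: iln; rewrite nE; case: i => [|[|[|[|[|]]]]].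
Qed.

(** * Candidate words and the exponent of the group *)

Section Candidates.
Variables (R : realType) (V : 'M[int]_(5, 4)) (n : nat).
Local Notation I := [set i : 'I_5 | (i < n)%N].
Hypothesis hI : minimal_cover R V I.
Hypothesis n45 : (n == 4%N) || (n == 5%N).
Local Notation G := (simplex_lattice R V).

(** At most one coordinate lies outside the covering ones, and it is integral because all five add
    up to an integer. *)
Lemma support0_int_all y i : G y -> support I y = finset.set0 -> y 0 i \is a Num.int.
Proof.
move=> hy h0; have hI' (j : 'I_5) : (j < n)%N -> y 0 j \is a Num.int.
  by move=> jn; apply: support0_int h0 _; rewrite inE.
case: (ltnP i n) => [/hI'//|ni].
have := lattice_coord_sum hy; rewrite (bigD1 i) //= rpredDr //.
apply: rpred_sum => j ji; apply: hI'.
have : j != i :> nat by [].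
by move: (ltn_ord i) (ltn_ord j) n45; lia.
Qed.

Lemma heavy_digits m y v : (0 < m)%N -> G y -> digits_of m y v -> heavy m n v.
Proof.
move=> m0 hy hv; have [sv lv cv] := hv.
have nv : (n <= size v)%N by rewrite sv; move: n45; lia.
have e : gcd_sum m n v = (\sum_(i in support I y) gcdn (nth 0 v i) m)%N.
  rewrite gcd_sum_big // sv; apply: eq_bigl => i.
  by rewrite !inE (digits_int _ m0 hv) lt0n.
rewrite /heavy e; have [->|hn] := eqVneq (support I y) finset.set0.
  by rewrite big_set0.
rewrite (support_gcd hI (a := fun i => nth 0%N v i)) ?orbT // => i.
by have := cv i; rewrite mxE.
Qed.

Lemma digits_sum m y v : (0 < m)%N -> G y -> digits_of m y v -> (m %| sumn v)%N.
Proof.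
move=> m0 hy [sv _ cv]; rewrite -(ratio_int R) // sumnE (big_nth 0%N) sv big_mkord.
rewrite natr_sum mulr_suml.
have -> : \sum_(i < 5) (nth 0%N v i)%:R / m%:R =
    \sum_i y 0 i - \sum_i (y 0 i - residue_vec R m v 0 i).
  by rewrite -sumrB; apply: eq_bigr => i _; rewrite subKr mxE.
apply: rpredB; first exact: lattice_coord_sum hy.
by apply: rpred_sum => i _; exact: cv.
Qed.

Lemma candidate_digits m y v i : (2 < m)%N -> G y -> digits_of m y v ->
  (i < n)%N -> nth 0%N v i = 0%N ->
  exists2 q, q \in candidates m n.-1 & v = insert0 i q.
Proof.
move=> m2 hy hv iln vi; have m0 : (0 < m)%N by lia.
have [sv lv cv] := hv.
pose q := take i v ++ drop i.+1 v.
have i5 : (i < 5)%N by move: n45; lia.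
have vE : v = insert0 i q.
  rewrite /insert0 /q take_cat drop_cat size_takel ?sv ?(ltnW i5) // ltnn subnn.
  by rewrite take0 drop0 cats0 -vi -drop_nth ?sv // cat_take_drop.
exists q => //; rewrite mem_filter.
have insE k : gcd_sum m n (insert0 i (scalev m k q)) = gcd_sum m n.-1 (scalev m k q).
  apply: gcd_sum_insert0 => //.
  by rewrite size_map size_cat size_takel ?size_drop ?sv ?(ltnW i5) //; lia.
have scE k : scalev m k (insert0 i q) = insert0 i (scalev m k q).
  by rewrite /scalev /insert0 map_cat /= muln0 mod0n map_take map_drop.
have hk k : heavy m n.-1 (scalev m k q).
  have := heavy_digits m0 (latticeMn k hy) (digits_scalev k m0 hv).
  by rewrite vE scE /heavy insE.
have q1 : scalev m 1 q = q.
  apply: map_id_in => a; rewrite mem_cat => ha; rewrite mul1n modn_small //.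
  by move/allP: lv; apply; case/orP: ha => [/mem_take|/mem_drop].
apply/andP; split.
  by rewrite /admissible -{1}q1 hk; apply/allP => k _.
have hs := digits_sum m0 hy hv.
have lq : all (fun a => a < m)%N q.
  apply/allP => a; rewrite mem_cat => ha.
  by move/allP: lv; apply; case/orP: ha => [/mem_take|/mem_drop].
have sq : sumn q = sumn v.
  by rewrite [in RHS]vE /insert0 sumn_cat /= -sumn_cat cat_take_drop.
have : size q = 4%N.
  by rewrite size_cat size_takel ?size_drop ?sv ?(ltnW i5) //; lia.
rewrite -sq in hs; move: hs lq.
case: (q) => [|a [|b [|c [|e []]]]] //= hs /and5P[ha hb hc he _] _.
apply/allpairsPdep; exists a, (b, c); split.
- by rewrite mem_iota.
- by apply/allpairsPdep; exists b, c; rewrite !mem_iota.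
congr [:: _; _; _; _] => /=.
rewrite !addn0 !addnA in hs.
have [t ht] := dvdnP hs.
(* Four entries below m add up to t m, so t is at most 3 and the subtraction from 3 m in
   [zero_sum_quads] recovers the last entry modulo m. *)
have t4 : (t <= 3)%N by nia.
have -> : (3 * m - (a + b + c) = (3 - t) * m + e)%N by nia.
by rewrite modnMDl modn_small.
Qed.

Lemma covered_digit m y v : (0 < m)%N -> G y -> digits_of m y v ->
  exists2 i, (i < n)%N & nth 0%N v i = 0%N.
Proof.
move=> m0 hy hv; have [hc _] := hI; have [i] := hc _ hy.
by rewrite inE (digits_int _ m0 hv) => iln /eqP vi; exists i.
Qed.

Lemma support_card y : G y -> (#|support I y| < n)%N.
Proof.
move=> hy; have [hc _] := hI; have [i iI hi] := hc _ hy.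
have cI : #|I| = n.
  have : n = 4%N \/ n = 5%N by case/orP: n45 => /eqP; [left|right].
  by case=> ->; rewrite cardsE cardE /enum_mem -enumT /= !enum_ordSl enum_ord0.
rewrite -[ltnRHS]cI; apply: proper_card; apply/properP; split.
  by apply/fintype.subsetP => j; rewrite inE => /andP[].
by exists i => //; rewrite inE hi andbF.
Qed.

(** This and the next computation replace the exponents 16 and 18 by divisors of 24: even digits
    modulo 16 mean that 8 y is integral, and digits modulo 18 divisible by 3 mean that 6 y is. *)
Lemma even_candidates : all (all (dvdn 2)) (candidates 16 4).
Proof. by vm_compute. Qed.

Lemma triple_candidates : all (all (dvdn 3)) (candidates 18 4).
Proof. by vm_compute. Qed.

Lemma int_mulrn_dvd (y : 'rV[R]_5) m k : (forall i, (y *+ m) 0 i \is a Num.int) ->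
  (m %| k)%N -> forall i, (y *+ k) 0 i \is a Num.int.
Proof.
by move=> h /dvdnP[c ->] i; rewrite mulnC mulrnA mulmxnE rpredMn.
Qed.

Lemma all_insert0 (p : pred nat) i q : p 0%N -> all p q -> all p (insert0 i q).
Proof.
move=> p0 /allP hq; apply/allP => a; rewrite mem_cat inE.
by case/or3P => [/mem_take|/eqP->|/mem_drop] //; exact: hq.
Qed.

Lemma exponent_24 y i : G y -> (y *+ 24) 0 i \is a Num.int.
Proof.
move=> hy; have key m : support I (y *+ m) = finset.set0 -> forall i, (y *+ m) 0 i \is a Num.int.
  by move=> h j; apply: support0_int_all h; exact: latticeMn.
have := support_card hy; case/orP: n45 => /eqP nE; rewrite {2}nE => hc.
  have [] := support_le3 hI hy hc => /key h; exact: int_mulrn_dvd h _ _.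
have red m p k : (2 < m)%N -> m = (p * k)%N -> (k %| 24)%N ->
    all (all (dvdn p)) (candidates m 4) ->
    support I (y *+ m) = finset.set0 -> (y *+ 24) 0 i \is a Num.int.
  move=> m2 mE k24 hp /key h; have m0 : (0 < m)%N by lia.
  have [v hv] := digits_exist m0 h.
  have [j jn vj] := covered_digit m0 hy hv.
  have [q hq vE] := candidate_digits m2 hy hv jn vj.
  rewrite nE in hq; have /allP dv : all (dvdn p) v.
    by rewrite vE; apply: all_insert0 => //; move/allP: hp; exact.
  apply: (int_mulrn_dvd _ k24) => l; have [sv _ cv] := hv.
  have /dvdnP[c hc'] : (p %| nth 0 v l)%N by apply: dv; rewrite mem_nth ?sv.
  have e : residue_vec R m v 0 l *+ k = c%:R.
    rewrite mxE hc' -[LHS]mulr_natr mulrAC -natrM -mulnA -mE natrM mulfK //.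
    by rewrite pnatr_eq0 -lt0n.
  have := rpredMn k (cv l); rewrite mulrnBl e mulmxnE => h'.
  by rewrite -(subrK c%:R (_ *+ k)) rpredD ?rpred_nat.
have [m] := support_le4 hI hy hc; rewrite !inE => /or3P[] /eqP->.
- exact: (red 16%N 2%N 8%N isT erefl isT even_candidates).
- exact: (red 18%N 3%N 6%N isT erefl isT triple_candidates).
- by move=> /key.
Qed.

End Candidates.

(** * The lattice of a code *)

Section CodeLattice.
Variable R : realType.

(** The preimage in R^5 of the code generated by g, containing Z^5. Natural coefficients suffice,
    since N times a generator is integral. *)
Definition code_lattice (N : nat) (g : seq (seq nat)) : set 'rV[R]_5 :=
  [set x | exists k : nat -> nat, forall j,
    x 0 j - \sum_(i < size g) residue_vec R N (nth [::] g i) 0 j *+ k i \is a Num.int]%classic.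

Lemma code_latticeD N g x y :
  code_lattice N g x -> code_lattice N g y -> code_lattice N g (x + y).
Proof.
move=> [k hk] [l hl]; exists (fun i => k i + l i)%N => j.
have := rpredD (hk j) (hl j).
rewrite addrACA -opprD -big_split mxE /=.
by under eq_bigr do rewrite -mulrnDr.
Qed.

Lemma code_lattice_congr N g (x y : 'rV[R]_5) :
  (forall i, x 0 i - y 0 i \is a Num.int) -> code_lattice N g x -> code_lattice N g y.
Proof.
move=> h [k hk]; exists k => j.
have := rpredB (hk j) (h j); set S := \sum_(i < _) _.
by have -> : x 0 j - S - (x 0 j - y 0 j) = y 0 j - S by ring.
Qed.

Lemma code_lattice0 N g : code_lattice N g 0.
Proof.
by exists (fun=> 0%N) => j; rewrite big1 ?subr0 ?mxE ?rpred0 // => i _; rewrite mulr0n.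
Qed.

Lemma code_lattice_gen N g r : r \in g -> code_lattice N g (residue_vec R N r).
Proof.
move=> /(nthP [::])[i ig <-]; exists (fun k => nat_of_bool (k == i)) => j.
rewrite (bigD1 (Ordinal ig)) //= eqxx mulr1n big1 ?addr0 ?subrr ?rpred0 // => l li.
case: eqP => // e; case/eqP: li; exact: val_inj.
Qed.

Lemma code_lattice_sub (V : 'M[int]_(5, 4)) N g :
  (forall r, r \in g -> simplex_lattice R V (residue_vec R N r)) ->
  forall x, code_lattice N g x -> simplex_lattice R V x.
Proof.
move=> h x [k hk].
apply: (@lattice_congr _ _ _ (\sum_(i < size g) residue_vec R N (nth [::] g i) *+ k i)).
  move=> j; rewrite -opprB rpredN; have := hk j.
  by rewrite summxE; under [in X in _ -> X]eq_bigr do rewrite mulmxnE.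
by apply: lattice_sum => i _; apply: latticeMn; apply: h; apply: mem_nth.
Qed.

(** The search handles all codes with the single modulus 24; this translates its results back to the
    modulus of each code. *)
Lemma code_lattice_scale N g : (N %| 24)%N -> (0 < N)%N ->
  code_lattice 24 [seq [seq (24 %/ N * a)%N | a <- r] | r <- g] = code_lattice N g.
Proof.
move=> N24 N0; have e (r : seq nat) j :
    residue_vec R 24 [seq (24 %/ N * a)%N | a <- r] 0 j = residue_vec R N r 0 j.
  have N0' : N%:R != 0 :> R by rewrite pnatr_eq0 -lt0n.
  have c0 : (24 %/ N)%:R != 0 :> R by rewrite pnatr_eq0 -lt0n divn_gt0 // dvdn_leq.
  rewrite !mxE -{2}(divnK N24) natrM.
  have -> : nth 0%N [seq (24 %/ N * a)%N | a <- r] j = (24 %/ N * nth 0 r j)%N.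
    case: (ltnP j (size r)) => h; first by rewrite (nth_map 0%N).
    by rewrite !nth_default ?size_map // muln0.
  by rewrite natrM -mulf_div divff // mul1r.
have es (k : nat -> nat) j :
    \sum_(i < size [seq [seq (24 %/ N * a)%N | a <- r] | r <- g])
      residue_vec R 24 (nth [::] [seq [seq (24 %/ N * a)%N | a <- r] | r <- g] i) 0 j *+ k i =
    \sum_(i < size g) residue_vec R N (nth [::] g i) 0 j *+ k i.
  by rewrite size_map; apply: eq_bigr => i _; rewrite (nth_map [::]) // e.
by apply/seteqP; split=> x [k hk]; exists k => j; have := hk j; rewrite es.
Qed.

End CodeLattice.
Arguments code_lattice R N g : clear implicits.

(** * From the search to an equality of lattices *)

Section Classify.
Variable R : realType.

Definition lattice_word (V : 'M[int]_(5, 4)) v :=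
  [/\ size v = 5%N, all (fun a => a < 24)%N v & simplex_lattice R V (residue_vec R 24 v)].

Lemma digits_residue m v : size v = 5%N -> all (fun a => a < m)%N v ->
  digits_of m (residue_vec R m v) v.
Proof. by move=> sv lv; split=> // i; rewrite subrr rpred0. Qed.

Lemma lattice_word_add V u v :
  lattice_word V u -> lattice_word V v -> lattice_word V (addv 24 u v).
Proof.
move=> [su lu hu] [sv lv hv].
have [s l c] := digits_addv (isT : 0 < 24)%N (digits_residue su lu) (digits_residue sv lv).
by split=> //; apply: lattice_congr c _; exact: latticeD.
Qed.

Lemma lattice_word0 V : lattice_word V (nseq 5 0%N).
Proof.
split=> //; apply: lattice_int => i.
by rewrite mxE nth_nseq ltn_ord mul0r rpred0.
Qed.

Section Cover.
Variables (V : 'M[int]_(5, 4)) (n : nat) (c : seq (seq nat)).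
Hypothesis hI : minimal_cover R V (segment n).
Hypothesis n45 : (n == 4%N) || (n == 5%N).
Hypothesis hc : {subset candidates 24 n.-1 <= c}.

Lemma lattice_word_not_full v : lattice_word V v -> ~~ full n v.
Proof.
move=> [sv lv hv]; have hd := digits_residue sv lv.
have [i iln vi] := covered_digit hI (isT : 0 < 24)%N hv hd.
have nv : (n <= size v)%N by rewrite sv; move: n45; lia.
apply/negP => /allP /(_ (nth 0%N v i)).
by rewrite vi -vi -(nth_take _ iln) mem_nth ?size_takel // nth_take // vi => /(_ isT).
Qed.

Lemma lattice_digits x : simplex_lattice R V x ->
  exists2 v, digits_of 24 x v & lattice_word V v.
Proof.
move=> hx; have [v hv] := digits_exist (isT : 0 < 24)%N (fun i => exponent_24 hI n45 i hx).
by exists v => //; have [sv lv cv] := hv; split=> //; exact: lattice_congr cv hx.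
Qed.

Lemma point_digits i x v : (i < n)%N -> simplex_lattice R V x -> digits_of 24 x v ->
  (forall j : 'I_5, (j < n)%N -> x 0 j \is a Num.int -> j = i :> nat) ->
  v \in points n i c.
Proof.
move=> iln hx hv hj.
have [j jn vj] := covered_digit hI (isT : 0 < 24)%N hx hv.
have v0 (k : 'I_5) : (k < n)%N -> nth 0%N v k = 0%N -> k = i :> nat.
  by move=> kn vk; apply: hj => //; rewrite (digits_int k (isT : 0 < 24)%N hv) vk.
have j5 : (j < 5)%N by move: n45; lia.
have ji : j = i := v0 (Ordinal j5) jn vj.
rewrite ji in vj; have [q hq vE] := candidate_digits hI n45 (isT : 2 < 24)%N hx hv iln vj.
rewrite vE; apply: map_f; rewrite mem_filter (hc hq) andbT.
have [sv _ _] := hv.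
have sq : size q = 4%N.
  by move: sv; rewrite vE /insert0 size_cat /= addnS -size_cat cat_take_drop => -[].
have hq0 k : (k < n.-1)%N -> nth 0%N q k != 0%N.
  move=> kn; apply/eqP => qk.
  (* Entry k of q is the entry of v at position [bump i k]. *)
  have k5 : (bump i k < 5)%N by rewrite /bump; move: n45; case: leqP; lia.
  have kn' : (bump i k < n)%N by rewrite /bump; move: n45; case: leqP; lia.
  suff /(v0 (Ordinal k5) kn')/eqP : nth 0%N v (bump i k) = 0%N.
    by rewrite /= eq_sym (negbTE (neq_bump i k)).
  rewrite vE /insert0 nth_cat size_takel ?sq; last by move: n45; lia.
  rewrite /bump; case: (leqP i k) => h /=; last by rewrite h nth_take.
  by rewrite add1n ltnNge leqW //= subSn //= nth_drop subnKC.
apply/(all_nthP 0%N) => k; rewrite size_takel ?sq; last by move: n45; lia.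
by move=> kn; rewrite nth_take // lt0n hq0.
Qed.

Lemma point_mem i : (i < n)%N -> exists2 v,
  v \in points n i c & lattice_word V v.
Proof.
move=> iln; have i5 : (i < 5)%N by move: n45; lia.
have [_ /(_ (Ordinal i5))] := hI; rewrite inE => /(_ iln) [x hx hj].
have [v hv wv] := lattice_digits hx; exists v => //.
apply: point_digits hx hv _ => // j jn xj.
by rewrite (hj j) // inE.
Qed.

Lemma maximal_lattice gens :
  maximal n c gens ->
  (forall g, g \in gens -> lattice_word V g) ->
  simplex_lattice R V = code_lattice R 24 gens.
Proof.
move=> hmax hg; apply/seteqP; split=> x; last first.
  by apply: code_lattice_sub => r /hg[].
move=> hx; have [v hv wv] := lattice_digits hx.
have [i iln vi] := covered_digit hI (isT : 0 < 24)%N hx hv.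
have [q hq vE] := candidate_digits hI n45 (isT : 2 < 24)%N hx hv iln vi.
have hspan := span_sound (@lattice_word_add V) (lattice_word0 V) hg.
have vspan : v \in span n gens.
  move/allP: hmax => /(_ i); rewrite mem_iota => /(_ iln) /allP /(_ q (hc hq)).
  rewrite -vE => /orP[//|]; have := adjoin_sound (@lattice_word_add V) n (hspan n) wv.
  by case: adjoin => [//|[y /lattice_word_not_full/negP]].
(* Soundness of the span is used a second time, now with A the words of the code, to pass from v in
   the span to x in the code lattice. *)
pose A u := [/\ size u = 5%N, all (fun a => a < 24)%N u &
  code_lattice R 24 gens (residue_vec R 24 u)].
have A_add u w : A u -> A w -> A (addv 24 u w).
  move=> [su lu hu] [sw lw hw].
  have [s l e] := digits_addv (isT : 0 < 24)%N (digits_residue su lu) (digits_residue sw lw).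
  by split=> //; apply: code_lattice_congr e _; exact: code_latticeD.
have A0 : A (nseq 5 0%N).
  split=> //; apply: (@code_lattice_congr _ _ _ 0); last exact: code_lattice0.
  by move=> j; rewrite mxE sub0r rpredN mxE nth_nseq ltn_ord mul0r rpred0.
have Ag g : g \in gens -> A g.
  by move=> gg; have [s l _] := hg _ gg; split=> //; exact: code_lattice_gen.
have [_ _] := span_sound A_add A0 Ag vspan.
apply: code_lattice_congr => j; have [_ _ /(_ j)] := hv.
by rewrite -opprB rpredN.
Qed.

End Cover.

(** The search finds a permuted code inside the lattice, and [maximal] turns this inclusion into an
    equality. The permutations preserve the first n positions, so that the renumbered lattice is
    still covered by them. *)
Lemma search_classify V n (c : seq (seq nat)) (L codes : seq (seq (seq nat)))
    (perms : seq (seq nat)) :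
  minimal_cover R V (segment n) -> (n == 4%N) || (n == 5%N) ->
  {subset candidates 24 n.-1 <= c} ->
  (forall Ps, Ps \in L -> exists2 p, p \in Ps & lattice_word V p) ->
  search n (contains_code codes perms) L [:: nseq 5 0%N] ->
  (forall s, s \in perms -> perm_eq s (iota 0 5) /\
     forall k, (k < 5)%N -> (nth 0 s k < n)%N = (k < n)%N) ->
  (forall g, g \in codes -> maximal n c g) ->
  all (all (fun r => (size r == 5%N) && all (fun a => a < 24)%N r)) codes ->
  exists s gens, [/\ gens \in codes &
    simplex_lattice R (row_perm s V) = code_lattice R 24 gens].
Proof.
move=> hI n45 hc hL hs hperm hmax hwf.
have h0 x : x \in [:: nseq 5 0%N] -> lattice_word V x.
  by rewrite inE => /eqP->; exact: lattice_word0.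
have [H hH /hasP[gens gc /hasP[s sp /allP hg]]] :=
  search_sound (@lattice_word_add V) (@lattice_word_not_full V n hI n45) hL h0 hs.
have [hs1 hs2] := hperm _ sp; have [t ht] := perm_of_iota hs1.
have ss : size s = 5%N by rewrite (perm_size hs1) size_iota.
exists (t^-1)%g, gens; split=> //.
have hcov : minimal_cover R (row_perm t^-1 V) (segment n).
  have -> : segment n = [set i : 'I_5 | (t^-1)%g i \in segment n].
    apply/setP => i; rewrite !inE -[in LHS](permKV t i) -ht hs2 //.
  exact: minimal_cover_row_perm.
apply: (maximal_lattice hcov n45 hc (hmax _ gc)) => g gg.
have := allP hwf _ gc => /allP /(_ g gg) /andP[/eqP sg lg]; split=> //.
have [_ _] := hH _ (hg _ gg).
have -> : residue_vec R 24 [seq nth 0%N g i | i <- s] = col_perm t (residue_vec R 24 g).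
  by apply/rowP => i; rewrite !mxE (nth_map 0%N) ?ss // ht.
move/(lattice_row_perm t^-1).
by rewrite -col_permM mulVg col_perm1.
Qed.

End Classify.

(** * The two computed searches *)

Section Tables.
Local Open Scope nat_scope.

Definition scale24 (c : nat * seq (seq nat)) :=
  [seq [seq (24 %/ c.1 * a)%N | a <- r] | r <- c.2].

Definition codes5 : seq (nat * seq (seq nat)) :=
  [:: (2, [:: [:: 1; 1; 0; 0; 0]; [:: 0; 1; 1; 0; 0];
              [:: 0; 0; 1; 1; 0]; [:: 0; 0; 0; 1; 1]]);
      (4, [:: [:: 0; 1; 1; 1; 1]; [:: 2; 0; 1; 2; 3]]);
      (4, [:: [:: 0; 0; 1; 1; 2]; [:: 2; 2; 0; 2; 2]; [:: 0; 2; 3; 3; 0]]);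
      (8, [:: [:: 4; 0; 1; 2; 1]; [:: 4; 4; 0; 4; 4]])].

(* Coordinates 0 and 4 of the codes in the classification are exchanged, so that
   the first four coordinates are those that cover the lattice. *)
Definition codes4 : seq (nat * seq (seq nat)) :=
  [:: (3, [:: [:: 1; 0; 1; 1; 0]; [:: 2; 2; 0; 1; 1]]);
      (4, [:: [:: 2; 0; 1; 1; 0]; [:: 0; 2; 1; 3; 2]])].

(** Only for n = 5 does every renumbering preserve the covering set, so only there may the first
    word be sorted. *)
Definition sorted_points5 (c : seq (seq nat)) :=
  [seq p <- points 5 0 c | sorted leq p] :: [seq points 5 i c | i <- iota 1 4].

Definition perms4 := [seq rcons s 4 | s <- permutations (iota 0 4)].

(** The existential hides the candidate list, so that later steps treat it as opaque and cannot
    start to compute it. *)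
Lemma search5 : exists2 c, {subset candidates 24 4 <= c} &
  search 5 (contains_code (map scale24 codes5) (permutations (iota 0 5)))
    (sorted_points5 c) [:: nseq 5 0] && all (fun g => maximal 5 c (scale24 g)) codes5.
Proof. by exists (candidates 24 4); [|vm_compute]. Qed.

Lemma search4 : exists2 c, {subset candidates 24 3 <= c} &
  search 4 (contains_code (map scale24 codes4) perms4)
    [seq points 4 i c | i <- iota 0 4] [:: nseq 5 0] &&
  all (fun g => maximal 4 c (scale24 g)) codes4.
Proof. by exists (candidates 24 3); [|vm_compute]. Qed.

End Tables.

Section Classify.
Variable R : realType.

Lemma code_lattice_perm N (g h : seq (seq nat)) (t : 'S_5) : size g = size h ->
  (forall i (j : 'I_5), (i < size g)%N ->
     nth 0%N (nth [::] h i) j = nth 0%N (nth [::] g i) (t j)) ->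
  [set col_perm t x | x in code_lattice R N g]%classic = code_lattice R N h.
Proof.
move=> s e.
have es (k : nat -> nat) j : \sum_(i < size h) residue_vec R N (nth [::] h i) 0 j *+ k i =
    \sum_(i < size g) residue_vec R N (nth [::] g i) 0 (t j) *+ k i.
  by rewrite s; apply: eq_bigr => i _; rewrite !mxE e ?s.
apply/seteqP; split=> x.
  by move=> [y [k hk] <-]; exists k => j; rewrite es mxE.
move=> [k hk]; exists (col_perm t^-1 x); last by rewrite -col_permM mulgV col_perm1.
by exists k => j; have := hk ((t^-1)%g j); rewrite es permKV mxE.
Qed.

(* Sorting the word chosen for coordinate 0 is the symmetry reduction that keeps
   the search small. *)
Lemma sorted_point (V : 'M[int]_(5, 4)) c : minimal_cover R V (segment 5) ->
  {subset candidates 24 4 <= c} ->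
  exists t : 'S_5, minimal_cover R (row_perm t V) (segment 5) /\
    exists2 p, p \in [seq p <- points 5 0 c | sorted leq p] &
      lattice_word R (row_perm t V) p.
Proof.
move=> hI hc; have [p pP [sp lp hp]] := point_mem hI (orbT _) hc (isT : 0 < 5)%N.
have [Is hIs eIs] : exists2 Is, perm_eq Is (iota 0 5) & sort leq p = [seq nth 0%N p i | i <- Is].
  by rewrite -sp; apply/perm_iotaP; rewrite perm_sort.
have [t ht] := perm_of_iota hIs; exists t.
have hI' : minimal_cover R (row_perm t V) (segment 5).
  have -> : segment 5 = [set i : 'I_5 | t i \in segment 5].
    by apply/setP => i; rewrite !inE !ltn_ord.
  exact: minimal_cover_row_perm.
have hw : lattice_word R (row_perm t V) (sort leq p).
  split; rewrite ?size_sort // ?all_sort //.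
  have -> : residue_vec R 24 (sort leq p) = col_perm t (residue_vec R 24 p).
    apply/rowP => i; rewrite !mxE eIs (nth_map 0%N) ?ht //.
    by rewrite (perm_size hIs) size_iota.
  by apply/lattice_row_perm.
split=> //; exists (sort leq p) => //.
rewrite mem_filter sort_sorted; last exact: leq_total.
have [q [sq q0 pE]] : exists q, [/\ size q = 4%N, all (leq 1) q & p = 0%N :: q].
  have /mapP[q] := pP; rewrite mem_filter => /andP[fq _] pE; exists q.
  have sq : size q = 4%N by move: sp; rewrite pE /insert0 /= take0 drop0 /= => -[].
  by split=> //; [move: fq; rewrite /full take_oversize ?sq|rewrite pE /insert0 take0 drop0].
(* The other four entries are positive, so sorting leaves the zero in front and the result is again
   a point for coordinate 0. *)
have sE : sort leq p = 0%N :: sort leq q.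
  apply: (sorted_eq leq_trans anti_leq); first by apply: sort_sorted; exact: leq_total.
    rewrite /= path_min_sorted; first by apply: sort_sorted; exact: leq_total.
    by apply/allP.
  by rewrite perm_sort pE perm_cons perm_sym perm_sort.
have [ss ls hs] := hw; have hd := digits_residue R ss ls.
apply: (point_digits hI' (orbT _) hc (isT : 0 < 5)%N hs hd) => j _.
rewrite (digits_int j (isT : 0 < 24)%N hd) sE; case: j => -[|j] // hj /=.
have : nth 0%N (sort leq q) j \in q by rewrite -(mem_sort leq) mem_nth // size_sort sq.
by move=> /(allP q0); rewrite lt0n => /negbTE ->.
Qed.

Lemma classify5 (V : 'M[int]_(5, 4)) : minimal_cover R V (segment 5) ->
  exists s c, c \in codes5 /\
    simplex_lattice R (row_perm s V) = code_lattice R c.1 c.2.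
Proof.
move=> hI; have [c hc /andP[hs hm]] := search5.
have [t [hI' hp]] := sorted_point hI hc.
have [||||s [gens [gc e]]] := search_classify hI' (orbT _) hc _ hs.
- move=> Ps; rewrite inE => /orP[/eqP->//|/mapP[i]]; rewrite mem_iota => /andP[_ hi] ->.
  exact: point_mem.
- move=> r; rewrite mem_permutations => hr; split=> // k k5; rewrite k5.
  have : nth 0%N r k \in r by rewrite mem_nth // (perm_size hr) size_iota.
  by rewrite (perm_mem hr) mem_iota.
- by move=> g /mapP[a ha ->]; exact: (allP hm).
- by [].
have /mapP[a ha eg] := gc; exists (s * t)%g, a; split=> //.
rewrite row_permM e eg /scale24 code_lattice_scale //; move: ha; rewrite !inE;
by case/or4P => /eqP->.
Qed.

Lemma classify4 (V : 'M[int]_(5, 4)) : minimal_cover R V (segment 4) ->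
  exists s c, c \in codes4 /\
    simplex_lattice R (row_perm s V) = code_lattice R c.1 c.2.
Proof.
move=> hI; have [c hc /andP[hs hm]] := search4.
have [||||s [gens [gc e]]] := search_classify hI (orTb _) hc _ hs.
- move=> Ps /mapP[i]; rewrite mem_iota => /andP[_ hi] ->.
  exact: point_mem.
- move=> r /mapP[r' ]; rewrite mem_permutations => hr ->.
  have sr : size r' = 4%N by rewrite (perm_size hr) size_iota.
  split; first by rewrite -cats1 (perm_cat2r [:: 4%N] r' (iota 0 4)).
  move=> k k5; rewrite nth_rcons sr; case: (ltnP k 4) => k4.
    have : nth 0%N r' k \in r' by rewrite mem_nth ?sr.
    by rewrite (perm_mem hr) mem_iota.
  by have -> : k = 4%N by lia.
- by move=> g /mapP[a ha ->]; exact: (allP hm).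
- by [].
have /mapP[a ha eg] := gc; exists s, a; split=> //.
rewrite e eg /scale24 code_lattice_scale //; move: ha; rewrite !inE;
by case/orP => /eqP->.
Qed.

End Classify.

(** * Invariants *)

Section BinomialSeries.

Lemma coefM_eq (p q r : {poly int}) n : (forall j, (j <= n)%N -> p`_j = q`_j) ->
  forall j, (j <= n)%N -> (r * p)`_j = (r * q)`_j.
Proof.
move=> h j jn; rewrite !coefM; apply: eq_bigr => i _.
by rewrite h // (leq_trans (leq_subr _ _)).
Qed.

Lemma coef_1subX (p : {poly int}) j :
  ((1 - 'X) * p)`_j = p`_j - (if j is j'.+1 then p`_j' else 0).
Proof. by rewrite mulrBl mul1r coefB coefXM; case: j. Qed.

(** The series t^h / (1 - t)^(m + 1), truncated after degree n. *)
Definition shifted_binomials n h m : {poly int} :=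
  \poly_(k < n.+1) (if (h <= k)%N then ('C(m + (k - h), m))%:Z else 0).

(** By Pascal's rule one factor 1 - t lowers m by one, and truncation does not disturb the
    coefficients up to n. *)
Lemma coef_shifted_binomials n h m j : (j <= n)%N ->
  ((1 - 'X) ^+ m.+1 * shifted_binomials n h m)`_j = (h == j)%:Z.
Proof.
elim: m j => [|m IH] j jn.
  rewrite expr1 coef_1subX /shifted_binomials coef_poly ltnS jn.
  case: j jn => [|j] jn; first by rewrite leqn0; case: eqP => // _; rewrite bin0.
  rewrite coef_poly ltnS (ltnW jn); case: (ltngtP h j.+1) => hj.
  - by rewrite ltnS in hj; rewrite hj !bin0.
  - by rewrite leqNgt (ltnW hj).
  - by rewrite hj ltnn bin0.
rewrite exprSr -mulrA -IH //.
apply: (@coefM_eq _ _ _ n) => // i iln.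
rewrite coef_1subX /shifted_binomials !coef_poly ltnS iln.
case: i iln => [|i] iln.
  by rewrite leqn0; case: eqP => // ->; rewrite !subnn !addn0 !binn subr0.
rewrite coef_poly ltnS (ltnW iln); case: (ltngtP h i.+1) => hj.
- rewrite ltnS in hj; rewrite hj subSn // !addnS addSn binS.
  by rewrite PoszD; ring.
- by rewrite leqNgt (ltnW hj) subr0.
- by rewrite hj ltnn subnn !addn0 !binn.
Qed.

End BinomialSeries.

(** * Counting lattice points of dilated simplices *)

Section Dilation.
Variables (R : realType) (d : nat) (V : 'M[int]_(d.+1, d)).

Lemma dilated_point k (y : 'rV[int]_d) : (0 < k)%N ->
  lattice_points [set k%:R *: x | x in polytope R V]%classic y <->
  exists x : 'rV[R]_d.+1, [/\ forall i, 0 <= x 0 i, \sum_i x 0 i = k%:R &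
    x *m to_real R V = to_real R y].
Proof.
move=> k0; have k0' : k%:R != 0 :> R by rewrite pnatr_eq0 -lt0n.
rewrite /lattice_points /= polytopeE; split.
  move=> [_ [a [a0 a1] <-] e]; exists (k%:R *: a); split.
  - by move=> i; rewrite mxE mulr_ge0.
  - by under eq_bigr => i _ do rewrite mxE; rewrite -mulr_sumr a1 mulr1.
  - by rewrite -scalemxAl.
move=> [x [x0 x1 e]]; exists (k%:R^-1 *: x *m to_real R V).
  exists (k%:R^-1 *: x) => //; split=> [i|].
    by rewrite mxE mulr_ge0 // invr_ge0 ler0n.
  by under eq_bigr => i _ do rewrite mxE; rewrite -mulr_sumr x1 mulVf.
by rewrite -scalemxAl scalerA divff // scale1r.
Qed.

Lemma nonneg_point_lattice (x : 'rV[R]_d.+1) (k : nat) (y : 'rV[int]_d) :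
  \sum_i x 0 i = k%:R -> x *m to_real R V = to_real R y -> simplex_lattice R V x.
Proof.
move=> h1 h2; exists (row_mx y (const_mx k%:Z)).
by rewrite mul_homog h1 h2 /to_real map_row_mx map_const_mx.
Qed.

End Dilation.

Section Ehrhart.
Variables (R : realType) (V : 'M[int]_(5, 4)) (N : nat) (W : seq (seq nat)).
Hypothesis hV : lattice_simplex R V.
Hypothesis N0 : (0 < N)%N.
Local Notation G := (simplex_lattice R V).
Local Notation P := (polytope R V).

(** W represents the half-open box, one word for each class of the lattice modulo Z^5. It is an
    arbitrary list because the words of the family depend on a variable modulus and are not computed
    as those of the sporadic codes are. *)
Definition word_list := [/\ uniq W,
  forall w, w \in W -> [/\ size w = 5%N, all (fun a => a < N)%N w & G (residue_vec R N w)] &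
  forall x, G x -> exists2 w, w \in W & digits_of N x w].

Hypothesis hW : word_list.

Definition height (w : seq nat) := (sumn w %/ N)%N.

Lemma residue_vec_sum w : w \in W ->
  \sum_i residue_vec R N w 0 i = (height w)%:R.
Proof.
have [_ hW1 _] := hW; move=> /hW1[sw lw hw].
have [k hk] : exists k, sumn w = (k * N)%N.
  have := lattice_coord_sum hw; under eq_bigr do rewrite mxE.
  rewrite -mulr_suml -natr_sum ratio_int // => /dvdnP[k hk]; exists k.
  by rewrite -hk sumnE (big_nth 0%N) sw big_mkord.
rewrite /height hk mulnK //; under eq_bigr do rewrite mxE.
rewrite -mulr_suml -natr_sum.
have -> : (\sum_(i < 5) nth 0 w i = k * N)%N.
  by rewrite -hk sumnE (big_nth 0%N) sw big_mkord.
by rewrite natrM mulfK // pnatr_eq0 -lt0n.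
Qed.

Definition tuple_vec j (t : 5.-tuple 'I_j.+1) : 'rV[R]_5 := \row_i (tnth t i)%:R.

(** The shape of tuples that [card_ord_partitions] counts. *)
Definition compositions j := enum [set t : 5.-tuple 'I_j.+1 | (\sum_(i <- t) i == j)%N].

(** A lattice point of k P has nonnegative coordinates with sum k with respect to the vertices.
    Their fractional parts form a word w, their integral parts a composition of [k - height w]. *)
Definition dilated_points k : seq 'rV[int]_4 :=
  [seq map_mx Num.floor ((residue_vec R N w + tuple_vec t) *m to_real R V)
  | w <- [seq w <- W | (height w <= k)%N], t <- compositions (k - height w)].

Lemma tuple_vec_sum j (t : 5.-tuple 'I_j.+1) :
  t \in compositions j -> \sum_i tuple_vec t 0 i = j%:R.
Proof.
rewrite mem_enum inE => /eqP e.
under eq_bigr do rewrite mxE.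
by rewrite -natr_sum -[in RHS]e big_tuple.
Qed.

Lemma word_plus_int w j (t : 5.-tuple 'I_j.+1) : w \in W ->
  G (residue_vec R N w + tuple_vec t).
Proof.
have [_ hW1 _] := hW; move=> /hW1[_ _ hw]; apply: latticeD => //.
by apply: lattice_int => i; rewrite mxE natr_int.
Qed.

Lemma word_plus_intE w k (t : 5.-tuple 'I_(k - height w).+1) :
  w \in W -> (height w <= k)%N -> t \in compositions (k - height w) ->
  (residue_vec R N w + tuple_vec t) *m homog (to_real R V) =
  to_real R (row_mx (map_mx Num.floor ((residue_vec R N w + tuple_vec t) *m to_real R V))
                    (const_mx k%:Z)).
Proof.
move=> wW wk tT; have [l hl] := word_plus_int t wW.
rewrite {1}mul_homog /to_real map_row_mx map_const_mx; congr row_mx.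
  apply/rowP => j; rewrite [RHS]mxE [X in X%:~R]mxE floorK //.
  move/rowP/(_ (lshift 1 j)): hl.
  by rewrite mul_homog row_mxEl => ->; exact: to_real_int.
apply/rowP => j; rewrite !mxE.
under eq_bigr do rewrite mxE.
by rewrite big_split /= residue_vec_sum // tuple_vec_sum // -natrD subnKC.
Qed.

Lemma word_plus_int_inj w w' j j' (t : 5.-tuple 'I_j.+1) (t' : 5.-tuple 'I_j'.+1) :
  w \in W -> w' \in W ->
  residue_vec R N w + tuple_vec t = residue_vec R N w' + tuple_vec t' ->
  w = w' /\ forall i, tnth t i = tnth t' i :> nat.
Proof.
have [_ hW1 _] := hW; move=> /hW1[sw lw _] /hW1[sw' lw' _] /rowP e.
have N0' : N%:R != 0 :> R by rewrite pnatr_eq0 -lt0n.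
have e' (i : 'I_5) : (nth 0 w i + tnth t i * N = nth 0 w' i + tnth t' i * N)%N.
  have := congr1 ( *%R^~ N%:R) (e i); rewrite !mxE !mulrDl !divfK // -!natrM -!natrD.
  by move/eqP; rewrite eqr_nat => /eqP.
have lt (v : seq nat) (i : 'I_5) : size v = 5%N -> all (fun a => a < N)%N v -> (nth 0 v i < N)%N.
  by move=> sv /allP; apply; rewrite mem_nth ?sv.
have ew (i : 'I_5) : nth 0%N w i = nth 0%N w' i.
  have := congr1 (modn^~ N) (e' i).
  by rewrite /= ![(nth _ _ _ + _)%N]addnC !modnMDl !modn_small ?lt.
split=> [|i].
  apply: (@eq_from_nth _ 0%N); first by rewrite sw sw'.
  by move=> i; rewrite sw => i5; exact: (ew (Ordinal i5)).
by have := e' i; rewrite ew => /addnI/eqP; rewrite eqn_pmul2r // => /eqP.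
Qed.

Lemma homog_inj (x y : 'rV[R]_5) :
  x *m homog (to_real R V) = y *m homog (to_real R V) -> x = y.
Proof.
move=> /(congr1 (mulmx^~ (vertex_inv R V))).
by rewrite /= -!mulmxA mul_vertex_inv // !mulmx1.
Qed.

Lemma dilated_points_uniq k : uniq (dilated_points k).
Proof.
have [uW _ _] := hW.
apply: allpairs_uniq_dep; first exact: filter_uniq.
  by move=> w _; exact: enum_uniq.
move=> u v /allpairsPdep[w [t [+ ht ->]]] /allpairsPdep[w' [t' [+ ht' ->]]].
rewrite !mem_filter /= => /andP[wk wW] /andP[wk' wW'] e.
have /homog_inj /(word_plus_int_inj wW wW')[ww] :
    (residue_vec R N w + tuple_vec t) *m homog (to_real R V) =
    (residue_vec R N w' + tuple_vec t') *m homog (to_real R V).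
  rewrite (word_plus_intE wW wk ht) (word_plus_intE wW' wk' ht').
  by congr (to_real R (row_mx _ _)); exact: e.
subst w' => et.
congr existT; apply: eq_from_tnth => i; apply: val_inj; exact: et.
Qed.

Lemma mem_dilated_points k y : (0 < k)%N ->
  y \in dilated_points k <-> lattice_points [set k%:R *: x | x in P]%classic y.
Proof.
move=> k0; rewrite dilated_point //; have [_ hW1 hW2] := hW; split.
  move=> /allpairsPdep[w [t [+ ht ->]]]; rewrite mem_filter => /andP[wk wW].
  exists (residue_vec R N w + tuple_vec t); split.
  - by move=> i; rewrite !mxE addr_ge0 // divr_ge0.
  - under eq_bigr do rewrite mxE.
    by rewrite big_split /= residue_vec_sum // tuple_vec_sum // -natrD subnKC.
  - have := word_plus_intE wW wk ht.
    by rewrite {1}mul_homog /to_real map_row_mx => /eq_row_mx[].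
move=> [x [x0 xk hx]].
have [w wW [sw lw cw]] := hW2 _ (nonneg_point_lattice xk hx).
have fw (i : 'I_5) : 0 <= residue_vec R N w 0 i < 1.
  rewrite mxE divr_ge0 //= ltr_pdivrMr ?ltr0n // mul1r ltr_nat.
  by move/allP: lw; apply; rewrite mem_nth ?sw.
have fl (i : 'I_5) : exists m : nat, x 0 i = residue_vec R N w 0 i + m%:R.
  have /intrP[z hz] := cw i.
  have z0 : 0 <= z.
    have : ((-1)%:~R : R) < z%:~R.
      by rewrite -hz mulrN1z; have := fw i; have := x0 i; lra.
    by rewrite ltr_int; lia.
  exists (absz z); rewrite pmulrn gez0_abs // -hz; ring.
have /choice[m hm] := fl.
have hsum : (height w + \sum_i m i = k)%N.
  apply/eqP; rewrite -(eqr_nat R) natrD -xk -(residue_vec_sum wW) natr_sum -big_split /=.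
  by apply/eqP; apply: eq_bigr => i _; rewrite hm.
have ek : (k - height w = \sum_i m i)%N by rewrite -hsum addKn.
have wk : (height w <= k)%N by rewrite -hsum leq_addr.
have mlt i : (m i < (k - height w).+1)%N.
  by rewrite ltnS -hsum addKn (bigD1 i) //= leq_addr.
pose t := [tuple Ordinal (mlt i) | i < 5].
have xE : x = residue_vec R N w + tuple_vec t.
  by apply/rowP => i; rewrite hm [RHS]mxE; congr (_ + _); rewrite mxE tnth_mktuple.
apply/allpairsPdep; exists w, t; split; first by rewrite mem_filter wk wW.
  rewrite mem_enum inE big_tuple; apply/eqP; rewrite [RHS]ek.
  by apply: eq_bigr => i _; rewrite tnth_mktuple.
rewrite -xE; apply: (@to_real_inj R); rewrite -hx; apply/rowP => i.
by rewrite [RHS]mxE [X in _ = X%:~R]mxE floorK // hx to_real_int.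
Qed.

Lemma size_compositions j : size (compositions j) = 'C(4 + j, 4).
Proof. by rewrite -cardE card_ord_partitions. Qed.

Lemma ehrhart_words k : nseq 5 0%N \in W ->
  ehrhart_coef P k = (\sum_(w <- W) if (height w <= k)%N then 'C(4 + (k - height w), 4) else 0)%N.
Proof.
have [uW hW1 _] := hW.
rewrite /ehrhart_coef; case: eqP => [-> h0|/eqP k0 _].
  (* At k = 0 the coefficient is 1 by definition, and the sum agrees because the zero word is the
     only word of height 0. *)
  rewrite (bigD1_seq _ h0 uW) /= big1_seq => [|w /andP[w0 wW]].
    by rewrite /height div0n leqnn subn0.
  rewrite leqn0; case: eqP => // hw; case/negP: w0; apply/eqP.
  have := residue_vec_sum wW; rewrite hw => /eqP.
  rewrite psumr_eq0 => [/allP h|i _]; last by rewrite mxE divr_ge0.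
  have [sw _ _] := hW1 _ wW; apply: (@eq_from_nth _ 0%N); rewrite sw ?size_nseq // => i i5.
  rewrite -[X in _ = nth _ X _]/(nseq 5 0%N) nth_nseq i5; have := h (Ordinal i5) (mem_index_enum _).
  by rewrite mxE mulf_eq0 invr_eq0 !pnatr_eq0 -[N == _]negbK -lt0n N0 orbF => /eqP.
have k1 : (0 < k)%N by rewrite lt0n.
have -> : lattice_points [set k%:R *: x | x in P]%classic = [set` dilated_points k]%classic.
  by apply/seteqP; split=> y /mem_dilated_points; apply.
transitivity (size (dilated_points k)).
  apply/perm_size/uniq_perm; [exact: fset_uniq|exact: dilated_points_uniq|].
  move=> y; apply: (etrans (in_fset_set _ y)); [exact: finite_seq|exact: asboolb].
rewrite size_allpairs_dep.
rewrite sumnE big_map big_filter big_mkcond /=.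
by apply: eq_bigr => w _; rewrite size_compositions.
Qed.

(** A word of height h contributes t^h / (1 - t)^5 to the Ehrhart series. *)
Lemma hstar_words : nseq 5 0%N \in W ->
  is_hstar P (\sum_(w <- W) 'X^(height w)).
Proof.
move=> h0 n; have -> : \poly_(k < n.+1) (ehrhart_coef P k)%:Z =
    \sum_(w <- W) shifted_binomials n (height w) 4.
  apply/polyP => k; rewrite coef_poly coef_sum.
  case: ltnP => hk; last first.
    by rewrite big1 // => w _; rewrite coef_poly ltnNge hk.
  rewrite ehrhart_words // (big_morph Posz PoszD (erefl 0%:Z)); apply: eq_bigr => w _.
  by rewrite coef_poly hk; case: ifP.
rewrite mulr_sumr !coef_sum; apply: eq_bigr => w _.
by rewrite coef_shifted_binomials // coefXn eq_sym; case: eqP.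
Qed.

End Ehrhart.

(** * Listing the words of a code *)

Definition codewords (N : nat) (g : seq (seq nat)) : seq (seq nat) :=
  foldr (fun r C => undup [seq addv N (scalev N k r) c | k <- iota 0 N, c <- C])
    [:: nseq 5 0%N] g.

Section Codewords.
Variables (R : realType) (N : nat).
Hypothesis N0 : (0 < N)%N.
Let wf (g : seq (seq nat)) := all (fun r => (size r == 5%N) && all (fun a => a < N)%N r) g.

Lemma code_lattice_cons r g (x : 'rV[R]_5) :
  code_lattice R N (r :: g) x <-> exists k, code_lattice R N g (x - residue_vec R N r *+ k).
Proof.
have e k j : (x - residue_vec R N r *+ k) 0 j = x 0 j - residue_vec R N r 0 j *+ k.
  by rewrite mxE [X in _ + X]mxE mulmxnE.
split=> [[k hk]|[k [l hl]]].
  exists (k 0%N); exists (fun i => k i.+1) => j; have := hk j.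
  by rewrite big_ord_recl /= opprD addrA e.
exists (fun i => if i is i'.+1 then l i' else k) => j; have := hl j.
by rewrite big_ord_recl /= opprD addrA e.
Qed.

Lemma residue_vec0 : residue_vec R N (nseq 5 0%N) = 0.
Proof. by apply/rowP => i; rewrite !mxE nth_nseq ltn_ord mul0r. Qed.

Lemma codewords_sound g w : wf g -> w \in codewords N g ->
  [/\ size w = 5%N, all (fun a => a < N)%N w & code_lattice R N g (residue_vec R N w)].
Proof.
elim: g w => [|r g IH] w /=.
  rewrite inE => _ /eqP->; split=> //; first by rewrite /= N0.
  by rewrite residue_vec0; exact: code_lattice0.
move=> /andP[/andP[/eqP sr lr] hg]; rewrite mem_undup => /allpairsPdep[k [c [_ hc ->]]].
have [sc lc hx] := IH _ hg hc.
have [s l e] := digits_addv N0 (digits_scalev k N0 (digits_residue R sr lr))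
  (digits_residue R sc lc).
split=> //; apply: code_lattice_congr e _; apply/code_lattice_cons; exists k.
by rewrite addrC addKr.
Qed.

Lemma codewords_complete g x : wf g -> code_lattice R N g x ->
  exists2 w, w \in codewords N g & digits_of N x w.
Proof.
elim: g x => [|r g IH] x /=.
  move=> _ [k hk]; exists (nseq 5 0%N); first exact: mem_head.
  split=> //; first by rewrite /= N0.
  by move=> i; have := hk i; rewrite big_ord0 residue_vec0 mxE.
move=> /andP[/andP[/eqP sr lr] hg] /code_lattice_cons[k /(IH _ hg)[w hw dw]].
exists (addv N (scalev N (k %% N) r) w).
  rewrite mem_undup; apply/allpairsPdep; exists (k %% N)%N, w.
  by rewrite mem_iota ltn_pmod.
have -> : scalev N (k %% N) r = scalev N k r.
  by apply: eq_map => a; rewrite modnMml.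
have := digits_addv N0 (digits_scalev k N0 (digits_residue R sr lr)) dw.
by rewrite addrC subrK.
Qed.

Lemma codewords_uniq g : uniq (codewords N g).
Proof. by case: g => [//|r g] /=; exact: undup_uniq. Qed.

Lemma codewords_list (V : 'M[int]_(5, 4)) g : wf g ->
  simplex_lattice R V = code_lattice R N g -> word_list R V N (codewords N g).
Proof.
move=> hg hG; split; first exact: codewords_uniq.
  by move=> w /(codewords_sound hg); rewrite hG.
by move=> x; rewrite hG; exact: codewords_complete.
Qed.

End Codewords.

(** * Recovering the modulus and the code from the lattice *)

Section CodeModulus.
Variables (R : realType) (V : 'M[int]_(5, 4)) (N : nat) (g : seq (seq nat)).
Hypothesis N1 : (1 < N)%N.
Hypothesis hG : simplex_lattice R V = code_lattice R N g.
Let N0 : (0 < N)%N := ltnW N1.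

Lemma code_lattice_mulN x i : code_lattice R N g x -> x 0 i * N%:R \is a Num.int.
Proof.
have N0' : N%:R != 0 :> R by rewrite pnatr_eq0 -lt0n.
move=> [k /(_ i) hk]; rewrite -[x 0 i](subrK (\sum_(l < size g) residue_vec R N (nth [::] g l) 0 i *+ k l)).
rewrite mulrDl rpredD //; first by rewrite rpredM ?natr_int.
rewrite mulr_suml rpred_sum // => l _.
by rewrite mulrnAl mxE divfK // rpredMn ?natr_int.
Qed.

Lemma denominators_dvd n : denominators R V n -> (n %| N)%N.
Proof.
rewrite /denominators Lambda_lattice hG => -[x /code_lattice_mulN hx [i [q [hq ->]]]].
have := hx i; rewrite hq => /intrP[z hz].
have : ratr (q * N%:R) = ratr z%:~R :> R by rewrite rmorphM /= ratr_nat ratr_int.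
move=> /(fmorph_inj (ratr : rat -> R)) e.
have : (z%:~R : rat) * (denq q)%:~R = (numq q)%:~R * N%:R.
  by rewrite -e -[in X in X * _ * _](divq_num_den q) mulrAC divfK // intr_eq0 denq_eq0.
rewrite pmulrn -!intrM => /intr_inj e'.
have : (absz (denq q) %| absz (numq q) * N)%N.
  by apply/dvdnP; exists (absz z); rewrite -[N in LHS]/(absz N) -!abszM -e'.
by rewrite Gauss_dvdr // coprime_sym coprime_num_den.
Qed.

Lemma denominators_finite : finite_set (denominators R V).
Proof.
apply: (sub_finite_set _ (finite_II N.+1)) => n /denominators_dvd h.
by rewrite /= ltnS dvdn_leq.
Qed.

Lemma denominatorN r i : r \in g -> (i < 5)%N -> nth 0%N r i = 1%N -> denominators R V N.
Proof.
move=> rg i5 ri; exists (residue_vec R N r); first by rewrite Lambda_lattice hG; exact: code_lattice_gen.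
exists (Ordinal i5), (1%:~R / N%:Z%:~R); rewrite mxE /= ri; split.
  by rewrite fmorph_div /= !ratr_int -pmulrn.
have /negbTE e : N%:Z != 0 by move: N0; lia.
by rewrite coprimeq_den ?coprime1n // e.
Qed.

(** All denominators divide N, and a generator with an entry 1 has a coordinate 1/N, whose
    denominator is N. *)
Lemma code_modulusE r i : r \in g -> (i < 5)%N -> nth 0%N r i = 1%N -> code_modulus R V = N.
Proof.
move=> rg i5 ri; have hN := denominatorN rg i5 ri.
rewrite /code_modulus fsbig_finite; last exact: denominators_finite.
apply/eqP; rewrite eqn_dvd; apply/andP; split.
  rewrite big_seq; elim/big_ind: _ => //; first by move=> a b ha hb; rewrite dvdn_lcm ha.
  move=> n; rewrite in_fset_set; last exact: denominators_finite.
  by rewrite inE => /denominators_dvd.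
rewrite (big_fsetD1 N) /=; first exact: dvdn_lcml.
by rewrite in_fset_set ?inE //; exact: denominators_finite.
Qed.

(** N times the fractional part differs from the integral combination of the generators by a
    multiple of N, which vanishes in ['Z_N]. *)
Lemma code_digit (x : 'rV[R]_5) (k : nat -> nat) j :
  x 0 j - \sum_(i < size g) residue_vec R N (nth [::] g i) 0 j *+ k i \is a Num.int ->
  (Num.floor (N%:R * frac_part (x 0 j)))%:~R =
  \sum_(i < size g) (k i)%:R * (nth 0%N (nth [::] g i) j)%:R :> 'Z_N.
Proof.
have N0' : N%:R != 0 :> R by rewrite pnatr_eq0 -lt0n.
move=> /intrP[z hz].
have e : N%:R * frac_part (x 0 j) = (N%:Z * (z - Num.floor (x 0 j)) +
    (\sum_(i < size g) k i * nth 0%N (nth [::] g i) j)%N%:Z)%:~R.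
  rewrite intrD intrM intrB -!pmulrn natr_sum /frac_part -hz.
  have -> : (\sum_(i < size g) (k i * nth 0 (nth [::] g i) j)%N%:R : R) =
      N%:R * \sum_(i < size g) residue_vec R N (nth [::] g i) 0 j *+ k i.
    rewrite mulr_sumr; apply: eq_bigr => i _.
    by rewrite mxE natrM [RHS]mulrnAr [X in _ = X *+ _]mulrC divfK // mulr_natl.
  ring.
rewrite e intrKfloor intrD intrM -!pmulrn pchar_Zp // mul0r add0r natr_sum.
by apply: eq_bigr => i _; rewrite natrM.
Qed.

Lemma code_at_generated : code_at N (code_lattice R N g) = @generated_code N 5 g.
Proof.
apply/seteqP; split=> c.
  move=> [x [k hk] <-]; exists (\row_i (k i)%:R) => //; apply/rowP => j.
  by rewrite [RHS]mxE (code_digit (hk j)) mxE; apply: eq_bigr => i _; rewrite !mxE.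
move=> [a _ <-].
pose k i := if insub i is Some l then nat_of_ord (a 0 (l : 'I_(size g))) else 0%N.
have hk j : (\sum_(i < size g) residue_vec R N (nth [::] g i) *+ k i) 0 j -
    \sum_(i < size g) residue_vec R N (nth [::] g i) 0 j *+ k i \is a Num.int.
  by rewrite summxE; under eq_bigr do rewrite mulmxnE; rewrite subrr rpred0.
exists (\sum_(i < size g) residue_vec R N (nth [::] g i) *+ k i); first by exists k.
apply/rowP => j; rewrite mxE (code_digit (hk j)) mxE; apply: eq_bigr => i _.
by rewrite /k valK natr_Zp mxE.
Qed.

Lemma simplex_code_generated : code_modulus R V = N ->
  code_iso (simplex_code R V) (@generated_code (code_modulus R V) 5 g).
Proof.
move=> eN; exists 1%g.
suff -> : simplex_code R V = @generated_code (code_modulus R V) 5 g.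
  apply/seteqP; split=> c; first by move=> hc; exists c => //; rewrite col_perm1.
  by move=> [c' hc' <-]; rewrite col_perm1.
change (code_at (code_modulus R V) (Lambda R V) = @generated_code (code_modulus R V) 5 g).
by rewrite eN Lambda_lattice hG code_at_generated.
Qed.

End CodeModulus.

(** * Lattice width through dual vectors *)

Section Width.
Variables (R : realType) (d : nat) (V : 'M[int]_(d.+1, d)).
Local Notation P := (polytope R V).

Definition form_values (u : 'cV[int]_d) : set R := [set (x *m to_real R u) 0 0 | x in P]%classic.

Lemma form_values_vertex u i : form_values u ((V *m u) i 0)%:~R.
Proof.
exists (row i (to_real R V)); last by rewrite -row_mul -to_realM mxE mxE.
rewrite polytopeE; exists (delta_mx 0 i); first exact: barycentric_delta.
by rewrite -rowE.
Qed.

Lemma form_values_bounds u (a b : R) :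
  (forall i, a <= ((V *m u) i 0)%:~R <= b) ->
  forall z, form_values u z -> a <= z <= b.
Proof.
move=> h _ [x + <-]; rewrite polytopeE => -[t [t0 t1] <-].
rewrite -mulmxA -to_realM mxE; apply/andP; split.
  rewrite -[a]mul1r -t1 mulr_suml; apply: ler_sum => i _.
  by rewrite ler_wpM2l // mxE; have /andP[] := h i.
rewrite -[b]mul1r -t1 mulr_suml; apply: ler_sum => i _.
by rewrite ler_wpM2l // mxE; have /andP[] := h i.
Qed.

Lemma form_values_bound u z : form_values u z ->
  - (\sum_i `|(V *m u) i 0|)%:~R <= z <= (\sum_i `|(V *m u) i 0|)%:~R.
Proof.
apply: form_values_bounds => i; rewrite -intrN !ler_int -ler_norml.
by rewrite (bigD1 i) //= lerDl sumr_ge0.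
Qed.

Lemma width_along_ge u i j :
  ((V *m u) i 0 - (V *m u) j 0)%:~R <= width_along P u.
Proof.
rewrite /width_along -/(form_values u) intrB; apply: lerB.
  apply: ub_le_sup; last exact: form_values_vertex.
  by eexists => z /form_values_bound/andP[_]; apply.
apply: ge_inf; last exact: form_values_vertex.
by eexists => z /form_values_bound/andP[+ _]; apply.
Qed.

Lemma width_along_le u (a : int) (w : nat) :
  (forall i, a <= (V *m u) i 0 <= a + w%:Z) -> width_along P u <= w%:R.
Proof.
move=> h; rewrite /width_along -/(form_values u).
have hb z : form_values u z -> a%:~R <= z <= (a + w%:Z)%:~R.
  by apply: form_values_bounds => i; rewrite !ler_int.
have hn : (form_values u !=set0)%classic by exists ((V *m u) ord0 0)%:~R; exact: form_values_vertex.
have -> : w%:R = (a + w%:Z)%:~R - a%:~R :> R by rewrite intrD addrC addKr pmulrn.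
apply: lerB; first by apply: ge_sup => // z /hb/andP[].
by apply: lb_le_inf => // z /hb/andP[].
Qed.

Lemma lattice_width_eq (w : nat) :
  (exists2 u : 'cV[int]_d, u != 0 & exists a : int, forall i, a <= (V *m u) i 0 <= a + w%:Z) ->
  (forall u : 'cV[int]_d, u != 0 -> exists i j, w%:Z <= (V *m u) i 0 - (V *m u) j 0) ->
  lattice_width P = w%:R.
Proof.
move=> [u0 u0n [a ha]] h.
have lb u : u != 0 -> w%:R <= width_along P u.
  move=> /h[i [j hij]]; apply: le_trans (width_along_ge u i j).
  by rewrite pmulrn ler_int.
have e0 : width_along P u0 = w%:R.
  by apply/eqP; rewrite eq_le lb // (width_along_le ha).
apply/eqP; rewrite eq_le; apply/andP; split.
  rewrite -e0; apply: ge_inf; last by exists u0.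
  by exists w%:R => _ [u /= un <-]; exact: lb.
apply: lb_le_inf; first by exists (width_along P u0), u0.
by move=> _ [u /= un <-]; exact: lb.
Qed.

Hypothesis hV : lattice_simplex R V.

(** Otherwise u together with a constant would give an affine form vanishing at all vertices, but
    (V, 1) is invertible. *)
Lemma form_not_constant (u : 'cV[int]_d) : u != 0 ->
  exists i j, (V *m u) j 0 < (V *m u) i 0.
Proof.
move=> u0; apply: contrapT => hn.
have hc i : (V *m u) i 0 = (V *m u) ord0 0.
  by apply/eqP; case: ltrgtP => // h; case: hn; [exists ord0, i|exists i, ord0].
have : homog (to_real R V) *m to_real R (col_mx u (const_mx (- (V *m u) ord0 0))) = 0.
  rewrite homog_to_real -to_realM /homog mul_row_col.
  rewrite -[RHS](map_mx0 intr); congr (to_real R _).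
  apply/matrixP => i j; rewrite ord1 mxE hc [X in _ + X]mxE big_ord1 !mxE mul1r.
  by rewrite subrr.
move=> /(congr1 (mulmx (vertex_inv R V))).
rewrite mulmxA vertex_invM // mul1mx mulmx0 => e.
case/eqP: u0; apply: (@to_real_inj R).
have := congr1 usubmx e; rewrite /to_real map_col_mx col_mxKu => ->.
by apply/matrixP => i j; rewrite !mxE.
Qed.

Definition dual_form (y : 'I_d.+1 -> int) :=
  forall x, simplex_lattice R V x -> \sum_i x 0 i * (y i)%:~R \is a Num.int.

Lemma dual_formP y : dual_form y ->
  exists (u : 'cV[int]_d) c, forall i, y i = (V *m u) i 0 + c.
Proof.
move=> hy; have [|w hw] := @lattice_dual R d V hV (\col_i (y i)%:~R).
  move=> x /hy; congr (is_true (_ \is a _)); rewrite mxE.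
  by apply: eq_bigr => i _; rewrite mxE.
exists (usubmx w), (w (rshift d 0) 0) => i.
have := congr1 (fun M : 'cV[R]_d.+1 => M i 0) hw.
rewrite homog_to_real -to_realM [LHS]mxE [RHS]mxE => /intr_inj ->.
rewrite -{1}(vsubmxK w) /homog mul_row_col mxE; congr (_ + _).
by rewrite mxE big_ord1 !mxE mul1r.
Qed.

Lemma form_dual (u : 'cV[int]_d) c : dual_form (fun i => (V *m u) i 0 + c).
Proof.
move=> x hx; under eq_bigr do rewrite intrD mulrDr.
rewrite big_split -mulr_suml /= rpredD //; last first.
  by rewrite rpredM ?intr_int //; exact: lattice_coord_sum hx.
have [l hl] := hx; have -> : \sum_i x 0 i * ((V *m u) i 0)%:~R =
    (x *m to_real R V *m to_real R u) 0 0.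
  by rewrite -mulmxA -to_realM mxE; apply: eq_bigr => i _; rewrite [to_real R _ _ _]mxE.
move: hl; rewrite mul_homog => /(congr1 lsubmx); rewrite row_mxKl => ->.
by rewrite /to_real -map_lsubmx -/(to_real R _) -to_realM to_real_int.
Qed.

Lemma lattice_width1 (y : 'I_d.+1 -> int) i0 j0 :
  dual_form y -> (forall i, 0 <= y i <= 1) -> y i0 != y j0 -> lattice_width P = 1.
Proof.
move=> hy y01 yn; apply: (@lattice_width_eq 1).
  have [u [c hu]] := dual_formP hy; exists u.
    by apply: contra_neq yn => u0; rewrite !hu u0 mulmx0 !mxE.
  by exists (- c) => i; have := y01 i; rewrite hu; lia.
by move=> u /form_not_constant[i [j hij]]; exists i, j; lia.
Qed.

Lemma lattice_width2 (y : 'I_d.+1 -> int) i0 j0 :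
  dual_form y -> (forall i, 0 <= y i <= 2) -> y i0 != y j0 ->
  (forall z : 'I_d.+1 -> int, (forall i, 0 <= z i <= 1) -> dual_form z -> forall i j, z i = z j) ->
  lattice_width P = 2.
Proof.
move=> hy y02 yn hz; apply: (@lattice_width_eq 2).
  have [u [c hu]] := dual_formP hy; exists u.
    by apply: contra_neq yn => u0; rewrite !hu u0 mulmx0 !mxE.
  by exists (- c) => i; have := y02 i; rewrite hu; lia.
move=> u u0; apply: contrapT => hn.
have [i [j hij]] := form_not_constant u0.
have hd k l : (V *m u) k 0 - (V *m u) l 0 <= 1.
  by rewrite leNgt; apply/negP => h; apply: hn; exists k, l; lia.
(* All differences are at most 1 and vertex j has a smaller value than vertex i, so j attains the
   minimum; subtracting its value leaves only the values 0 and 1. *)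
have := hz (fun k => (V *m u) k 0 + (- (V *m u) j 0)) _ (form_dual u _) i j.
suff h01 : forall k, 0 <= (V *m u) k 0 + (- (V *m u) j 0) <= 1.
  by move=> /(_ h01); lia.
by move=> k; have := hd k j; have := hd i k; have := hd i j; lia.
Qed.

End Width.

(** * The spanning property *)

Section Spanning.
Variables (R : realType) (V : 'M[int]_(5, 4)).
Hypothesis hV : lattice_simplex R V.
Local Notation G := (simplex_lattice R V).
Local Notation P := (polytope R V).

Definition generated (x : 'rV[R]_5) :=
  exists n (A : 'M[int]_(n, 4)) (c : 'rV[int]_n),
    (forall i, lattice_points P (row i A)) /\
    x *m homog (to_real R V) = to_real R (c *m homog A).

Lemma generatedD x y : generated x -> generated y -> generated (x + y).
Proof.
move=> [m [A [a [hA ea]]]] [n [B [b [hB eb]]]].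
exists (m + n)%N, (col_mx A B), (row_mx a b); split.
  move=> i; rewrite -(splitK i); case: (fintype.split i) => j /=.
    by rewrite rowKu.
  by rewrite rowKd.
rewrite mulmxDl ea eb -to_realD; congr (to_real R _).
have -> : homog (col_mx A B) = col_mx (homog A) (homog B).
  by rewrite /homog -block_mxEv block_mxEh col_mx_const.
by rewrite mul_row_col.
Qed.

Lemma generated0 : generated 0.
Proof.
exists 0%N, 0, 0; split; first by case.
by rewrite !mul0mx /to_real map_mx0.
Qed.

Lemma generatedN x : generated x -> generated (- x).
Proof.
move=> [m [A [a [hA ea]]]]; exists m, A, (- a); split=> //.
by rewrite !mulNmx ea to_realN.
Qed.

Lemma generatedMn x k : generated x -> generated (x *+ k).
Proof.
move=> hx; elim: k => [|k IH]; first by rewrite mulr0n; exact: generated0.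
by rewrite mulrS; exact: generatedD.
Qed.

Lemma generatedMz x k : generated x -> generated (x *~ k).
Proof.
move=> hx; case: k => k; first exact: generatedMn.
by rewrite NegzE mulrNz; apply: generatedN; exact: generatedMn.
Qed.

Lemma generated_sum (I : Type) (r : seq I) (F : I -> 'rV[R]_5) :
  (forall i, generated (F i)) -> generated (\sum_(i <- r) F i).
Proof. by move=> h; elim/big_ind: _ => //; [exact: generated0|exact: generatedD]. Qed.

Lemma generated_unit x : G x -> barycentric R 5 x -> generated x.
Proof.
move=> [l hl] hx; exists 1%N, (lsubmx l), 1%:M; split.
  move=> i; rewrite row_id /lattice_points /= polytopeE; exists x => //.
  by move: hl; rewrite mul_homog => /(congr1 lsubmx); rewrite row_mxKl /to_real map_lsubmx.
rewrite mul1mx hl -homog_to_real.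
move: hl; have [_ h1] := hx; rewrite mul_homog h1 => hl.
rewrite -hl /homog /to_real map_lsubmx -/(to_real R l) -hl row_mxKl.
by congr row_mx; apply/matrixP => i j; rewrite !mxE.
Qed.

Lemma generated_int (x : 'rV[R]_5) : (forall i, x 0 i \is a Num.int) -> generated x.
Proof.
move=> /int_row[l ->]; have -> : to_real R l = \sum_i (delta_mx 0 i) *~ l 0 i.
  apply/rowP => j; rewrite mxE summxE (bigD1 j) //= big1 ?addr0.
    by rewrite -scaler_int !mxE !eqxx mulr1.
  by move=> i ij; rewrite -scaler_int !mxE eq_sym (negbTE ij) mulr0.
apply: generated_sum => i; apply: generatedMz; apply: generated_unit.
  by apply: lattice_int => j; rewrite mxE natr_int.
exact: barycentric_delta.
Qed.

Lemma spanning_generated : spanning P <-> forall x, G x -> generated x.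
Proof.
split=> [h x [l hl]|h y].
  by have [n [A [c [hA e]]]] := h l; exists n, A, c; rewrite hl e.
have hy : to_real R y *m vertex_inv R V *m homog (to_real R V) = to_real R y.
  by rewrite -mulmxA vertex_invM // mulmx1.
have [|n [A [c [hA e]]]] := h (to_real R y *m vertex_inv R V); first by exists y.
by exists n, A, c; split=> //; apply: (@to_real_inj R); rewrite -e hy.
Qed.

(** Pairing with q is additive. Being integral on the lattice points of the simplex, it is integral
    on everything they generate, which excludes x0. *)
Lemma not_spanning (q : 'cV[R]_5) x0 : G x0 -> (x0 *m q) 0 0 \isn't a Num.int ->
  (forall x, G x -> barycentric R 5 x -> (x *m q) 0 0 \is a Num.int) -> ~ spanning P.
Proof.
move=> hx0 /negP hn hq /spanning_generated /(_ _ hx0) [n [A [c [hA e]]]]; apply: hn.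
have /choice[f hf] : forall i, exists x, barycentric R 5 x /\ x *m to_real R V = to_real R (row i A).
  by move=> i; have := hA i; rewrite /lattice_points /= polytopeE => -[x hx hxA]; exists x.
have hfM i : f i *m homog (to_real R V) = to_real R (row i (homog A)).
  have [[_ h1] h2] := hf i; rewrite mul_homog h1 h2.
  have -> : row i (homog A) = row_mx (row i A) (const_mx 1).
    by apply/rowP => j; rewrite !mxE; case: fintype.split => k; rewrite !mxE.
  by rewrite /to_real map_row_mx map_const_mx.
have -> : x0 = to_real R c *m \matrix_i f i.
  apply: (homog_inj hV); rewrite e to_realM -mulmxA; congr (_ *m _).
  apply/row_matrixP => i; rewrite row_mul rowK hfM.
  by apply/rowP => j; rewrite !mxE.
rewrite -mulmxA mxE rpred_sum // => i _; rewrite rpredM ?to_real_int //.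
have [hb _] := hf i.
have -> : (\matrix_i f i *m q) i 0 = (f i *m q) 0 0.
  by rewrite -(rowK f i) -row_mul [RHS]mxE.
by apply: hq hb; exists (row i (homog A)).
Qed.

End Spanning.

Lemma unit_interval_sub (R : realType) (a b : R) :
  0 <= a < 1 -> 0 <= b < 1 -> - 1 < a - b < 1.
Proof. by move=> /andP[? ?] /andP[? ?]; apply/andP; split; lra. Qed.

(** * Reading the invariants off a list of words *)

Section Certificates.
Variables (R : realType) (V : 'M[int]_(5, 4)) (N : nat) (g W : seq (seq nat)).
Hypothesis hV : lattice_simplex R V.
Hypothesis N0 : (0 < N)%N.
Hypothesis hG : simplex_lattice R V = code_lattice R N g.
Hypothesis hW : word_list R V N W.
Local Notation G := (simplex_lattice R V).
Local Notation P := (polytope R V).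
Let wf (g : seq (seq nat)) := all (fun r => (size r == 5%N) && all (fun a => a < N)%N r) g.

Definition dotn (w q : seq nat) := sumn [seq nth 0 w i * nth 0 q i | i <- iota 0 5]%N.

Lemma dotnE w q : dotn w q = (\sum_(i < 5) nth 0 w i * nth 0 q i)%N.
Proof. by rewrite /dotn sumnE big_map -[iota 0 5]/(index_iota 0 5) big_mkord. Qed.

Definition int_col (q : seq nat) : 'cV[R]_5 := \col_i (nth 0%N q i)%:R.

Lemma residue_vec_dot w q : (residue_vec R N w *m int_col q) 0 0 = (dotn w q)%:R / N%:R.
Proof.
rewrite mxE dotnE natr_sum mulr_suml; apply: eq_bigr => i _.
by rewrite !mxE natrM mulrAC.
Qed.

Lemma int_mul_col (x : 'rV[R]_5) q :
  (forall i, x 0 i \is a Num.int) -> (x *m int_col q) 0 0 \is a Num.int.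
Proof. by move=> h; rewrite mxE rpred_sum // => i _; rewrite rpredM // mxE natr_int. Qed.

Lemma digits_dot x w q : digits_of N x w ->
  ((x *m int_col q) 0 0 \is a Num.int) = (N %| dotn w q)%N.
Proof.
move=> [_ _ c]; rewrite -(ratio_int R) // -residue_vec_dot.
rewrite -[x in LHS](subrK (residue_vec R N w)) mulmxDl mxE rpredDl //.
by apply: int_mul_col => i; have := c i; rewrite !mxE.
Qed.

Lemma dual_words q : all (fun w => N %| dotn w q)%N W -> dual_form R V (fun i => (nth 0%N q i)%:Z).
Proof.
have [_ _ hc] := hW; move=> /allP h x /hc[w wW /digits_dot e].
have := e q; rewrite h // mxE => hx.
by move: hx; congr (is_true (_ \is a _)); apply: eq_bigr => i _; rewrite mxE.
Qed.

Lemma thin_words : all (fun w => 0%N \in w) W -> thin R V.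
Proof.
have [_ _ hc] := hW; move=> /allP h; apply/thin_lattice => x /hc[w wW hw].
have [sw _ _] := hw; have /(nthP 0%N)[i] := h _ wW; rewrite sw => i5 wi.
by exists (Ordinal i5); rewrite (digits_int _ N0 hw) wi.
Qed.

(** The words of height 1 are lattice points of the simplex. Once they produce the code generators,
    they generate the lattice together with the vertices. *)
Lemma spanning_words : wf g ->
  all (fun r => r \in codewords N [seq w <- W | height N w == 1%N]) g -> spanning P.
Proof.
have [_ hW1 _] := hW; move=> _ /allP hg; apply/(spanning_generated hV) => x.
set h := [seq w <- W | _] in hg.
have wfh : wf h.
  apply/allP => w; rewrite mem_filter => /andP[_ /hW1[sw lw _]].
  by rewrite sw eqxx.
have hgen l y : all (fun w => w \in h) l -> code_lattice R N l y -> generated V y.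
  elim: l y => [|w l IH] y /=.
    move=> _ [k hk]; apply: generated_int => i.
    by have := hk i; rewrite big_ord0 subr0.
  move=> /andP[wh hl] /code_lattice_cons[k /(IH _ hl) hy].
  rewrite -[y](subrK (residue_vec R N w *+ k)); apply: generatedD => //.
  apply: generatedMn; move: wh; rewrite mem_filter => /andP[/eqP h1 wW].
  apply: generated_unit; first by have [_ _] := hW1 _ wW.
  split=> [i|]; first by rewrite mxE divr_ge0.
  by rewrite (residue_vec_sum N0 hW wW) h1.
rewrite hG => hx; apply: (@hgen h); first by apply/allP.
suff hsub l y : {subset l <= g} -> code_lattice R N l y -> code_lattice R N h y.
  exact: hsub hx.
elim: l y => [|w l IH] y hl.
  move=> [k hk]; apply: (@code_lattice_congr _ _ _ 0); last exact: code_lattice0.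
  by move=> i; have := hk i; rewrite big_ord0 mxE subr0 sub0r rpredN.
move=> /code_lattice_cons[k hk].
rewrite -[y](subrK (residue_vec R N w *+ k)); apply: code_latticeD.
  by apply: IH hk => r rl; apply: hl; rewrite inE rl orbT.
have [_ _ hw] := codewords_sound R N0 wfh (hg _ (hl _ (mem_head _ _))).
elim: k {hk} => [|k IHk]; first by rewrite mulr0n; exact: code_lattice0.
by rewrite mulrS; exact: code_latticeD.
Qed.

(** A lattice point of the simplex is either a vertex, which pairs integrally with the integral
    vector q, or has all barycentric coordinates below 1 and then is itself a word of height 1. *)
Lemma not_spanning_words q r : r \in W -> ~~ (N %| dotn r q)%N ->
  all (fun w => (height N w == 1%N) ==> (N %| dotn w q)%N) W -> ~ spanning P.
Proof.
have [_ hW1 hc] := hW; move=> rW hr /allP h1.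
have [sr lr hrG] := hW1 _ rW.
apply: (@not_spanning R V hV (int_col q) (residue_vec R N r)) => //.
  by rewrite residue_vec_dot ratio_int.
move=> x hx [x0 x1]; have [w wW hw] := hc _ hx; have [sw lw cw] := hw.
have [[i hi]|hn] := pselect (exists i, 1 <= x 0 i).
  apply: int_mul_col => j; have [->|ji] := eqVneq j i.
    suff -> : x 0 i = 1 by rewrite rpred1.
    apply/eqP; rewrite eq_le hi andbT -x1 (bigD1 i) //= lerDl.
    exact: sumr_ge0.
  suff -> : x 0 j = 0 by rewrite rpred0.
  apply/eqP; rewrite eq_le x0 andbT; move: x1; rewrite (bigD1 i) //= (bigD1 j) //=.
  have : 0 <= \sum_(k < 5 | (k != i) && (k != j)) x 0 k by exact: sumr_ge0.
  by set s := \sum_(k < 5 | _) _; move: hi; lra.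
have hlt i : x 0 i < 1 by rewrite ltNge; apply/negP => h; apply: hn; exists i.
have xE : x = residue_vec R N w.
  apply/rowP => i; apply/eqP; rewrite -subr_eq0; have /intrP[z hz] := cw i.
  rewrite hz intr_eq0.
  have : - 1 < (z%:~R : R) < 1.
    rewrite -hz; have h0 : 0 <= residue_vec R N w 0 i by rewrite mxE divr_ge0.
    have h1' : residue_vec R N w 0 i < 1.
      rewrite mxE ltr_pdivrMr ?ltr0n // mul1r ltr_nat.
      by move/allP: lw; apply; rewrite mem_nth ?sw.
    by apply: unit_interval_sub; rewrite ?x0 ?h0 ?hlt ?h1'.
  by rewrite -[1]/(1%:~R) -intrN !ltr_int; lia.
rewrite (digits_dot q hw); have := h1 _ wW; move/implyP; apply.
by rewrite -(eqr_nat R) -(residue_vec_sum N0 hW wW) -xE x1.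
Qed.

Lemma width1_words q : all (fun w => N %| dotn w q)%N W -> size q = 5%N ->
  all (fun a => a <= 1)%N q -> 0%N \in q -> 1%N \in q -> lattice_width P = 1.
Proof.
move=> /dual_words hd sq /allP h1 /(nthP 0%N)[i +] e0 /(nthP 0%N)[j +] e1.
rewrite sq => i5 j5; apply: (lattice_width1 (i0 := Ordinal i5) (j0 := Ordinal j5) hV hd).
  by move=> k; have : nth 0%N q k \in q; [rewrite mem_nth ?sq|move/h1; lia].
by rewrite /= e0 e1.
Qed.

End Certificates.

Definition bit_lists n :=
  iter n (fun L => [seq b :: l | b <- [:: 0; 1], l <- L])%N [:: [::]].

Lemma mem_bit_lists l : all (fun a => a <= 1)%N l -> l \in bit_lists (size l).
Proof.
elim: l => [//|a l IH] /andP[ha hl].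
change (a :: l \in [seq b :: l | b <- [:: 0; 1]%N, l <- bit_lists (size l)]).
apply/allpairsPdep; exists a, l; split=> //; last exact: IH.
by move: ha; rewrite !inE; case: a => [|[]].
Qed.

(* [q] is a linear form of lattice width [w]; [s] is [None] for a spanning simplex,
   and otherwise a form that is integral on the lattice points of the simplex but
   not on the whole lattice. *)
Definition certificate N g (c : nat * nat * nat * nat) (w : nat) q (s : option (seq nat)) :=
  let W := codewords N g in
  [&& (1 < N)%N, all (fun r => (size r == 5%N) && all (fun a => a < N)%N r) g,
      has (fun r => 1%N \in r) g, nseq 5 0%N \in W, all (fun v => 0%N \in v) W,
      perm_eq [seq height N v | v <- W]
        (nseq c.1.1.1 0%N ++ nseq c.1.1.2 1%N ++ nseq c.1.2 2%N ++ nseq c.2 3%N),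
      all (fun v => N %| dotn v q)%N W, size q == 5%N, 0%N \in q, w \in q,
      all (fun a => a <= w)%N q,
      (w == 1%N) || (w == 2%N) && all (fun z => constant z ||
        has (fun v => ~~ (N %| dotn v z)%N) W) (bit_lists 5) &
      if s is Some p then
        has (fun v => ~~ (N %| dotn v p)%N) W &&
        all (fun v => (height N v == 1%N) ==> (N %| dotn v p)%N) W
      else all (fun r => r \in codewords N [seq v <- W | height N v == 1%N]) g].

Definition cubic (c : nat * nat * nat * nat) : {poly int} :=
  1 *+ c.1.1.1 + 'X *+ c.1.1.2 + 'X^2 *+ c.1.2 + 'X^3 *+ c.2.

Lemma sum_exponents (s : seq nat) a b c d :
  perm_eq s (nseq a 0%N ++ nseq b 1%N ++ nseq c 2%N ++ nseq d 3%N) ->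
  \sum_(k <- s) 'X^k = cubic (a, b, c, d).
Proof.
move=> h; rewrite (perm_big _ h) !big_cat /= !big_nseq !iter_addr_0.
by rewrite expr0 expr1 !addrA.
Qed.

Lemma certificate_data (R : realType) (V : 'M[int]_(5, 4)) N g c w q s :
  certificate N g c w q s -> lattice_simplex R V ->
  simplex_lattice R V = code_lattice R N g ->
  thin R V /\ has_data R V (SimplexData N g (cubic c) w (~~ isSome s)).
Proof.
move=> /and5P[N1 wf /hasP[r rg r1] W0 /and5P[Wt Wh Wq /eqP sq /and5P[q0 qw qle hw hs]]] hV hG.
have N0 := ltnW N1; have hW := codewords_list N0 wf hG.
split; first exact: thin_words N0 hW Wt.
have sr : size r = 5%N by have /andP[/eqP ? _] := allP wf _ rg.
have [i i5 ri] : exists2 i, (i < 5)%N & nth 0%N r i = 1%N.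
  by move: r1 => /(nthP 0%N)[i]; rewrite sr => i5 ri; exists i.
have eN := code_modulusE N1 hG rg i5 ri.
split=> //=.
- exact: (simplex_code_generated N1 hG eN).
- have -> : cubic c = \sum_(v <- codewords N g) 'X^(height N v).
    rewrite -(big_map (height N) xpredT (fun k => 'X^k)) (sum_exponents Wh).
    by case: (c) => [[[]]].
  exact: (hstar_words hV N0 hW W0).
- have [/eqP w1|/andP[/eqP w2 /allP hz]] := orP hw.
    by rewrite w1 in qw qle *; rewrite (width1_words hV N0 hW Wq sq qle q0 qw).
  rewrite w2 in qw qle *.
  move: q0 qw => /(nthP 0%N)[j j5 qj] /(nthP 0%N)[k k5 qk].
  rewrite sq in j5 k5.
  apply: (lattice_width2 (i0 := Ordinal j5) (j0 := Ordinal k5) hV (dual_words N0 hW Wq)).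
  + move=> l; have := allP qle (nth 0%N q l); by rewrite mem_nth ?sq // => /(_ isT); rewrite lez_nat.
  + by rewrite /= qj qk.
  move=> z z01 hzd.
  pose zl := [tuple absz (z l) | l < 5].
  have znth (l : 'I_5) : (nth 0%N zl l)%:Z = z l.
    by rewrite -tnth_nth tnth_mktuple gez0_abs //; have /andP[] := z01 l.
  have zmem : (zl : seq nat) \in bit_lists 5.
    have : all (fun a => a <= 1)%N zl; last by move=> /mem_bit_lists; rewrite size_tuple.
    apply/all_tnthP => l; rewrite tnth_mktuple -lez_nat gez0_abs; have /andP[//] := z01 l.
  have := hz _ zmem; case/orP => [cz l m|/hasP[v vW]].
    have /(constantP 0%N)[x hx] := cz.
    by rewrite -!znth hx !nth_nseq size_tuple !ltn_ord.
  have [_ hW1 _] := hW; have [sv lv hv] := hW1 _ vW.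
  case/negP; rewrite -(ratio_int R) // -residue_vec_dot.
  suff -> : (residue_vec R N v *m int_col R zl) 0 0 =
      \sum_l residue_vec R N v 0 l * (z l)%:~R by exact: hzd.
  by rewrite mxE; apply: eq_bigr => l _; rewrite -znth [int_col _ _ _ _]mxE.
- case: s hs => [p|] /=.
    move=> /andP[/hasP[v vW hv] hp]; split=> // hsp.
    by case: (not_spanning_words hV N0 hW vW hv hp).
  by move=> hs; split=> // _; exact: (spanning_words hV N0 hG hW wf hs).
Qed.

Lemma sporadic_data (R : realType) (V : 'M[int]_(5, 4)) (i : 'I_6) :
  lattice_simplex R V ->
  simplex_lattice R V =
    code_lattice R (data_modulus (tnth sporadic i)) (data_gens (tnth sporadic i)) ->
  thin R V /\ has_data R V (tnth sporadic i).
Proof.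
move=> hV; have key N g c w q s h : certificate N g c w q s -> cubic c = h ->
    simplex_lattice R V = code_lattice R N g ->
    thin R V /\ has_data R V (SimplexData N g h w (~~ isSome s)).
  by move=> hc <-; exact: (certificate_data hc hV).
have e5 n (p : {poly int}) : n%:R *: p = p *+ n by rewrite scaler_nat.
case: i => -[|[|[|[|[|[|//]]]]]] hi; rewrite (tnth_nth (tnth sporadic (Ordinal hi))) /=.
(* In each case the quadruple counts the words of height 0, 1, 2 and 3, which are the coefficients
   of the h*-polynomial in ascending order. *)
- apply: (@key _ _ (1, 10, 5, 0)%N 2%N [:: 0; 0; 0; 0; 2]%N None); first by vm_compute.
  by rewrite /cubic !e5 /=; ring.
- apply: (@key _ _ (1, 1, 7, 0)%N 1%N [:: 0; 0; 1; 1; 1]%N (Some [:: 0; 0; 0; 1; 2]%N)).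
    by vm_compute.
  by rewrite /cubic !e5 /=; ring.
- apply: (@key _ _ (1, 2, 5, 0)%N 1%N [:: 0; 0; 1; 1; 1]%N (Some [:: 0; 0; 0; 2; 1]%N)).
    by vm_compute.
  by rewrite /cubic !e5 /=; ring.
- apply: (@key _ _ (1, 3, 11, 1)%N 2%N [:: 0; 0; 1; 2; 1]%N (Some [:: 0; 0; 0; 2; 2]%N)).
    by vm_compute.
  by rewrite /cubic !e5 /=; ring.
- apply: (@key _ _ (1, 6, 9, 0)%N 2%N [:: 0; 0; 0; 0; 2]%N None); first by vm_compute.
  by rewrite /cubic !e5 /=; ring.
- apply: (@key _ _ (1, 3, 11, 1)%N 2%N [:: 0; 0; 2; 2; 2]%N (Some [:: 0; 0; 0; 1; 6]%N)).
    by vm_compute.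
  by rewrite /cubic !e5 /=; ring.
Qed.

(** * Words and invariants of the one-parameter family *)

Section FamilyWords.
Local Open Scope nat_scope.
Variable h : nat.
Hypothesis h0 : 0 < h.
Local Notation N := (2 * h).

Definition family_gens := [:: [:: h; 0; h; 0; 0]; [:: 0; h; h; 1; N - 1]].

(** The bit b and the number j are the multipliers of the two generators. As h has order 2 modulo 2
    h, the first three entries depend only on parities; the last entry is - j modulo N. *)
Definition family_word (b : bool) j :=
  [:: h * b; h * odd j; h * (b (+) odd j); j; (N - j) %% N].

Definition family_words :=
  [seq family_word b j | b <- [:: false; true], j <- iota 0 N].

Lemma double_gt0 : 0 < N. Proof. by rewrite muln_gt0. Qed.

Lemma half_mod k : h * odd k = k * h %[mod N].
Proof.
have -> : k * h = k./2 * N + h * odd k.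
  by rewrite -{1}(odd_double_half k) -muln2; lia.
by rewrite modnMDl.
Qed.

Lemma odd_mod l : odd (l %% N) = odd l.
Proof. by rewrite {2}(divn_eq l N) oddD !oddM /= andbF. Qed.

Lemma family_word_congr k l i : i < 5 ->
  nth 0 (family_word (odd k) (l %% N)) i =
  k * nth 0 (nth [::] family_gens 0) i + l * nth 0 (nth [::] family_gens 1) i %[mod N].
Proof.
case: i => [|[|[|[|[|//]]]]] _ /=; rewrite ?muln0 ?addn0 ?add0n ?odd_mod.
- exact: half_mod.
- exact: half_mod.
- by rewrite -mulnDl -half_mod oddD.
- by rewrite muln1 modn_mod.
rewrite modn_mod; apply/eqP; rewrite -(eqn_modDl (l %% N)).
rewrite subnKC; last by rewrite ltnW // ltn_pmod // double_gt0.
by rewrite modnn modnDml -mulnS subn1 prednK ?double_gt0 // modnMl.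
Qed.

(** Exactly two of the first three entries equal h unless b is false and j is even, when all three
    vanish; the last two add up to N unless j = 0. *)
Lemma family_word_sumn b j : j < N ->
  sumn (family_word b j) = ((b || odd j) + (0 < j)) * N.
Proof.
move=> jN; rewrite /=.
have -> : j + ((N - j) %% N + 0) = (0 < j) * N.
  case: j jN => [|j] jN; first by rewrite subn0 modnn.
  by rewrite modn_small; move: h0 jN; lia.
by case: b; case: (odd j) => /=; lia.
Qed.

Lemma family_word_height b j : j < N -> height N (family_word b j) = (b || odd j) + (0 < j).
Proof. by move=> jN; rewrite /height family_word_sumn // mulnK // double_gt0. Qed.

Lemma family_words_uniq : uniq family_words.
Proof.
apply: allpairs_uniq => //; first exact: iota_uniq.
move=> [b j] [c k] _ _ [/eqP e _ _ -> _]; congr (_, _).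
by move: e; rewrite eqn_pmul2l //; case: b c => -[].
Qed.

Lemma mem_family_words w :
  reflect (exists b j, j < N /\ w = family_word b j) (w \in family_words).
Proof.
apply: (iffP allpairsP) => [[[b j] [_ hj ->]]|[b [j [hj ->]]]].
  by exists b, j; move: hj; rewrite mem_iota.
by exists (b, j); rewrite mem_iota; split=> //; case: b.
Qed.

Lemma sum_odd_exponents :
  (\sum_(1 <= j < N) 'X^((odd j).+1) = 'X *+ h.-1 + 'X^2 *+ h :> {poly int})%R.
Proof.
elim: h h0 => // n IH _; case: n IH => [|n] IH.
  by rewrite big_nat1 /= mulr0n add0r.
have -> : 2 * n.+2 = (2 * n.+1).+2 by lia.
rewrite big_nat_recr // big_nat_recr ?muln_gt0 // IH //.
have o1 : odd (2 * n.+1) = false by rewrite oddM.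
by rewrite oddS o1 /= !mulrSr expr1; ring.
Qed.

Lemma family_hstar_sum :
  (\sum_(w <- family_words) 'X^(height N w) =
   (((3 * N) %/ 2 - 1)%N%:R *: 'X^2 + (N %/ 2)%N%:R *: 'X + 1) :> {poly int})%R.
Proof.
rewrite /family_words /= cats0 big_cat !big_map /=.
have e (b : bool) : (\sum_(j <- iota 0 N) 'X^(height N (family_word b j)) =
    'X^b + \sum_(1 <= j < N) 'X^((b || odd j).+1) :> {poly int})%R.
  have -> : iota 0 N = index_iota 0 N by rewrite /index_iota subn0.
  rewrite big_nat_cond.
  rewrite (eq_bigr (fun j => 'X^((b || odd j) + (0 < j)))%R); last first.
    by move=> j /andP[/andP[_ jN] _]; rewrite family_word_height.
  rewrite -big_nat_cond big_ltn ?double_gt0 // orbF addn0; congr (_ + _)%R.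
  by apply: eq_big_nat => j /andP[j0 _]; rewrite j0 addn1.
rewrite !e /= sum_odd_exponents expr0 expr1.
have -> : (\sum_(1 <= j < N) 'X^2 = 'X^2 *+ N.-1 :> {poly int})%R.
  by rewrite big_const_nat iter_addr_0 subn1.
have -> : (3 * N) %/ 2 - 1 = N.-1 + h by rewrite mulnCA mulKn //; lia.
rewrite mulKn // !scaler_nat mulrnDr.
have -> : ('X *+ h = 'X *+ h.-1 + 'X :> {poly int})%R by rewrite -mulrSr prednK.
ring.
Qed.

End FamilyWords.

Section FamilyData.
Variables (R : realType) (V : 'M[int]_(5, 4)) (h : nat).
Hypothesis h0 : (0 < h)%N.
Hypothesis hV : lattice_simplex R V.
Local Notation N := (2 * h)%N.
Hypothesis hG : simplex_lattice R V = code_lattice R N (family_gens h).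
Let N0 : (0 < N)%N := double_gt0 h0.
Let N1 : (1 < N)%N. Proof. by move: h0; lia. Qed.

Lemma family_word_digits (x : 'rV[R]_5) (k : nat -> nat) :
  (forall j, x 0 j - \sum_(i < 2) residue_vec R N (nth [::] (family_gens h) i) 0 j *+ k i
     \is a Num.int) ->
  digits_of N x (family_word h (odd (k 0)) (k 1 %% N))%N.
Proof.
move=> hk; split=> //.
  by rewrite /= !ltn_pmod // !andbT; case: (odd (k 0%N)); case: odd; rewrite /= ?muln0 ?muln1;
    move: h0; lia.
move=> j; rewrite [residue_vec _ _ _ _ _]mxE.
have e := family_word_congr h0 (k 0%N) (k 1%N) (ltn_ord j).
set a := nth _ (family_word _ _ _) j in e *.
set c := (_ + _)%N in e.
have hS : \sum_(i < 2) residue_vec R N (nth [::] (family_gens h) i) 0 j *+ k i = c%:R / N%:R.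
  rewrite !big_ord_recl big_ord0 addr0 /c natrD mulrDl; congr (_ + _).
    by rewrite mxE (natrM _ (k 0%N)) -mulrA [RHS]mulr_natl.
  by rewrite mxE (natrM _ (k 1%N)) -mulrA [RHS]mulr_natl.
have := hk j; rewrite hS => hx.
rewrite -(subrKA (c%:R / N%:R)) rpredD //.
rewrite -(subrKA ((c %% N)%N%:R / N%:R)) rpredD ?residue_mod //.
by rewrite -e -opprB rpredN residue_mod.
Qed.

Lemma family_word_list : word_list R V N (family_words h).
Proof.
split; first exact: family_words_uniq.
  move=> _ /mem_family_words[b [j [jN ->]]].
  pose k i := if i is 0%N then nat_of_bool b else j.
  pose x := \sum_(i < 2) residue_vec R N (nth [::] (family_gens h) i) *+ k i.
  have hk l : x 0 l - \sum_(i < 2) residue_vec R N (nth [::] (family_gens h) i) 0 l *+ k i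
      \is a Num.int.
    by rewrite summxE; under eq_bigr do rewrite mulmxnE; rewrite subrr rpred0.
  have := family_word_digits hk; rewrite /= oddb modn_small // => -[s l c].
  split=> //; apply: lattice_congr c _; rewrite hG.
  by exists k.
move=> x; rewrite hG => -[k hk].
exists (family_word h (odd (k 0)) (k 1 %% N))%N; last exact: family_word_digits.
by apply/mem_family_words; exists (odd (k 0%N)), (k 1 %% N)%N; rewrite ltn_pmod.
Qed.

Lemma family_data : thin R V /\ has_data R V (thin_family N).
Proof.
have hW := family_word_list.
have N2 : (N %/ 2 = h)%N by rewrite mulKn.
have hgens : data_gens (thin_family N) = family_gens h by rewrite /= N2.
have eN : code_modulus R V = N.
  by apply: (code_modulusE N1 hG (r := [:: 0; h; h; 1; N - 1]%N) (i := 3%N));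
    rewrite // !inE eqxx orbT.
split.
  apply: (thin_words N0 hW); apply/allP => _ /mem_family_words[b [j [_ ->]]].
  by rewrite /family_word; case: b; case: (odd j); rewrite /= ?muln0 !inE ?eqxx ?orbT.
split=> //.
- by rewrite hgens; exact: (simplex_code_generated N1 hG eN).
- rewrite /= -(family_hstar_sum h0).
  apply: (hstar_words hV N0 hW); apply/mem_family_words; exists false, 0%N.
  by rewrite N0 /family_word /= subn0 modnn !muln0.
- apply: (width1_words hV N0 hW (q := [:: 0; 0; 0; 1; 1]%N)) => //.
  apply/allP => _ /mem_family_words[b [j [jN ->]]].
  rewrite /dotn /= !muln0 !muln1 !add0n addn0.
  case: j jN => [|j] jN; first by rewrite subn0 modnn.
  by rewrite modn_small; move: h0 jN => *; [rewrite subnKC ?dvdnn // ltnW|lia].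
- split=> // hsp; exfalso; move: hsp.
  (* A word of height 1 has j = 0, or has b false and j even; in both cases N divides h j. The word
     with j = 1 violates this divisibility. *)
  apply: (not_spanning_words hV N0 hW (q := [:: 0; 0; 0; h; 0]%N) (r := family_word h false 1%N)).
  + by apply/mem_family_words; exists false, 1%N.
  + by rewrite /dotn /= !muln0 !add0n !addn0 mul1n gtnNdvd //; move: h0; lia.
  apply/allP => _ /mem_family_words[b [j [jN ->]]].
  rewrite family_word_height // /dotn /= !muln0 !add0n !addn0; apply/implyP.
  case: j jN => [|j] jN; first by rewrite mul0n dvdn0.
  case: b => //=; case jo : (odd j) => //= _.
  rewrite -(odd_double_half j.+1) /= jo /= add0n -muln2 -mulnA.
  exact: dvdn_mull.
Qed.

End FamilyData.

(** * Free joins of simplices *)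

Lemma mul_homog_eq0 (R : realType) n d (x : 'rV[R]_n) (A : 'M[R]_(n, d)) :
  x *m homog A = 0 -> x *m A = 0 /\ \sum_i x 0 i = 0.
Proof.
rewrite mul_homog => h; split; first by have := congr1 lsubmx h; rewrite row_mxKl linear0.
by have := congr1 (fun M : 'rV_(d + 1) => M 0 (rshift d 0)) h; rewrite row_mxEr !mxE.
Qed.

Lemma sum_row_mx (R : realType) m n (x : 'rV[R]_m) (y : 'rV[R]_n) :
  \sum_i row_mx x y 0 i = \sum_i x 0 i + \sum_i y 0 i.
Proof.
by rewrite big_split_ord /=; congr (_ + _); apply: eq_bigr => i _;
  rewrite (row_mxEl, row_mxEr).
Qed.

Section Join.
Variables (R : realType) (d1 d2 : nat).
Variables (W1 : 'M[int]_(d1.+1, d1)) (W2 : 'M[int]_(d2.+1, d2)).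

Definition join_matrix : 'M[int]_(d1.+1 + d2.+1, d1 + d2 + 1) :=
  col_mx (row_mx (row_mx W1 0) 0) (row_mx (row_mx 0 W2) (const_mx 1)).

Lemma join_matrix_ul i j : join_matrix (lshift d2.+1 i) (lshift 1 (lshift d2 j)) = W1 i j.
Proof. by rewrite col_mxEu !row_mxEl. Qed.

Lemma join_matrix_ur i j : join_matrix (lshift d2.+1 i) (rshift (d1 + d2) j) = 0.
Proof. by rewrite col_mxEu row_mxEr mxE. Qed.

Lemma join_matrix_dl i j : join_matrix (rshift d1.+1 i) (lshift 1 (lshift d2 j)) = 0.
Proof. by rewrite col_mxEd !row_mxEl mxE. Qed.

Lemma join_matrix_dr i j : join_matrix (rshift d1.+1 i) (rshift (d1 + d2) j) = 1.
Proof. by rewrite col_mxEd row_mxEr mxE. Qed.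

Lemma mul_join_matrix (x : 'rV[R]_d1.+1) (y : 'rV[R]_d2.+1) :
  row_mx x y *m to_real R join_matrix =
  row_mx (row_mx (x *m to_real R W1) (y *m to_real R W2)) (const_mx (\sum_i y 0 i)).
Proof.
rewrite /to_real map_col_mx !map_row_mx !map_mx0 map_const_mx mul_row_col !mul_mx_row !mulmx0.
rewrite add_row_mx add0r add_row_mx addr0 add0r; congr row_mx.
apply/rowP => j; rewrite !mxE; apply: eq_bigr => i _.
by rewrite !mxE mulr1.
Qed.

Lemma free_join_matrix :
  polytope R join_matrix = free_join (polytope R W1) (polytope R W2).
Proof.
have e1 (a : 'rV[R]_d1.+1) : row_mx (row_mx (a *m to_real R W1) (0 : 'rV_d2)) (0 : 'rV_1) =
    row_mx a 0 *m to_real R join_matrix.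
  rewrite mul_join_matrix mul0mx; congr row_mx; apply/rowP => j; rewrite !mxE.
  by rewrite big1 // => i _; rewrite mxE.
have e2 (a : 'rV[R]_d2.+1) : barycentric R _ a ->
    row_mx (row_mx (0 : 'rV_d1) (a *m to_real R W2)) (const_mx 1 : 'rV_1) =
    row_mx 0 a *m to_real R join_matrix.
  by move=> [_ h1]; rewrite mul_join_matrix mul0mx h1.
have b1 (a : 'rV[R]_d1.+1) : barycentric R _ a ->
    barycentric R (d1.+1 + d2.+1) (row_mx a 0).
  move=> [a0 h1]; split=> [i|]; first by rewrite mxE; case: fintype.split => k; rewrite ?mxE.
  rewrite big_split_ord /= [X in _ + X]big1 ?addr0 => [|i _]; last by rewrite row_mxEr mxE.
  by rewrite -h1; apply: eq_bigr => i _; rewrite row_mxEl.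
have b2 (a : 'rV[R]_d2.+1) : barycentric R _ a ->
    barycentric R (d1.+1 + d2.+1) (row_mx 0 a).
  move=> [a0 h1]; split=> [i|]; first by rewrite mxE; case: fintype.split => k; rewrite ?mxE.
  rewrite big_split_ord /= [X in X + _]big1 ?add0r => [|i _]; last by rewrite row_mxEl mxE.
  by rewrite -h1; apply: eq_bigr => i _; rewrite row_mxEr.
rewrite [LHS]polytopeE /free_join; apply/esym/conv_hull_rows => [i|x].
  rewrite -(splitK i); case: (fintype.split i) => j /=; rewrite rowE.
    have -> : delta_mx 0 (lshift d2.+1 j) = row_mx (delta_mx 0 j) 0 :> 'rV[R]_(_ + _).
      by rewrite delta_mx_lshift.
    left; exists (delta_mx 0 j *m to_real R W1); last exact: e1.
    by rewrite polytopeE; exists (delta_mx 0 j) => //; exact: barycentric_delta.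
  have -> : delta_mx 0 (rshift d1.+1 j) = row_mx 0 (delta_mx 0 j) :> 'rV[R]_(_ + _).
    by rewrite delta_mx_rshift.
  right; exists (delta_mx 0 j *m to_real R W2); last by apply: e2; exact: barycentric_delta.
  by rewrite polytopeE; exists (delta_mx 0 j) => //; exact: barycentric_delta.
case=> -[z]; rewrite polytopeE => -[a ha <-] <-.
  by exists (row_mx a 0); [exact: b1|exact: e1].
by exists (row_mx 0 a); [exact: b2|exact: e2].
Qed.

(** An affine relation between the vertices of one factor extends by zeros to the join. *)
Lemma join_simplices : row_free (homog (to_real R join_matrix)) ->
  lattice_polytope (polytope R W1) /\ lattice_polytope (polytope R W2).
Proof.
move=> hf.
have key (x : 'rV[R]_d1.+1) (y : 'rV[R]_d2.+1) :
    x *m homog (to_real R W1) = 0 -> y *m homog (to_real R W2) = 0 -> row_mx x y = 0.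
  move=> /mul_homog_eq0[x1 sx] /mul_homog_eq0[y1 sy].
  apply: (row_free_inj hf); rewrite mul0mx mul_homog mul_join_matrix x1 y1 sy.
  rewrite sum_row_mx sx add0r.
  have c0 m n : const_mx 0 = 0 :> 'M[R]_(m, n) by apply/matrixP => i j; rewrite !mxE.
  by rewrite sy !c0 !row_mx0.
have full n (W : 'M[int]_(n.+1, n)) : row_free (homog (to_real R W)) ->
    lattice_polytope (polytope R W).
  by move=> h; exists n.+1, W; split=> //; rewrite /row_full (eqP h) addn1.
split; apply: full; apply/inj_row_free => x hx.
  have := key x 0 hx (mul0mx _ _); rewrite -[X in _ = X -> _]row_mx0.
  by case/eq_row_mx.
have := key 0 x (mul0mx _ _) hx; rewrite -[X in _ = X -> _]row_mx0.
by case/eq_row_mx.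
Qed.

Lemma join_row_free : lattice_simplex R W1 -> lattice_simplex R W2 ->
  row_free (homog (to_real R join_matrix)).
Proof.
move=> h1 h2; apply/inj_row_free => z; rewrite -(hsubmxK z).
move: (lsubmx z) (rsubmx z) => x y /mul_homog_eq0[].
rewrite mul_join_matrix sum_row_mx => e sxy; have sy : \sum_i y 0 i = 0.
  have := congr1 (fun M : 'rV_(d1 + d2 + 1) => M 0 (rshift (d1 + d2) 0)) e.
  by rewrite row_mxEr !mxE.
have sx : \sum_i x 0 i = 0 by move: sxy; rewrite sy addr0.
have := congr1 lsubmx e; rewrite row_mxKl linear0 => exy.
have x1 : x *m to_real R W1 = 0 by have := congr1 lsubmx exy; rewrite row_mxKl linear0.
have y1 : y *m to_real R W2 = 0 by have := congr1 rsubmx exy; rewrite row_mxKr linear0.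
have c0 n : const_mx 0 = 0 :> 'M[R]_(1, n) by apply/matrixP => i j; rewrite !mxE.
have -> : x = 0 by apply: (row_free_inj h1); rewrite mul0mx mul_homog x1 sx c0 row_mx0.
have -> : y = 0 by apply: (row_free_inj h2); rewrite mul0mx mul_homog y1 sy c0 row_mx0.
by rewrite row_mx0.
Qed.

(** The joining coordinate makes the sum of y integral, and the total sum then does the same for x,
    so the lattice is the product of those of the factors. The left side is spelled out because the
    dimensions do not convert to those of [simplex_lattice]. *)
Lemma join_lattice x y :
  (exists l, row_mx x y *m homog (to_real R join_matrix) = to_real R l) <->
  simplex_lattice R W1 x /\ simplex_lattice R W2 y.
Proof.
rewrite mul_homog mul_join_matrix sum_row_mx.
have mapc n (z : int) : const_mx z%:~R = to_real R (const_mx z : 'rV[int]_n).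
  by rewrite /to_real map_const_mx.
split=> [[l hl]|[[l hl] [k hk]]].
  have hy : \sum_i y 0 i \is a Num.int.
    have := congr1 (fun M : 'rV_(d1 + d2 + 1 + 1) => M 0 (lshift 1 (rshift (d1 + d2) 0))) hl.
    by rewrite row_mxEl row_mxEr mxE => ->; exact: to_real_int.
  have hxy : \sum_i x 0 i + \sum_i y 0 i \is a Num.int.
    have := congr1 (fun M : 'rV_(d1 + d2 + 1 + 1) => M 0 (rshift (d1 + d2 + 1) 0)) hl.
    by rewrite row_mxEr mxE => ->; exact: to_real_int.
  have hx : \sum_i x 0 i \is a Num.int by rewrite rpredDr in hxy.
  have := congr1 (fun M => lsubmx (lsubmx M)) hl; rewrite !row_mxKl.
  rewrite /to_real -!map_lsubmx -/(to_real R _) => e.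
  have [x' hx'] := intrP hx; have [y' hy'] := intrP hy.
  split; [exists (row_mx (lsubmx (lsubmx (lsubmx l))) (const_mx x'))
         |exists (row_mx (rsubmx (lsubmx (lsubmx l))) (const_mx y'))].
    rewrite mul_homog hx' mapc /to_real map_row_mx map_lsubmx; congr row_mx.
    by have := congr1 lsubmx e; rewrite row_mxKl.
  rewrite mul_homog hy' mapc /to_real map_row_mx map_rsubmx; congr row_mx.
  by have := congr1 rsubmx e; rewrite row_mxKr.
move: hl hk; rewrite !mul_homog => hl hk.
have [x' hx'] : exists z, \sum_i x 0 i = z%:~R.
  exists (l 0 (rshift d1 0)).
  have := congr1 (fun M : 'rV_(d1 + 1) => M 0 (rshift d1 0)) hl.
  by rewrite row_mxEr !mxE.
have [y' hy'] : exists z, \sum_i y 0 i = z%:~R.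
  exists (k 0 (rshift d2 0)).
  have := congr1 (fun M : 'rV_(d2 + 1) => M 0 (rshift d2 0)) hk.
  by rewrite row_mxEr !mxE.
have hx1 : x *m to_real R W1 = to_real R (lsubmx l).
  by have := congr1 lsubmx hl; rewrite row_mxKl /to_real map_lsubmx.
have hy1 : y *m to_real R W2 = to_real R (lsubmx k).
  by have := congr1 lsubmx hk; rewrite row_mxKl /to_real map_lsubmx.
exists (row_mx (row_mx (row_mx (lsubmx l) (lsubmx k)) (const_mx y')) (const_mx (x' + y'))).
by rewrite hx1 hy1 hx' hy' -intrD !mapc /to_real !map_row_mx.
Qed.

End Join.

(** * Lattice pyramids *)

Lemma unit_int_sqr (r z : int) : z * r = 1 -> r * r = 1.
Proof.
move=> /(congr1 absz); rewrite abszM => /eqP; rewrite muln_eq1 => /andP[_ /eqP h].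
have [->|->] : r = 1 \/ r = - 1 by lia.
  by rewrite mulr1.
by rewrite mulrNN mulr1.
Qed.

(** The Smith form of a column has a single possibly nonzero entry, so u is a multiple of the first
    column of a unimodular matrix. *)
Lemma smith_column n (u : 'cV[int]_n.+1) : exists L : 'M[int]_n.+1,
  exists2 r : int, L \in unitmx & u = L *m (r *: delta_mx 0 0).
Proof.
have [L uL [Q _ [e _ ->]]] := int_Smith_normal_form u.
exists L, (e`_0 * Q 0 0) => //; rewrite -mulmxA; congr (_ *m _).
apply/matrixP => i j; rewrite !ord1 mxE big_ord1 !mxE andbT.
case: i => -[|i] hi /=; first by rewrite mulr1n mulr1.
by rewrite mulr0n mul0r mulr0.
Qed.

Section Pyramid.
Variables (R : realType).

(** The last barycentric coordinate is an integral affine form with value 1 at the apex and 0 at the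
    other vertices. Its linear part u takes the value 1 on a lattice vector, so r is a unit and u
    extends to a basis; in these coordinates the simplex is a join with a point. *)
Lemma pyramid_last (V : 'M[int]_(5, 4)) : lattice_simplex R V ->
  (forall x, simplex_lattice R V x -> x 0 ord_max \is a Num.int) ->
  is_free_join (polytope R V).
Proof.
move=> hV hx.
have [|u [c hu]] := @dual_formP R 4 V hV (fun j => (j == ord_max)%:Z).
  move=> x /hx h; rewrite (bigD1 ord_max) //= big1 => [|j /negbTE->]; last by rewrite mulr0.
  by rewrite addr0 mulr1.
have [L [r uL uE]] := smith_column u.
have rr : r * r = 1.
  have e : ((row ord_max V - row ord0 V) *m u) 0 0 = 1.
    have rowB (B : 'cV[int]_5) i j : (row i B - row j B) 0 0 = B i 0 - B j 0 by rewrite !mxE.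
    rewrite mulmxBl -!row_mul rowB.
    have subDc (p q t : int) : p - q = (p + t) - (q + t) by ring.
    by rewrite (subDc _ _ c) -!hu.
  by move: e; rewrite uE -!scalemxAr [LHS]mxE mulrC => /unit_int_sqr.
(* K moves the first column of L to the end and multiplies it by r, so that the last column of L K
   is u. *)
pose K : 'M[int]_(1 + 3, 3 + 1) := block_mx 0 r%:M 1%:M 0.
pose K' : 'M[int]_(3 + 1, 1 + 3) := block_mx 0 1%:M r%:M 0.
have KK' : K *m K' = 1%:M.
  rewrite mulmx_block !mul0mx !mulmx0 !mul1mx !add0r !addr0 -scalar_mxM rr.
  by rewrite scalar_mx_block.
have K'K : K' *m K = 1%:M.
  rewrite mulmx_block !mul0mx !mulmx0 !mul1mx !add0r !addr0 -scalar_mxM rr.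
  by rewrite scalar_mx_block.
pose U : 'M[int]_(4, 3 + 0 + 1) := L *m K.
pose U' : 'M[int]_(3 + 0 + 1, 4) := K' *m invmx L.
have UU' : U *m U' = 1%:M.
  rewrite /U /U' mulmxA -(mulmxA L) KK' mulmx1; exact: mulmxV.
have U'U : U' *m U = 1%:M.
  rewrite /U /U' mulmxA -(mulmxA K') mulVmx // mulmx1; exact: K'K.
have Uu : rsubmx U = u.
  rewrite uE /U -mulmx_rsub; congr (_ *m _); rewrite /K block_mxEh row_mxKr.
  apply/matrixP => i j; rewrite !ord1; have [k ->|k ->] := @split_ordP 1 3 i.
    by apply: (etrans (@col_mxEu _ 1 3 1 _ _ _ _)); rewrite !ord1 !mxE mulr1.
  by apply: (etrans (@col_mxEd _ 1 3 1 _ _ _ _)); rewrite !mxE mulr0.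
(* The translation puts the apex at the origin of the first three coordinates and makes the last
   coordinate the affine form itself. *)
pose b : 'rV[int]_(3 + 0 + 1) := row_mx (- lsubmx (row ord_max V *m U)) (const_mx c).
pose V2 : 'M[int]_(5, 3 + 0 + 1) := V *m U + const_mx 1 *m b.
have V2ij i j : V2 i j = (V *m U) i j + b 0 j.
  by rewrite mxE [X in _ + X]mxE big_ord1 [X in X * _]mxE mul1r.
have hU (i : 'I_5) : V2 i (rshift (3 + 0) (0 : 'I_1)) = (i == ord_max)%:Z.
  rewrite V2ij /b row_mxEr [X in _ + X]mxE hu -Uu mulmx_rsub.
  by rewrite [(rsubmx _) _ _]mxE.
have hL (j : 'I_(3 + 0)) : V2 ord_max (lshift 1 j) = 0.
  have rowE (B : 'M[int]_(5, 3 + 0 + 1)) : (- lsubmx (row ord_max B)) 0 j = - B ord_max (lshift 1 j).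
    by rewrite !mxE.
  by rewrite V2ij /b row_mxEl -row_mul rowE subrr.
pose W1 : 'M[int]_(4, 3) := \matrix_(i < 4, j < 3) V2 (@lshift 4 1 i) (@lshift 3 1 (@lshift 3 0 j)).
have V2E : V2 = join_matrix W1 (0 : 'M_(1, 0)).
  apply/matrixP => i j.
  have [k ->|k ->] := @split_ordP 4 1 i; have [l ->|l ->] := @split_ordP (3 + 0) 1 j.
  - have [l' ->|[]//] := @split_ordP 3 0 l.
    by rewrite [RHS](@join_matrix_ul 3 0) [RHS]mxE.
  - rewrite [RHS](@join_matrix_ur 3 0) [l]ord1 hU.
    by case: eqP => // /(congr1 val) /= e; move: (ltn_ord k); rewrite e.
  - have [l' ->|[]//] := @split_ordP 3 0 l.
    rewrite [RHS](@join_matrix_dl 3 0) -(hL (lshift 0 l')); congr (V2 _ _).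
    by apply: val_inj; rewrite /= [k]ord1.
  - rewrite [RHS](@join_matrix_dr 3 0) [l]ord1 hU.
    by case: eqP => // -[]; apply: val_inj; rewrite /= [k]ord1.
have hfree : row_free (homog (to_real R V2)).
  apply/inj_row_free => x /mul_homog_eq0[xV2 xs].
  have xb : x *m const_mx 1 = 0 :> 'M_1.
    apply/matrixP => i j; rewrite !ord1 [LHS]mxE [RHS]mxE -[RHS]xs; apply: eq_bigr => k _.
    by rewrite mxE mulr1.
  have xV : x *m to_real R V = 0.
    have : x *m to_real R V2 *m to_real R U' = 0 by rewrite xV2 mul0mx.
    have -> : to_real R V2 = to_real R V *m to_real R U + const_mx 1 *m to_real R b.
      by rewrite /V2 to_realD !to_realM /to_real map_const_mx.
    rewrite mulmxDr (mulmxA x (const_mx 1)) xb mul0mx addr0 -!mulmxA -to_realM UU'.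
    by rewrite /to_real map_mx1 mulmx1.
  apply: (row_free_inj hV); rewrite mul0mx mul_homog xV xs.
  by apply/rowP => j; rewrite !mxE; case: fintype.split => k; rewrite mxE.
rewrite V2E in hfree; have [h1 h2] := @join_simplices R 3 0 W1 0 hfree.
exists 3%N, 0%N, (polytope R W1), (polytope R (0 : 'M[int]_(1, 0))); split=> //.
exists U, U', b; split=> //.
rewrite -free_join_matrix -V2E; apply: (polytope_affine (W := V2 : 'M_(5, 4))).
by rewrite /V2 to_realD !to_realM /to_real map_const_mx.
Qed.

Lemma pyramid_free_join (V : 'M[int]_(5, 4)) i : lattice_simplex R V ->
  (forall x, simplex_lattice R V x -> x 0 i \is a Num.int) ->
  is_free_join (polytope R V).
Proof.
move=> hV hx; rewrite -(polytope_row_perm R (tperm i ord_max) V).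
apply: pyramid_last; first exact: simplex_row_perm.
move=> x; rewrite lattice_row_permE => -[y hy <-].
by rewrite mxE tpermR; exact: hx.
Qed.

End Pyramid.

(** * Coverings by three coordinates *)

Section HalfIntegers.
Variable R : realType.
Implicit Types a b : R.

Definition half_int a := a - 2^-1 \is a Num.int.

Lemma half_intP a : a *+ 2 \is a Num.int -> a \isn't a Num.int -> half_int a.
Proof.
move=> /intrP[z hz] ha; rewrite /half_int.
have aE : a = z%:~R / 2 by rewrite -hz; field.
have [k [zE|zE]] : exists k, z = k * 2 \/ z = k * 2 + 1 by exists (z %/ 2)%Z; lia.
  have e : a = k%:~R by rewrite aE zE intrM; field.
  by case/negP: ha; rewrite e intr_int.
have e : a - 2^-1 = k%:~R by rewrite aE zE intrD intrM; field.
by rewrite e intr_int.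
Qed.

Lemma half_intB a b : half_int a -> half_int b -> a - b \is a Num.int.
Proof. by rewrite /half_int => ha hb; rewrite -(subrKA 2^-1) rpredD // -opprB rpredN. Qed.

Lemma half_intD a b : half_int a -> half_int b -> a + b \is a Num.int.
Proof.
rewrite /half_int => ha hb; have -> : a + b = (a - 2^-1) + (b - 2^-1) + 1 by field.
by apply: rpredD (rpred1 _); exact: rpredD.
Qed.

End HalfIntegers.

Section SmallCover.
Variables (R : realType) (V : 'M[int]_(5, 4)).
Hypothesis hV : lattice_simplex R V.
Local Notation G := (simplex_lattice R V).

(** The adjugate inverts (V, 1) up to its determinant, so the determinant clears all
    denominators. *)
Lemma common_denominator : exists2 D : nat, (0 < D)%N &
  forall x i, G x -> x 0 i * D%:R \is a Num.int.
Proof.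
pose M : 'M[int]_5 := homog V.
have hM x : G x -> exists l : 'rV[int]_5, x *m to_real R M = to_real R l.
  by move=> [l hl]; exists l; rewrite -hl homog_to_real.
have dM : \det M != 0.
  have : row_free (to_real R M) by move: hV; rewrite /lattice_simplex homog_to_real.
  rewrite row_free_unit unitmxE unitfE /to_real det_map_mx intr_eq0.
  by [].
exists (absz (\det M)); first by rewrite absz_gt0.
move=> x i /hM[l hl].
have e : (\det M)%:~R *: x = to_real R (l *m \adj M).
  rewrite to_realM -hl -mulmxA -to_realM mul_mx_adj.
  by rewrite /to_real map_scalar_mx mul_mx_scalar.
have hi : x 0 i * (\det M)%:~R \is a Num.int.
  have := congr1 (fun A : 'rV[R]_5 => A 0 i) e.
  by rewrite mxE mulrC => ->; exact: to_real_int.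
have [-> //|->] : (absz (\det M))%:R = (\det M)%:~R :> R \/ (absz (\det M))%:R = - (\det M)%:~R :> R.
  rewrite pmulrn abszE; case: (ger0P (\det M)) => _; [by left|right].
  by rewrite intrN.
by rewrite mulrN rpredN.
Qed.

(** The values of one coordinate modulo Z form a finite subgroup of Q/Z, hence a cyclic one. Over
    the common denominator D the least positive numerator g divides all others and D itself, and m =
    D / g. *)
Lemma cyclic_coordinate i : exists2 m : nat, (0 < m)%N &
  (exists2 u, G u & u 0 i - m%:R^-1 \is a Num.int) /\
  forall x, G x -> exists k : nat, x 0 i - k%:R / m%:R \is a Num.int.
Proof.
have [D D0 hD] := common_denominator.
have D0' : D%:R != 0 :> R by rewrite pnatr_eq0 -lt0n.
pose Q (c : nat) := `[< (0 < c)%N /\ exists2 x, G x & x 0 i - c%:R / D%:R \is a Num.int >].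
have exQ : exists c, Q c.
  exists D; apply/asboolP; split=> //; exists 0; first exact: lattice0.
  by rewrite mxE divff // sub0r rpredN rpred1.
case: (ex_minnP exQ) => g /asboolP[g0 [u hu ug]] gmin.
have key x (z : nat) : G x -> x 0 i - z%:R / D%:R \is a Num.int -> (g %| z)%N.
  move=> hx xz; rewrite /dvdn; apply/eqP; apply: contrapT => /eqP; rewrite -lt0n => r0.
  have : Q (z %% g)%N.
    apply/asboolP; split=> //; exists (x - u *+ (z %/ g)).
      by apply: latticeB => //; exact: latticeMn.
    have -> : (x - u *+ (z %/ g)) 0 i - (z %% g)%N%:R / D%:R =
        (x 0 i - z%:R / D%:R) - (u 0 i - g%:R / D%:R) *+ (z %/ g).
      have -> : (x - u *+ (z %/ g)) 0 i = x 0 i - u 0 i *+ (z %/ g).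
        by rewrite mxE [X in _ + X]mxE mulmxnE.
      have -> : z%:R = (z %/ g)%N%:R * g%:R + (z %% g)%N%:R :> R.
        by rewrite -natrM -natrD -divn_eq.
      rewrite -[u 0 i *+ _]mulr_natr -[(_ - _) *+ _]mulr_natr; field.
      exact: D0'.
    by rewrite rpredB // rpredMn.
  by move=> /gmin; rewrite leqNgt ltn_pmod.
have gD : (g %| D)%N.
  apply: (key 0); first exact: lattice0.
  by rewrite mxE divff // sub0r rpredN rpred1.
pose m := (D %/ g)%N; have DE : D = (m * g)%N by rewrite divnK.
have m0 : (0 < m)%N by move: D0; rewrite DE muln_gt0 => /andP[].
have g0' : g%:R != 0 :> R by rewrite pnatr_eq0 -lt0n.
have m0' : m%:R != 0 :> R by rewrite pnatr_eq0 -lt0n.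
exists m => //; split.
  exists u => //; have -> // : m%:R^-1 = g%:R / D%:R :> R.
  by rewrite DE natrM; field; rewrite m0' g0'.
move=> x hx; have /intrP[z hz] := hD x i hx.
pose z' := absz (modz z D).
have z'E : z'%:R = (modz z D)%:~R :> R.
  by rewrite pmulrn gez0_abs // modz_ge0 // eqz_nat -lt0n.
have xz : x 0 i - z'%:R / D%:R \is a Num.int.
  have -> : x 0 i = z%:~R / D%:R by rewrite -hz mulfK.
  by rewrite z'E -mulrBl -intrB {1}(divz_eq z D) addrK intrM -pmulrn mulfK ?intr_int.
have /dvdnP[k kE] := key _ _ hx xz; exists k.
have -> // : k%:R / m%:R = z'%:R / D%:R :> R.
by rewrite kE DE !natrM; field; rewrite m0' g0'.
Qed.

End SmallCover.

Lemma ord5P (P : 'I_5 -> Prop) :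
  P (o 0) -> P (o 1) -> P (o 2) -> P (o 3) -> P (o 4) -> forall i, P i.
Proof.
move=> p0 p1 p2 p3 p4 -[[|[|[|[|[|//]]]]] hi]; rewrite (bool_irrelevance hi isT) //.
Qed.

Lemma sum5 (A : nmodType) (F : 'I_5 -> A) :
  \sum_i F i = F (o 0) + F (o 1) + F (o 2) + F (o 3) + F (o 4).
Proof.
rewrite !big_ord_recl big_ord0 addr0 !addrA.
by do ![congr (_ + _)]; congr F; apply: val_inj.
Qed.

Section Columns.
Variables (R : realType) (d : nat) (V : 'M[int]_(d.+1, d)).

Lemma lattice_columns x : simplex_lattice R V x <->
  (forall j, \sum_i x 0 i * (V i j)%:~R \is a Num.int) /\ \sum_i x 0 i \is a Num.int.
Proof.
have e j : \sum_i x 0 i * (V i j)%:~R = (x *m to_real R V) 0 j.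
  by rewrite mxE; apply: eq_bigr => i _; rewrite [to_real R V i j]mxE.
split=> [hx|[h1 h2]].
  split; last exact: lattice_coord_sum hx.
  move=> j; rewrite e; have [l] := hx.
  rewrite mul_homog => /(congr1 lsubmx); rewrite row_mxKl => ->.
  by rewrite [lsubmx _ _ _]mxE to_real_int.
have [z hz] := intrP h2.
have [l hl] : exists l, x *m to_real R V = to_real R l.
  by apply: int_row => j; rewrite -e.
exists (row_mx l (const_mx z)).
by rewrite mul_homog hl hz /to_real map_row_mx map_const_mx.
Qed.

End Columns.

(** * The free join of a triangle and a segment *)

Section ProductSimplex.
Variable R : realType.

Lemma row_free_lattice d (V : 'M[int]_(d.+1, d)) :
  (forall x : 'rV[R]_d.+1, (forall j, \sum_i x 0 i * (V i j)%:~R = 0) ->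
     \sum_i x 0 i = 0 -> x = 0) -> lattice_simplex R V.
Proof.
move=> h; apply/inj_row_free => x /mul_homog_eq0[xV xs]; apply: h => // j.
have : (x *m to_real R V) 0 j = 0 by rewrite xV mxE.
rewrite mxE => e; rewrite -[RHS]e; by apply: eq_bigr => i _; rewrite [to_real R V i j]mxE.
Qed.

Definition dilated_simplex n (m : nat) : 'M[int]_(n.+1, n) :=
  \matrix_(i, j) (m%:Z *+ (i == j.+1 :> nat)).

Lemma mul_dilated_simplex n m (x : 'rV[R]_n.+1) j :
  \sum_i x 0 i * (dilated_simplex n m i j)%:~R = x 0 (lift ord0 j) * m%:R.
Proof.
rewrite (bigD1 (lift ord0 j)) //= mxE /= eqxx mulr1n -pmulrn big1 ?addr0 // => i ij.
rewrite mxE; case: eqP => e; last by rewrite mulr0n mulr0.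
by case/eqP: ij; apply: val_inj.
Qed.

Lemma dilated_simplex_simplex n m : (0 < m)%N -> lattice_simplex R (dilated_simplex n m).
Proof.
move=> m0; apply: row_free_lattice => x hx hs.
have h (j : 'I_n) : x 0 (lift ord0 j) = 0.
  have /eqP := hx j; rewrite mul_dilated_simplex mulf_eq0 pnatr_eq0 => /orP[/eqP//|/eqP m00].
  by rewrite m00 in m0.
move: hs; rewrite big_ord_recl big1 ?addr0 => [h0|j _]; last exact: h.
apply/rowP => i; rewrite [RHS]mxE; case: (unliftP ord0 i) => [j ->|->] //.
Qed.

Lemma dilated_simplex_lattice n m (x : 'rV[R]_n.+1) :
  simplex_lattice R (dilated_simplex n m) x <->
  (forall j : 'I_n, x 0 (lift ord0 j) * m%:R \is a Num.int) /\ \sum_i x 0 i \is a Num.int.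
Proof.
rewrite lattice_columns; split=> -[h1 h2]; split=> // j.
  by rewrite -mul_dilated_simplex.
by rewrite mul_dilated_simplex.
Qed.

(** Twice a unimodular triangle joined with a segment of length m: the half-integral coordinates
    come from the triangle, the cyclic group of order m from the segment. *)
Definition product_simplex m : 'M[int]_(5, 4) :=
  join_matrix (dilated_simplex 2 2) (dilated_simplex 1 m).

Lemma product_lattice m (x : 'rV[R]_5) : simplex_lattice R (product_simplex m) x <->
  [/\ x 0 (o 1) * 2 \is a Num.int, x 0 (o 2) * 2 \is a Num.int,
      x 0 (o 0) + x 0 (o 1) + x 0 (o 2) \is a Num.int,
      x 0 (o 4) * m%:R \is a Num.int & x 0 (o 3) + x 0 (o 4) \is a Num.int].
Proof.
have := @join_lattice R 2 1 (dilated_simplex 2 2) (dilated_simplex 1 m)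
  (@lsubmx _ 1 3 2 x) (@rsubmx _ 1 3 2 x).
rewrite hsubmxK => h; apply: (iff_trans h).
rewrite !dilated_simplex_lattice !big_ord_recl !big_ord0 !addr0.
have el (i : 'I_3) : (@lsubmx _ 1 3 2 x) 0 i = x 0 (lshift 2 i) by rewrite mxE.
have er (i : 'I_2) : (@rsubmx _ 1 3 2 x) 0 i = x 0 (rshift 3 i) by rewrite mxE.
have e0 : lshift 2 (ord0 : 'I_3) = o 0 by exact: val_inj.
have e1 : lshift 2 (lift ord0 ord0 : 'I_3) = o 1 by exact: val_inj.
have e2 : lshift 2 (lift ord0 (lift ord0 ord0) : 'I_3) = o 2 by exact: val_inj.
have e3 : rshift 3 (ord0 : 'I_2) = o 3 by exact: val_inj.
have e4 : rshift 3 (lift ord0 ord0 : 'I_2) = o 4 by exact: val_inj.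
rewrite !el !er e0 e1 e2 e3 e4 addrA.
split=> [[[h1 h2] [h3 h4]]|[h1 h2 h3 h4 h5]].
  split=> //.
  - by have := h1 ord0; rewrite el e1.
  - by have := h1 (lift ord0 ord0); rewrite el e2.
  - by have := h3 ord0; rewrite er e4.
split; split=> // j.
  rewrite el; case: (unliftP ord0 j) => [k ->|->]; last by rewrite e1.
  by rewrite [k]ord1 e2.
by rewrite er [j]ord1 e4.
Qed.

Lemma product_free_join (V : 'M[int]_(5, 4)) m : (0 < m)%N -> lattice_simplex R V ->
  simplex_lattice R V = simplex_lattice R (product_simplex m) ->
  is_free_join (polytope R V).
Proof.
move=> m0 hV hG.
have hf := @join_row_free R 2 1 _ _ (dilated_simplex_simplex 2 (isT : 0 < 2)%N)
  (dilated_simplex_simplex 1 m0).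
have [h1 h2] := @join_simplices R 2 1 _ _ hf.
exists 2%N, 1%N, (polytope R (dilated_simplex 2 2)), (polytope R (dilated_simplex 1 m)).
split=> //; rewrite -free_join_matrix; exact: lattice_iso hG.
Qed.

End ProductSimplex.

Lemma triple_cases (R : realType) (a b c : R) :
  a *+ 2 \is a Num.int -> b *+ 2 \is a Num.int -> c *+ 2 \is a Num.int ->
  a + b + c \is a Num.int ->
  [\/ [/\ a \is a Num.int, b \is a Num.int & c \is a Num.int],
      [/\ a \is a Num.int, half_int b & half_int c],
      [/\ half_int a, b \is a Num.int & half_int c] |
      [/\ half_int a, half_int b & c \is a Num.int]].
Proof.
move=> a2 b2 c2; have [ai|ai] := boolP (a \is a Num.int);
  have [bi|bi] := boolP (b \is a Num.int).
- by rewrite rpredDl ?rpredD // => ci; apply: Or41.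
- rewrite -addrA rpredDl // => bc; apply: Or42; split=> //; apply: half_intP => //.
  by apply: contra bi => ci; rewrite rpredDr in bc.
- rewrite addrAC rpredDr // => ac; apply: Or43; split=> //; apply: half_intP => //.
  by apply: contra ai => ci; rewrite rpredDr in ac.
have ha := half_intP a2 ai; have hb := half_intP b2 bi.
by rewrite rpredDl ?half_intD // => ci; apply: Or44.
Qed.

(** * Half-integrality and the free join case *)

Section Three.
Variables (R : realType) (V : 'M[int]_(5, 4)).
Hypothesis hI : minimal_cover R V (segment 3).
Local Notation G := (simplex_lattice R V).
Local Notation S := (support (segment 3)).

(** Two integral covering coordinates leave a support of at most one element, which must be
    empty. *)
Lemma support3_int x (i j : 'I_5) : G x -> (i < 3)%N -> (j < 3)%N -> i != j ->
  x 0 i \is a Num.int -> x 0 j \is a Num.int ->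
  forall k : 'I_5, (k < 3)%N -> x 0 k \is a Num.int.
Proof.
move=> hx i3 j3 ij xi xj k k3; apply: support0_int (segment 3) _ _ _ _; last by rewrite inE.
apply: (support_le1 hI) => //; apply/card_le1_eqP => a b; rewrite !inE.
move=> /andP[a3 xa] /andP[b3 xb]; apply: val_inj.
have ai : a != i by apply: contraNneq xa => ->.
have aj : a != j by apply: contraNneq xa => ->.
have bi : b != i by apply: contraNneq xb => ->.
have bj : b != j by apply: contraNneq xb => ->.
move: ij ai aj bi bj; rewrite -!(inj_eq val_inj) /=; lia.
Qed.

Lemma covered3 x : G x -> exists2 i : 'I_5, (i < 3)%N & x 0 i \is a Num.int.
Proof. by have [hc _] := hI; move=> /hc[i]; rewrite inE; exists i. Qed.

Lemma half3 x (i : 'I_5) : G x -> (i < 3)%N -> x 0 i \isn't a Num.int -> half_int (x 0 i).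
Proof.
move=> hx i3 xi; apply: half_intP => //; rewrite -mulmxnE.
apply: (@support0_int _ _ (segment 3)); last by rewrite inE.
apply: (support_le2 hI) => //; have [j j3 xj] := covered3 hx.
suff : (S x \subset [set a : 'I_5 | (a < 3)%N & a != j]).
  move=> /subset_leq_card h; apply: leq_trans h _.
  rewrite cardsE cardE /enum_mem -enumT /= !enum_ordSl enum_ord0 /=.
  by case: j j3 {xj} => -[|[|[|]]].
apply/fintype.subsetP => a; rewrite !inE => /andP[-> xa] /=.
by apply: contraNneq xa => ->.
Qed.

Lemma cases3 x : G x -> (forall k : 'I_5, (k < 3)%N -> x 0 k \is a Num.int) \/
  exists2 i : 'I_5, (i < 3)%N & x 0 i \is a Num.int /\
    forall j : 'I_5, (j < 3)%N -> j != i -> x 0 j \isn't a Num.int.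
Proof.
move=> hx; have [i i3 xi] := covered3 hx.
have [h|h] := pselect (exists2 j : 'I_5, (j < 3)%N & (j != i) && (x 0 j \is a Num.int)).
  left; have [j j3 /andP[ji xj]] := h.
  exact: support3_int hx j3 i3 ji xj xi.
right; exists i => //; split=> // j j3 ji; apply/negP => xj; apply: h.
by exists j; rewrite ?ji.
Qed.

Lemma sum3_int x : G x -> x 0 (o 0) + x 0 (o 1) + x 0 (o 2) \is a Num.int.
Proof.
move=> hx; have [h|[i i3 [xi h]]] := cases3 hx; first by rewrite !rpredD ?h.
have hh (j : 'I_5) : (j < 3)%N -> j != i -> half_int (x 0 j).
  by move=> j3 ji; apply: half3 => //; exact: h.
move: i i3 xi hh {h}; apply: ord5P => // _ xi hh.
- by rewrite -addrA rpredD // half_intD // hh.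
- by rewrite addrAC rpredD // half_intD // hh.
- by rewrite rpredD // half_intD // hh.
Qed.

Lemma sum34_int x : G x -> x 0 (o 3) + x 0 (o 4) \is a Num.int.
Proof.
by move=> hx; have := lattice_coord_sum hx; rewrite sum5 -addrA rpredDl // sum3_int.
Qed.

(* The point of the plane [x_0 = x_1 = x_2 = 0] generating the last coordinate. *)
Definition tail_point (m : nat) : 'rV[R]_5 :=
  \row_i nth 0 [:: 0; 0; 0; m%:R^-1; - m%:R^-1] i.

(** Multiples of the tail point clear the last two coordinates modulo Z. The witnesses of
    minimality, cleared in this way, realize every half-integral pattern of the triangle. *)
Lemma product_case m : (0 < m)%N -> G (tail_point m) ->
  (forall x, G x -> exists k : nat, x 0 (o 3) - k%:R / m%:R \is a Num.int) ->
  G = simplex_lattice R (product_simplex m).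
Proof.
move=> m0 ht hk; have m0' : m%:R != 0 :> R by rewrite pnatr_eq0 -lt0n.
apply/seteqP; split=> x.
  move=> hx; apply/product_lattice.
  have h2 (i : 'I_5) : (i < 3)%N -> x 0 i * 2 \is a Num.int.
    move=> i3; have [xi|xi] := boolP (x 0 i \is a Num.int); first by rewrite rpredM ?natr_int.
    by rewrite mulr_natr mulr2n half_intD // half3.
  split; [exact: h2|exact: h2|exact: sum3_int| |exact: sum34_int].
  have [k xk] := hk _ hx.
  have -> : x 0 (o 4) * m%:R = (x 0 (o 3) + x 0 (o 4)) * m%:R -
      (x 0 (o 3) - k%:R / m%:R) * m%:R - k%:R by field.
  by rewrite !rpredB ?rpredM ?natr_int ?sum34_int.
move=> /product_lattice[h1 h2 h012 h4 h34].
have /intrP[z hz] := h4.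
have x4 : x 0 (o 4) = z%:~R / m%:R by rewrite -hz mulfK.
(* The multiple is chosen so that the last coordinate of y is exactly 0. *)
pose y := x + tail_point m *~ z.
have ty (i : 'I_5) : y 0 i = x 0 i + nth 0 [:: 0; 0; 0; m%:R^-1; - m%:R^-1] i * z%:~R.
  by rewrite /y -scaler_int mxE [X in _ + X]mxE [tail_point m _ _]mxE mulrC.
suff hy : G y by rewrite -[x](addrK (tail_point m *~ z)); apply: latticeB => //; exact: latticeMz.
have y4 : y 0 (o 4) = 0 by rewrite ty /= x4 mulNr mulrC subrr.
have y3 : y 0 (o 3) \is a Num.int.
  by rewrite ty /=; have -> : m%:R^-1 * z%:~R = x 0 (o 4) by rewrite x4 mulrC.
have yE (i : 'I_5) : (i < 3)%N -> y 0 i = x 0 i.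
  by move: i; apply: ord5P => //; rewrite ty /= mul0r addr0.
have pG (i : 'I_5) : (i < 3)%N -> exists2 p, G p & [/\ p 0 i \is a Num.int,
    forall j : 'I_5, (j < 3)%N -> j != i -> half_int (p 0 j), p 0 (o 3) \is a Num.int &
    p 0 (o 4) \is a Num.int].
  move=> i3; have [hc /(_ i)[|q hq qi]] := hI; first by rewrite inE.
  have [k qk] := hk _ hq.
  have tk (j : 'I_5) : (q - tail_point m *+ k) 0 j =
      q 0 j - nth 0 [:: 0; 0; 0; m%:R^-1; - m%:R^-1] j * k%:R.
    by rewrite mxE [X in _ + X]mxE mulmxnE mxE mulr_natr.
  have p3 : (q - tail_point m *+ k) 0 (o 3) \is a Num.int by rewrite tk /= mulrC.
  exists (q - tail_point m *+ k); first by apply: latticeB => //; exact: latticeMn.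
  have tk3 (j : 'I_5) : (j < 3)%N -> (q - tail_point m *+ k) 0 j = q 0 j.
    by move: j; apply: ord5P => //; rewrite tk /= mul0r subr0.
  split=> //.
  - rewrite tk3 //; have [j] := hc _ hq; rewrite inE => j3 qj.
    by rewrite -(qi j) ?inE.
  - move=> j j3 ji; rewrite tk3 //; apply: half3 => //; apply: contraNN ji => qj.
    by apply/eqP; apply: qi; rewrite ?inE.
  - have -> : (q - tail_point m *+ k) 0 (o 4) = (q 0 (o 3) + q 0 (o 4)) -
        (q - tail_point m *+ k) 0 (o 3) by rewrite !tk /=; ring.
    by rewrite rpredB // sum34_int.
have h0 : x 0 (o 0) *+ 2 \is a Num.int.
  have -> : x 0 (o 0) *+ 2 = (x 0 (o 0) + x 0 (o 1) + x 0 (o 2)) * 2 - x 0 (o 1) * 2 - x 0 (o 2) * 2.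
    by rewrite -mulr_natr; ring.
  by rewrite !rpredB // rpredM ?natr_int.
rewrite !mulr_natr in h1 h2.
have close p : G p -> y 0 (o 0) - p 0 (o 0) \is a Num.int ->
    y 0 (o 1) - p 0 (o 1) \is a Num.int -> y 0 (o 2) - p 0 (o 2) \is a Num.int ->
    p 0 (o 3) \is a Num.int -> p 0 (o 4) \is a Num.int -> G y.
  move=> hp e0 e1 e2 e3 e4; apply: lattice_congr hp; apply: ord5P.
  - by rewrite -opprB rpredN.
  - by rewrite -opprB rpredN.
  - by rewrite -opprB rpredN.
  - by rewrite rpredB.
  - by rewrite rpredB // y4 rpred0.
have [y0 y1 y2] : [/\ y 0 (o 0) = x 0 (o 0), y 0 (o 1) = x 0 (o 1) & y 0 (o 2) = x 0 (o 2)].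
  by split; apply: yE.
have [[a b c]|[a b c]|[a b c]|[a b c]] := triple_cases h0 h1 h2 h012.
- by apply: lattice_int; apply: ord5P; rewrite ?y0 ?y1 ?y2 ?y4 ?rpred0.
- have [p hp [p0 ph p3 p4]] := pG (o 0) isT; apply: (close p) => //; rewrite ?y0 ?y1 ?y2.
  + exact: rpredB.
  + exact: half_intB b (ph (o 1) isT isT).
  + exact: half_intB c (ph (o 2) isT isT).
- have [p hp [p0 ph p3 p4]] := pG (o 1) isT; apply: (close p) => //; rewrite ?y0 ?y1 ?y2.
  + exact: half_intB a (ph (o 0) isT isT).
  + exact: rpredB.
  + exact: half_intB c (ph (o 2) isT isT).
- have [p hp [p0 ph p3 p4]] := pG (o 2) isT; apply: (close p) => //; rewrite ?y0 ?y1 ?y2.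
  + exact: half_intB a (ph (o 0) isT isT).
  + exact: half_intB b (ph (o 1) isT isT).
  + exact: rpredB.
Qed.

End Three.

(** * Three covering coordinates without the tail point: the family *)

Section Family.
Variables (R : realType) (V : 'M[int]_(5, 4)).
Hypothesis hI : minimal_cover R V (segment 3).
Local Notation G := (simplex_lattice R V).

Lemma tail_point_mem m (w : 'rV[R]_5) : G w -> w 0 (o 0) \is a Num.int -> w 0 (o 1) \is a Num.int ->
  w 0 (o 2) \is a Num.int -> w 0 (o 3) - m%:R^-1 \is a Num.int -> G (tail_point R m).
Proof.
move=> hw w0 w1 w2 w3; apply: lattice_congr (hw); apply: ord5P;
  rewrite [tail_point _ _ _ _]mxE /= ?subr0 //.
have -> : w 0 (o 4) - - m%:R^-1 = w 0 (o 3) + w 0 (o 4) - (w 0 (o 3) - m%:R^-1) by ring.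
by rewrite rpredB // (sum34_int hI hw).
Qed.

(** Subtracting a multiple of u makes coordinate 3 integral. The rest is then integral or has the
    pattern of y; any other pattern would put the tail point into G. *)
Lemma family_case h u y : (0 < h)%N ->
  (forall x, G x -> exists k : nat, x 0 (o 3) - k%:R / (2 * h)%N%:R \is a Num.int) ->
  ~ G (tail_point R (2 * h)) ->
  G u -> u 0 (o 0) \is a Num.int -> half_int (u 0 (o 1)) -> half_int (u 0 (o 2)) ->
  u 0 (o 3) - (2 * h)%N%:R^-1 \is a Num.int ->
  G y -> half_int (y 0 (o 0)) -> y 0 (o 1) \is a Num.int -> half_int (y 0 (o 2)) ->
  y 0 (o 3) \is a Num.int ->
  G = code_lattice R (2 * h) (family_gens h).
Proof.
move=> h0 hk ht hu u0 u1 u2 u3 hy y0 y1 y2 y3; set m := (2 * h)%N in hk ht u3 *.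
have m1 : (1 <= m)%N by rewrite muln_gt0.
have m0 : m%:R != 0 :> R by rewrite pnatr_eq0 -lt0n.
have hm : half_int (h%:R / m%:R : R).
  have hn0 : h%:R != 0 :> R by rewrite pnatr_eq0 -lt0n.
  rewrite /half_int /m natrM; have -> : h%:R / (2 * h%:R) - 2^-1 = 0 :> R by field.
  exact: rpred0.
have u4 : u 0 (o 4) + m%:R^-1 \is a Num.int.
  have -> : u 0 (o 4) + m%:R^-1 = u 0 (o 3) + u 0 (o 4) - (u 0 (o 3) - m%:R^-1) by ring.
  by rewrite rpredB // (sum34_int hI hu).
have y4 : y 0 (o 4) \is a Num.int by rewrite -(rpredDl _ y3) (sum34_int hI hy).
have yg i : residue_vec R m [:: h; 0; h; 0; 0]%N 0 i - y 0 i \is a Num.int.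
  move: i; apply: ord5P; rewrite mxE /= ?mul0r ?sub0r ?rpredN //; exact: half_intB.
have ug i : residue_vec R m [:: 0; h; h; 1; m - 1]%N 0 i - u 0 i \is a Num.int.
  move: i; apply: ord5P; rewrite mxE /= ?mul0r ?sub0r ?rpredN //; try exact: half_intB.
    by rewrite mul1r -opprB rpredN.
  rewrite (natrB _ m1).
  have -> : (m%:R - 1) / m%:R - u 0 (o 4) = 1 - (u 0 (o 4) + m%:R^-1) by field.
  by rewrite rpredB ?rpred1.
apply/seteqP; split=> x; last first.
  apply: code_lattice_sub => r; rewrite !inE => /orP[]/eqP ->.
    by apply: lattice_congr (hy) => i; rewrite -opprB rpredN.
  by apply: lattice_congr (hu) => i; rewrite -opprB rpredN.
move=> hx; have [k xk] := hk _ hx.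
have cy : code_lattice R m (family_gens h) y.
  by apply: code_lattice_congr yg _; apply: code_lattice_gen; rewrite inE eqxx.
have cu : code_lattice R m (family_gens h) u.
  by apply: code_lattice_congr ug _; apply: code_lattice_gen; rewrite !inE eqxx orbT.
have cuk : code_lattice R m (family_gens h) (u *+ k).
  elim: k {xk} => [|k IH]; first exact: code_lattice0.
  by rewrite mulrS; exact: code_latticeD.
rewrite -[x](subrK (u *+ k)); apply: code_latticeD cuk.
set z := x - u *+ k; have hz : G z by apply: latticeB => //; exact: latticeMn.
have z3 : z 0 (o 3) \is a Num.int.
  have -> : z 0 (o 3) = (x 0 (o 3) - k%:R / m%:R) - (u 0 (o 3) - m%:R^-1) *+ k.
    rewrite mxE [X in _ + X]mxE mulmxnE -[u 0 _ *+ k]mulr_natr -[(_ - _) *+ k]mulr_natr; ring.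
  by rewrite rpredB // rpredMn.
clearbody z; have z4 : z 0 (o 4) \is a Num.int by rewrite -(rpredDl _ z3) (sum34_int hI hz).
have [hh|[i i3 [zi hi]]] := cases3 hI hz.
  apply: code_lattice_congr (code_lattice0 R m (family_gens h)) => i.
  by rewrite mxE sub0r rpredN; move: i; apply: ord5P => //; apply: hh.
have hhz (j : 'I_5) : (j < 3)%N -> j != i -> half_int (z 0 j).
  by move=> j3 ji; apply: (half3 hI hz j3); exact: hi.
have sB (v w : 'rV[R]_5) j : (v - w) 0 j = v 0 j - w 0 j by rewrite !mxE.
have sD (v w : 'rV[R]_5) j : (v + w) 0 j = v 0 j + w 0 j by rewrite !mxE.
(* Such a v has the half-integral pattern of u, so u - v would be the tail point modulo Z^5. *)
have ww (v : 'rV[R]_5) : G v -> v 0 (o 0) \is a Num.int -> half_int (v 0 (o 1)) ->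
    half_int (v 0 (o 2)) -> v 0 (o 3) \is a Num.int -> False.
  move=> hv v0 v1 v2 v3; apply: ht; apply: (@tail_point_mem m (u - v)); rewrite ?sB.
  - exact: latticeB.
  - exact: rpredB.
  - exact: half_intB.
  - exact: half_intB.
  - by rewrite addrAC rpredB.
move: i i3 zi hhz {hi}; apply: ord5P => // _ zi hhz.
- by case: (ww z) => //; apply: hhz.
- have [a b] : half_int (z 0 (o 0)) /\ half_int (z 0 (o 2)) by split; apply: hhz.
  apply: code_lattice_congr (cy); apply: ord5P.
  + exact: half_intB.
  + exact: rpredB.
  + exact: half_intB.
  + exact: rpredB.
  + exact: rpredB.
- have [a b] : half_int (z 0 (o 0)) /\ half_int (z 0 (o 1)) by split; apply: hhz.
  (* The patterns of z and y combine to that of u, which was just excluded. *)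
  case: (ww (z - y)); rewrite ?sB.
  + exact: latticeB.
  + exact: half_intB.
  + by rewrite /half_int addrAC rpredB.
  + rewrite /half_int; have -> : z 0 (o 2) - y 0 (o 2) - 2^-1 = z 0 (o 2) - (y 0 (o 2) - 2^-1) - 1.
      by field.
    by apply: rpredB (rpred1 _); exact: rpredB.
  + exact: rpredB.
Qed.

Lemma family_points m : (0 < m)%N ->
  (exists2 u, G u & u 0 (o 3) - m%:R^-1 \is a Num.int) ->
  (forall x, G x -> exists k : nat, x 0 (o 3) - k%:R / m%:R \is a Num.int) ->
  ~ G (tail_point R m) ->
  ~~ odd m /\ exists i j : 'I_5, [/\ (i < 3)%N, (j < 3)%N, j != i & exists u y,
    [/\ G u, u 0 i \is a Num.int, forall k : 'I_5, (k < 3)%N -> k != i -> half_int (u 0 k) &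
        u 0 (o 3) - m%:R^-1 \is a Num.int] /\
    [/\ G y, y 0 j \is a Num.int, forall k : 'I_5, (k < 3)%N -> k != j -> half_int (y 0 k) &
        y 0 (o 3) \is a Num.int]].
Proof.
move=> m0 [u hu u3] hk ht; have m0' : m%:R != 0 :> R by rewrite pnatr_eq0 -lt0n.
have [h|[i i3 [ui un]]] := cases3 hI hu.
  by case: ht; apply: tail_point_mem hu _ _ _ u3; apply: h.
have uh (k : 'I_5) : (k < 3)%N -> k != i -> half_int (u 0 k).
  by move=> k3 ki; apply: (half3 hI hu k3); exact: un.
split.
  (* For odd m the even multiple - (m - 1) u is integral on the covering coordinates, and its
     coordinate 3 is 1/m modulo Z: it would be the tail point. *)
  apply/negP => om; case: ht; have mE : m = (m./2 * 2 + 1)%N by rewrite -[LHS]odd_double_half om; lia.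
  have hi (k : 'I_5) : (k < 3)%N -> (u *- (m./2 * 2)) 0 k \is a Num.int.
    move=> k3; rewrite mxE mulmxnE rpredN mulnC mulrnA rpredMn //.
    have [->|ki] := eqVneq k i; first by rewrite rpredMn.
    by rewrite mulr2n half_intD // uh.
  apply: (@tail_point_mem m (u *- (m./2 * 2))).
  - by rewrite -[u *- _]add0r; apply: latticeB; [exact: lattice0|exact: latticeMn].
  - exact: hi.
  - exact: hi.
  - exact: hi.
  - rewrite mxE mulmxnE.
    have -> : - (u 0 (o 3) *+ (m./2 * 2)) - m%:R^-1 =
        - ((u 0 (o 3) - m%:R^-1) *+ (m./2 * 2)) - 1.
      have e : m%:R = (m./2 * 2)%N%:R + 1 :> R by rewrite {1}mE natrD.
      rewrite -[u 0 _ *+ _]mulr_natr -[(_ - _) *+ _]mulr_natr.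
      have -> : (m./2 * 2)%N%:R = m%:R - 1 :> R by rewrite e addrK.
      by field.
    by apply: rpredB (rpred1 _); rewrite rpredN rpredMn.
(* Any covering coordinate other than i will do. The witness at j0 is not integral at i, while u is,
   so correcting coordinate 3 by a multiple of u leaves a y not integral at i; its integral covering
   coordinate j need not be j0. *)
pose j0 : 'I_5 := if i == o 0 then o 1 else o 0.
have j03 : (j0 < 3)%N by rewrite /j0; case: ifP.
have j0i : j0 != i by rewrite /j0; have [->|] := eqVneq i (o 0) => //; rewrite eq_sym.
have [_ /(_ j0)[|p hp pj]] := hI; first by rewrite inE.
have [k pk] := hk _ hp; set y := p - u *+ k.
have hy : G y by apply: latticeB => //; exact: latticeMn.
have yE a : y 0 a = p 0 a - u 0 a *+ k by rewrite mxE [X in _ + X]mxE mulmxnE.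
have y3 : y 0 (o 3) \is a Num.int.
  have -> : y 0 (o 3) = (p 0 (o 3) - k%:R / m%:R) - (u 0 (o 3) - m%:R^-1) *+ k.
    rewrite yE -[u 0 _ *+ k]mulr_natr -[(_ - _) *+ k]mulr_natr; ring.
  by rewrite rpredB // rpredMn.
have yi : y 0 i \isn't a Num.int.
  rewrite yE rpredBr ?rpredMn //; apply/negP => pi; case/eqP: j0i.
  by rewrite (pj i) ?inE.
have [h|[j j3 [yj yn]]] := cases3 hI hy; first by rewrite h in yi.
have ji : j != i by apply: contraNneq yi => <-.
exists i, j; split=> //; exists u, y; split; split=> // a a3 aj.
by apply: (half3 hI hy a3); exact: yn.
Qed.

End Family.

Lemma classify3 (R : realType) (V : 'M[int]_(5, 4)) :
  lattice_simplex R V -> minimal_cover R V (segment 3) ->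
  is_free_join (polytope R V) \/ exists s h, (0 < h)%N /\
    simplex_lattice R (row_perm s V) = code_lattice R (2 * h) (family_gens h).
Proof.
move=> hV hI; have [m m0 [hu hk]] := cyclic_coordinate hV (o 3).
have [ht|ht] := pselect (simplex_lattice R V (tail_point R m)).
  left; apply: (product_free_join m0 hV); exact: (product_case hI m0 ht hk).
right; have [om [i [j [i3 j3 ji [u [y [[Gu ui uh u3] [Gy yj yh y3]]]]]]]] :=
  family_points hI m0 hu hk ht.
have mE : m = (2 * m./2)%N by rewrite -[LHS]odd_double_half (negPf om); lia.
(* The covering indices 0, 1, 2 add up to 3, so [3 - i - j] is the one that remains. *)
have [|s hs] := @perm_of_iota 5 [:: val i; val j; 3 - i - j; 3; 4]%N.
  by move: i j i3 j3 ji {ui uh yj yh}; do 2 apply: ord5P => //.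
have s0 : s (o 0) = i by apply: val_inj; rewrite /= -hs.
have s1 : s (o 1) = j by apply: val_inj; rewrite /= -hs.
have s3 : s (o 3) = o 3 by apply: val_inj; rewrite /= -hs.
have s4 : s (o 4) = o 4 by apply: val_inj; rewrite /= -hs.
have [s2 s2i s2j] : [/\ (s (o 2) < 3)%N, s (o 2) != i & s (o 2) != j].
  split; first by rewrite -hs /=; move: ji i3 j3; rewrite -(inj_eq val_inj) /=; lia.
    by rewrite -s0 (inj_eq perm_inj).
  by rewrite -s1 (inj_eq perm_inj).
have hI' : minimal_cover R (row_perm s V) (segment 3).
  have -> : segment 3 = [set a | s a \in segment 3].
    apply/setP => a; rewrite !inE; move: a; apply: ord5P.
    - by rewrite s0 i3.
    - by rewrite s1 j3.
    - by rewrite s2.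
    - by rewrite s3.
    - by rewrite s4.
  exact: minimal_cover_row_perm.
have h0 : (0 < m./2)%N by move: m0 mE; lia.
exists s, m./2; split=> //.
have pE (x : 'rV[R]_5) a : col_perm s x 0 a = x 0 (s a) by rewrite mxE.
apply: (@family_case _ _ hI' _ (col_perm s u) (col_perm s y) h0); rewrite -?mE.
- move=> x; rewrite lattice_row_permE => -[z /hk[k hz] <-]; exists k.
  by rewrite pE s3.
- move=> h; apply: ht; move: h; set t := tail_point R m.
  have e : t = col_perm s t; last by rewrite {1}e => /lattice_row_perm.
  apply/rowP; apply: ord5P; rewrite pE.
  + by rewrite s0 /t !mxE; case: (nat_of_ord i) i3 => [|[|[|]]].
  + by rewrite s1 /t !mxE; case: (nat_of_ord j) j3 => [|[|[|]]].
  + by rewrite /t !mxE; case: (nat_of_ord (s _)) s2 => [|[|[|]]].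
  + by rewrite s3.
  + by rewrite s4.
- exact/lattice_row_perm.
- by rewrite pE s0.
- by rewrite pE s1; apply: uh.
- by rewrite pE; apply: uh.
- by rewrite pE s3.
- exact/lattice_row_perm.
- by rewrite pE s0; apply: yh => //; rewrite eq_sym.
- by rewrite pE s1.
- by rewrite pE; apply: yh.
- by rewrite pE s3.
Qed.

(** A witness at coordinate 0 would have a support of one element, which is impossible. *)
Lemma cover2_false (R : realType) (V : 'M[int]_(5, 4)) : ~ minimal_cover R V (segment 2).
Proof.
move=> hI; have [hc /(_ (o 0))[|x hx hi]] := hI; first by rewrite inE.
have [i i2 xi] := hc _ hx; have i0 := hi _ i2 xi; rewrite i0 in xi.
have s0 : support (segment 2) x = finset.set0.
  apply: (support_le1 hI hx); apply/card_le1_eqP => a b; rewrite !inE.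
  have e (c : 'I_5) : (c < 2)%N && (x 0 c \isn't a Num.int) -> c = o 1.
    move=> /andP[c2 xc]; apply: val_inj => /=; apply/eqP; move: xc; apply: contraNT => c1.
    by have -> // : c = o 0; apply: val_inj => /=; lia.
  by move=> /e -> /e ->.
have x1 : x 0 (o 1) \is a Num.int by apply: (support0_int s0); rewrite inE.
by have : o 1 = o 0 by apply: hi => //; rewrite inE.
Qed.

(** * Assembling the classification *)

Lemma codes5_sporadic c : c \in codes5 -> exists i : 'I_6,
  c = (data_modulus (tnth sporadic i), data_gens (tnth sporadic i)).
Proof.
rewrite !inE => /or4P[] /eqP ->.
- by exists (@Ordinal 6 0 isT).
- by exists (@Ordinal 6 3 isT).
- by exists (@Ordinal 6 4 isT).
- by exists (@Ordinal 6 5 isT).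
Qed.

Lemma codes4_sporadic R c : c \in codes4 -> exists i : 'I_6,
  [set col_perm (tperm (o 0) (o 4)) x | x in code_lattice R c.1 c.2]%classic =
    code_lattice R (data_modulus (tnth sporadic i)) (data_gens (tnth sporadic i)).
Proof.
have hp g h N : size g = size h ->
  [seq [:: nth 0 r 4; nth 0 r 1; nth 0 r 2; nth 0 r 3; nth 0 r 0]%N | r <- g] = h ->
  [set col_perm (tperm (o 0) (o 4)) x | x in code_lattice R N g]%classic =
    code_lattice R N h.
  move=> s e; apply: code_lattice_perm => // i j ig.
  rewrite -e (nth_map [::]) //; move: j; apply: ord5P.
  - by rewrite tpermL.
  - by rewrite tpermD.
  - by rewrite tpermD.
  - by rewrite tpermD.
  - by rewrite tpermR.
rewrite !inE => /orP[] /eqP ->.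
- by exists (@Ordinal 6 1 isT); apply: hp.
- by exists (@Ordinal 6 2 isT); apply: hp.
Qed.

Lemma sporadic_lattice (R : realType) (V : 'M[int]_(5, 4)) s (i : 'I_6) : lattice_simplex R V ->
  simplex_lattice R (row_perm s V) =
    code_lattice R (data_modulus (tnth sporadic i)) (data_gens (tnth sporadic i)) ->
  has_data R V (tnth sporadic i).
Proof.
move=> hV h; have [_ hd] := sporadic_data (simplex_row_perm s hV) h.
exact: has_data_row_perm hd.
Qed.

Section Classification.
Variables (R : realType) (V : 'M[int]_(5, 4)).
Hypothesis hV : lattice_simplex R V.
Local Notation G := (simplex_lattice R V).

Theorem thin_classification : thin R V ->
  [\/ is_free_join (polytope R V), exists i : 'I_6, has_data R V (tnth sporadic i) |
      exists2 h, (0 < h)%N & has_data R V (thin_family (2 * h))].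
Proof.
move=> /thin_lattice ht.
have [I hI] : exists I, minimal_cover R V I.
  apply: (@minimal_cover_exists _ _ _ (~: finset.set0)) => x /ht[i xi]; exists i => //.
  by rewrite !inE.
have [s] := minimal_cover_segment hI.
have : (#|I| <= 5)%N by rewrite -[X in (_ <= X)%N]card_ord max_card.
move: #|I| => n n5 hs; move: n5.
case: n hs => [|[|[|[|[|[|//]]]]]] hs _.
- have [hc _] := hs; have [i] := hc _ (lattice0 _ _).
  by rewrite inE.
- constructor 1; rewrite -(polytope_row_perm R s V).
  apply: (@pyramid_free_join _ _ (o 0) (simplex_row_perm s hV)) => x hx.
  have [hc _] := hs; have [i] := hc _ hx; rewrite inE ltnS leqn0 => /eqP i0.
  by have -> : i = o 0 by exact: val_inj.
- by case: (cover2_false hs).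
- have [hf|[t [h [h0 hG]]]] := classify3 (simplex_row_perm s hV) hs.
    by constructor 1; rewrite -(polytope_row_perm R s V).
  constructor 3; exists h => //.
  have [_ hd] := family_data h0 (simplex_row_perm t (simplex_row_perm s hV)) hG.
  exact: has_data_row_perm (has_data_row_perm hd).
- have [t [c [hc hG]]] := classify4 hs; constructor 2.
  have hs' := simplex_row_perm t (simplex_row_perm s hV).
  have [i hi] := codes4_sporadic R hc.
  exists i; do 2 apply: has_data_row_perm; apply: (sporadic_lattice hs' (s := tperm (o 0) (o 4))).
  by rewrite lattice_row_permE hG.
- have [t [c [hc hG]]] := classify5 hs; constructor 2.
  have hs' := simplex_row_perm t (simplex_row_perm s hV).
  have [i hi] := codes5_sporadic hc; exists i.
  have [|_ hd] := @sporadic_data _ _ i hs'; first by rewrite hG hi.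
  exact: has_data_row_perm (has_data_row_perm hd).
Qed.

End Classification.

(** * Existence *)

Section Realization.
Variable R : realType.
Variables (N : nat) (g : seq (seq nat)) (s K : seq (seq int)) (C : seq (seq nat)).

(* Rows of four entries are read with default value 1, so that the fifth column
   of the table is that of the homogeneous coordinates. *)
Definition table_entry i j : int := nth 1 (nth [::] s i) j.
Definition table_simplex : 'M[int]_(5, 4) := \matrix_(i, j) table_entry i j.

Local Notation H := table_entry.
Local Notation Kt i j := (nth 0 (nth [::] K i) j).
Local Notation gt i j := (nth 0%N (nth [::] g i) j).
Local Notation Ct i j := (nth 0%N (nth [::] C i) j).

Hypothesis N0 : (0 < N)%N.
Hypothesis hs : forall i : 'I_5, H i 4 = 1.
Hypothesis hK : forall i k : 'I_5, \sum_(j < 5) H i j * Kt j k = N%:Z *+ (i == k).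
Hypothesis hC : forall j k : 'I_5,
  (N %| Kt j k - (\sum_(r < size g) Ct j r * gt r k)%N%:Z)%Z.
Hypothesis hg : forall (r : 'I_(size g)) (j : 'I_5), (N %| \sum_(i < 5) (gt r i)%:Z * H i j)%Z.

Definition table_form (x : 'rV[R]_5) (j : nat) : R := \sum_i x 0 i * (H i j)%:~R.

Lemma table_form4 (x : 'rV[R]_5) : table_form x 4 = \sum_i x 0 i.
Proof. by apply: eq_bigr => i _; rewrite hs mulr1. Qed.

Lemma table_form_mx (x : 'rV[R]_5) (j : 'I_4) :
  \sum_i x 0 i * (table_simplex i j)%:~R = table_form x j.
Proof. by apply: eq_bigr => i _; rewrite [table_simplex _ _]mxE. Qed.

Lemma table_inverse (x : 'rV[R]_5) (k : 'I_5) :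
  \sum_(j < 5) table_form x j * (Kt j k)%:~R = x 0 k * N%:R.
Proof.
transitivity (\sum_(i < 5) x 0 i * (\sum_(j < 5) H i j * Kt j k)%:~R).
  under eq_bigr do rewrite mulr_suml; rewrite exchange_big; apply: eq_bigr => i _ /=.
  rewrite rmorph_sum mulr_sumr; apply: eq_bigr => j _ /=.
  by rewrite intrM mulrA.
rewrite (bigD1 k) //= hK eqxx big1 ?addr0 // => i ik.
by rewrite hK (negbTE ik) mulr0.
Qed.

Lemma table_lattice (x : 'rV[R]_5) : simplex_lattice R table_simplex x <->
  forall j : 'I_5, table_form x j \is a Num.int.
Proof.
rewrite lattice_columns; split=> [[h1 h2]|h].
  move=> j; have [j4|j4] := ltnP j 4.
    by rewrite -(table_form_mx x (Ordinal j4)).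
  have -> : j = o 4 by apply: val_inj => /=; have := ltn_ord j; lia.
  by rewrite table_form4.
split=> [j|]; last by rewrite -table_form4; apply: (h (o 4)).
by rewrite table_form_mx; apply: (h (widen_ord (isT : 4 <= 5)%N j)).
Qed.

Lemma table_simplexP : lattice_simplex R table_simplex.
Proof.
apply: row_free_lattice => x h1 h2; apply/rowP => k; rewrite [RHS]mxE.
have N0' : N%:R != 0 :> R by rewrite pnatr_eq0 -lt0n.
apply: (mulIf N0'); rewrite -table_inverse mul0r big1 // => j _.
have [j4|j4] := ltnP j 4.
  by rewrite -(table_form_mx x (Ordinal j4)) h1 mul0r.
have -> : j = o 4 by apply: val_inj => /=; have := ltn_ord j; lia.
by rewrite table_form4 h2 mul0r.
Qed.

(** By [hg] the code generators lie in the lattice. Conversely [hK] makes N x the combination of the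
    rows of K with the integral coefficients [table_form x j], and [hC] expresses these rows modulo
    N by the generators. *)
Lemma table_code : simplex_lattice R table_simplex = code_lattice R N g.
Proof.
have N0' : N%:R != 0 :> R by rewrite pnatr_eq0 -lt0n.
apply/seteqP; split=> x; last first.
  apply: code_lattice_sub => r /(nthP [::])[i ig <-]; apply/table_lattice => j.
  have /dvdzP[q hq] := hg (Ordinal ig) j.
  suff -> : table_form (residue_vec R N (nth [::] g i)) j = q%:~R by rewrite intr_int.
  apply: (mulIf N0'); rewrite [N%:R in RHS]pmulrn -intrM -hq rmorph_sum mulr_suml.
  apply: eq_bigr => k _; rewrite [residue_vec _ _ _ _ _]mxE /= intrM -pmulrn.
  by rewrite mulrAC divfK.
move=> /table_lattice hx.
have [z hz] : exists z : 'I_5 -> int, forall j : 'I_5, table_form x j = (z j)%:~R.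
  by exists (fun j => Num.floor (table_form x j)) => j; rewrite floorK.
have N0z : N%:Z != 0 by rewrite eqz_nat -lt0n.
(* Coefficients in [code_lattice] are natural numbers, so the integers z are replaced by their
   residues modulo N. *)
pose n (j : 'I_5) := absz (modz (z j) N).
have nE j : ((n j)%:Z = z j - divz (z j) N * N)%R.
  by rewrite /n gez0_abs ?modz_ge0 // {2}(divz_eq (z j) N) addrC addKr.
exists (fun r => \sum_(j < 5) n j * Ct j r)%N => k.
have -> : x 0 k - \sum_(i < size g) residue_vec R N (nth [::] g i) 0 k *+ (\sum_(j < 5) n j * Ct j i)
    = (\sum_(j < 5) z j * Kt j k - (\sum_(i < size g) gt i k * (\sum_(j < 5) n j * Ct j i))%N%:Z)%:~R / N%:R.
  apply: (mulIf N0'); rewrite divfK // mulrBl -table_inverse intrB rmorph_sum mulr_suml.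
  congr (_ - _); first by apply: eq_bigr => j _ /=; rewrite hz intrM.
  rewrite -pmulrn natr_sum; apply: eq_bigr => i _; rewrite mxE natrM -mulrnAl divfK //.
  by rewrite -mulr_natr.
set e := (X in X%:~R / _); suff /dvdzP[q ->] : (N %| e)%Z.
  by rewrite intrM mulfK // intr_int.
have -> : e = \sum_(j < 5) ((divz (z j) N * Kt j k) * N +
    (n j)%:Z * (Kt j k - (\sum_(r < size g) Ct j r * gt r k)%N%:Z)).
  rewrite /e; have -> : (\sum_(i < size g) gt i k * (\sum_(j < 5) n j * Ct j i))%N =
     (\sum_(j < 5) n j * \sum_(r < size g) Ct j r * gt r k)%N.
    under eq_bigr do rewrite big_distrr /=; rewrite exchange_big /=; apply: eq_bigr => j _.
    by rewrite big_distrr; apply: eq_bigr => i _ /=; lia.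
  rewrite -[X in _ - X]natz natr_sum -sumrB; apply: eq_bigr => j _.
  by rewrite natrM !natz nE; ring.
by apply: rpred_sum => j _; rewrite rpredD // dvdz_mull // hC.
Qed.

Lemma table_realizes : lattice_simplex R table_simplex /\
  simplex_lattice R table_simplex = code_lattice R N g.
Proof. by split; [exact: table_simplexP|exact: table_code]. Qed.

End Realization.

Section Existence.
Variable R : realType.

Lemma ord55P (P : 'I_5 -> 'I_5 -> Prop) :
  (forall j, P (o 0) j) -> (forall j, P (o 1) j) -> (forall j, P (o 2) j) ->
  (forall j, P (o 3) j) -> (forall j, P (o 4) j) -> forall i j, P i j.
Proof. by move=> p0 p1 p2 p3 p4; apply: ord5P. Qed.

(* Vertices V, the matrix N (V, 1)^-1, whose rows generate N G, and the coefficients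
   that express these rows by the code generators. *)
Definition sporadic_tables : seq (seq (seq int) * seq (seq int) * seq (seq nat)) :=
  [:: ([:: [:: -1; 1; -1; 1]; [:: 1; -1; 1; -1]; [:: 1; 1; -1; 1]; [:: 1; 1; 1; -1];
           [:: 1; 1; 1; 1]],
       [:: [:: -1; 0; 1; 0; 0]; [:: 0; -1; 0; 1; 0]; [:: 0; 0; -1; 0; 1]; [:: 0; 0; 0; -1; 1];
           [:: 1; 1; 0; 0; 0]],
       [:: [:: 1; 1; 0; 0]; [:: 0; 1; 1; 0]; [:: 0; 0; 1; 1]; [:: 0; 0; 0; 1]; [:: 1; 0; 0; 0]]%N);
      ([:: [:: 0; 1; -1; 1]; [:: -1; 1; 0; 0]; [:: -1; 0; -1; 0]; [:: 0; 0; 1; 1];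
          [:: 1; 0; 0; -1]],
       [:: [:: 1; -1; -1; 0; 1]; [:: 1; 2; -2; -1; 0]; [:: -1; 1; -1; 1; 0];
           [:: 1; -1; 0; 1; -1]; [:: 0; 0; 1; 1; 1]],
       [:: [:: 2; 1]; [:: 1; 1]; [:: 2; 2]; [:: 0; 1]; [:: 1; 0]]%N);
      ([:: [:: 1; -1; 0; 1]; [:: -1; -1; 0; 0]; [:: 0; 0; -1; 1]; [:: 0; 0; -1; -1];
          [:: 0; 0; 1; 0]],
       [:: [:: 2; -2; -1; 1; 0]; [:: -2; -2; 2; 0; 2]; [:: 0; 0; -1; -1; 2];
           [:: 0; 0; 2; -2; 0]; [:: 0; 0; 1; 1; 2]],
       [:: [:: 0; 3]; [:: 1; 1]; [:: 1; 2]; [:: 0; 2]; [:: 1; 0]]%N);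
      ([:: [:: 2; 1; -1; 1]; [:: 0; 0; -1; 1]; [:: 0; 1; 0; -1]; [:: 0; 0; 1; 1];
          [:: 0; -1; 0; -1]],
       [:: [:: 2; -2; -1; 0; 1]; [:: 0; 0; 2; 0; -2]; [:: 0; -2; 0; 2; 0];
           [:: 0; 1; -1; 1; -1]; [:: 0; 1; 1; 1; 1]],
       [:: [:: 2; 1]; [:: 0; 2]; [:: 2; 2]; [:: 1; 2]; [:: 1; 0]]%N);
      ([:: [:: 0; -2; -1; 1]; [:: 2; 0; -1; 0]; [:: 0; 0; -1; 1]; [:: 0; 0; -1; -1];
          [:: 0; 0; 1; 0]],
       [:: [:: 0; 2; -1; -1; 0]; [:: -2; 0; 2; 0; 0]; [:: 0; 0; -1; -1; 2];
           [:: 0; 0; 2; -2; 0]; [:: 0; 0; 1; 1; 2]],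
       [:: [:: 0; 0; 1]; [:: 1; 1; 3]; [:: 1; 0; 2]; [:: 0; 0; 2]; [:: 1; 0; 0]]%N);
      ([:: [:: -1; 0; 0; 0]; [:: 1; 1; 0; 1]; [:: 1; -1; -1; 1]; [:: 1; 0; 1; 0];
          [:: 1; 1; -1; -1]],
       [:: [:: -4; 0; 1; 2; 1]; [:: 0; 4; -3; -2; 1]; [:: 0; 0; -2; 4; -2];
           [:: 0; 4; 1; -2; -3]; [:: 4; 0; 1; 2; 1]],
       [:: [:: 1; 0]; [:: 5; 1]; [:: 6; 0]; [:: 1; 1]; [:: 1; 0]]%N)].

Lemma sporadic_realization (i : 'I_6) : exists V : 'M[int]_(5, 4), lattice_simplex R V /\
  simplex_lattice R V =
    code_lattice R (data_modulus (tnth sporadic i)) (data_gens (tnth sporadic i)).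
Proof.
pose t := nth ([::], [::], [::]) sporadic_tables i.
exists (table_simplex t.1.1); apply: (@table_realizes _ _ _ _ t.1.2 t.2); rewrite /t {t}.
- by case: i => -[|[|[|[|[|[|]]]]]].
- by case: i => -[|[|[|[|[|[|//]]]]]] ?; apply: ord5P.
- by case: i => -[|[|[|[|[|[|//]]]]]] ?; apply: ord55P; apply: ord5P; rewrite sum5.
- by case: i => -[|[|[|[|[|[|//]]]]]] ?; apply: ord55P; apply: ord5P; rewrite /= !big_ord_recl big_ord0.
- by case: i => -[|[|[|[|[|[|//]]]]]] ? [[|[|[|[|//]]]] ?] // ; apply: ord5P; rewrite sum5.
Qed.

Lemma family_realization h : (0 < h)%N -> exists V : 'M[int]_(5, 4), lattice_simplex R V /\
  simplex_lattice R V = code_lattice R (2 * h) (family_gens h).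
Proof.
move=> h0; pose a := h%:Z.
exists (table_simplex [:: [:: 0; 2; 0; -1]; [:: 0; 0; 1; 0]; [:: 0; 0; 0; 1];
                          [:: 2 * a; 0; - a; - a]; [:: 0; 0; 0; 0]]).
(* Modulo 2 h the first two rows of this multiple of the inverse are the second and the first
   generator, and the other rows vanish; this dictates the table of coefficients. *)
apply: (@table_realizes _ _ _ _
  [:: [:: 0; a; a; 1; -1 - 2 * a]; [:: a; 0; a; 0; - (2 * a)]; [:: 0; 2 * a; 0; 0; - (2 * a)];
      [:: 0; 0; 2 * a; 0; - (2 * a)]; [:: 0; 0; 0; 0; 2 * a]]
  [:: [:: 0; 1]; [:: 1; 0]; [:: 0; 0]; [:: 0; 0]; [:: 0; 0]]%N).
- by rewrite muln_gt0.
- exact: ord5P.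
- by apply: ord55P; apply: ord5P; rewrite sum5 /table_entry /= /a ?mulr0n ?mulr1n; lia.
- apply: ord55P; apply: ord5P; rewrite /= !big_ord_recl big_ord0 /= /a;
    apply/dvdzP; first [by exists 0; lia|by exists 1; lia|by exists (-1); lia|by exists 2; lia|
                        by exists (-2); lia].
- move=> [[|[|//]] ?]; apply: ord5P; rewrite sum5 /table_entry /= /a;
    apply/dvdzP; first [by exists 0; lia|by exists 1; lia|by exists (-1); lia|by exists 2; lia|
                        by exists (-2); lia].
Qed.

End Existence.

Theorem theorem1p3 (R : realType) :
  (forall V : 'M[int]_(5, 4),
     lattice_simplex R V -> thin R V -> ~ is_free_join (polytope R V) ->
     (exists i : 'I_6, has_data R V (tnth sporadic i)) \/
     (exists N : nat, [/\ (2 <= N)%N, ~~ odd N & has_data R V (thin_family N)])) /\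
  (forall i : 'I_6, exists V : 'M[int]_(5, 4),
     [/\ lattice_simplex R V, thin R V & has_data R V (tnth sporadic i)]) /\
  (forall N : nat, (2 <= N)%N -> ~~ odd N -> exists V : 'M[int]_(5, 4),
     [/\ lattice_simplex R V, thin R V & has_data R V (thin_family N)]).
Proof.
split; [move=> V hV ht hf|split=> [i|N N2 oN]].
- have [//|h|[h h0 hd]] := thin_classification hV ht; [by left|right].
  by exists (2 * h)%N; split=> //; [lia|rewrite oddM].
- have [V [hV hG]] := sporadic_realization R i; exists V.
  by have [ht hd] := sporadic_data hV hG.
- have NE : N = (2 * N./2)%N by rewrite -[LHS]odd_double_half (negPf oN); lia.
  have h0 : (0 < N./2)%N by lia.
  have [V [hV hG]] := family_realization R h0; exists V.
  by have [ht hd] := family_data h0 hV hG; rewrite NE.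
Qed.
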